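(* Let $E,C>0$ and for $n\in\mathbb N$ let $u_n\in AC([0,T];V)$, $\tilde u_n:[0,T]\to D_E$ and $\xi_n:[0,T]\to V^*$ measurable, and $\varepsilon_n\in(0,\infty)$ be such that $$\int_0^T\Big(\Psi_{\varepsilon_n}(\dot u_n)+\Psi^*_{\varepsilon_n}(\xi_n)\Big)dt\le C,\qquad\xi_n(t)\in-\partial\mathcal E_t(\tilde u_n(t))\ \text{ for a.a. }t\in(0,T),$$ $$\sup_{t\in[0,T]}\|u_n(t)-\tilde u_n(t)\|\to0,\qquad\varepsilon_n\downarrow0\qquad\text{as }n\to\infty.$$ Then there exist a (not relabeled) subsequence and a limit function $u\in BV([0,T];D_E,\Psi)$ such that $u_n(t)\to u(t)$ in $V$ for all $t\in[0,T]$, $u$ satisfies the local stability condition $K^*+\partial\mathcal E_t(u(t))\ni0$ for all $t\in[0,T]\setminus J_u$, and $$\liminf_{n\to\infty}\int_r^s\Big(\Psi_{\varepsilon_n}(\dot u_n(t))+\Psi^*_{\varepsilon_n}(\xi_n(t))\Big)dt\ge\mathrm{Var}_{\mathfrak f}(u;[r,s])\qquad\text{for every }0\le r<s\le T.$$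
   Context: Setting. $(V,\|\cdot\|)$ is a separable Banach space with the Radon–Nikodym property, $V^*$ its dual with norm $\|\cdot\|_*$ and pairing $\langle\cdot,\cdot\rangle$, $T>0$. $\Psi,\Phi:V\to[0,\infty)$ are continuous, convex, strictly positive on $V\setminus\{0\}$; $\Psi(\lambda v)=\lambda\Psi(v)$ for $\lambda\ge0$; $\Phi(v)=F(\|v\|)$ with $F\in C^1([0,\infty))$ convex, $F(r)>0$ for $r>0$, $F(0)=F'(0)=0$, $\lim_{r\to\infty}F'(r)=+\infty$. ($\Psi$ need be neither symmetric nor coercive.) For $\varepsilon>0$ put $\Psi_\varepsilon(v)=\Psi(v)+\varepsilon^{-1}\Phi(\varepsilon v)$, $\Psi^*_\varepsilon(\xi)=\sup_{v\in V}(\langle\xi,v\rangle-\Psi_\varepsilon(v))$; $K^*=\{\xi\in V^*:\langle\xi,w\rangle\le\Psi(w)\ \forall w\in V\}$; $\Psi_\wedge(w)=\min(\Psi(w),\Psi(-w))$. Energy. $D\subset V$ and $\mathcal E:[0,T]\times D\to\mathbb R$, $(t,u)\mapsto\mathcal E_t(u)$, is lower semicontinuous, with $\mathcal E_t(u)=+\infty$ if $u\notin D$. The Fréchet subdifferential $\partial\mathcal E_t(u)$, $u\in D$, is the set of $\xi\in V^*$ with $\mathcal E_t(v)-\mathcal E_t(u)-\langle\xi,v-u\rangle\ge o(\|v-u\|)$ as $v\to u$. Assume: (i) with $\mathcal G(u)=\Psi(u)+\sup_{t\in[0,T]}\mathcal E_t(u)$, the sets $D_E=\{u\in D:\mathcal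 G(u)\le E\}$ are compact in $V$ for all $E>0$; (ii) for all $u\in D$, $t\mapsto\mathcal E_t(u)$ is differentiable on $[0,T]$ with derivative $\mathcal P_t(u)$, and there is $C_P\ge0$ with $|\mathcal P_t(u)|\le C_P(\Psi(u)+\mathcal E_t(u))$ and $\limsup_{w\to u,\,w\in D_E}\mathcal P_t(w)\le\mathcal P_t(u)$ for all $(t,u)\in(0,T)\times D$, $E>0$; (iii) for every $E>0$ there is an upper semicontinuous $\omega^E:[0,T]\times D_E\times D_E\to\mathbb R$ with $\omega^E_t(u,u)=0$ and $\mathcal E_t(v)\ge\mathcal E_t(u)+\langle\xi,v-u\rangle-\omega^E_t(u,v)\Psi_\wedge(v-u)$ for all $t\in[0,T]$, $u,v\in D_E$, $\xi\in\partial\mathcal E_t(u)$. Curves. For $Z\subset V$, $AC([a,b];Z,\Psi)$ is the set of $u:[a,b]\to Z$ for which there is $0\le m\in L^1(a,b)$ with $\Psi(u(t_1)-u(t_0))\le\int_{t_0}^{t_1}m\,ds$ for $a\le t_0<t_1\le b$; then $\Psi[u'](t)=\lim_{h\to0}\Psi((u(t+h)-u(t))/h)$ exists a.e. $\mathrm{Var}_\Psi(u;[a,b])=\sup\sum_m\Psi(u(t_m)-u(t_{m-1}))$ over finite partitions of $[a,b]$; $BV([0,T];Z,\Psi)$ is the set of $u:[0,T]\to Z$ with $\mathrm{Var}_\Psi(u;[0,T])<\infty$. For $u\in BV([0,T];D_E,\Psi)$ the one-sided limits $u(t_\pm)$ exist in $V$ ($u(0_-):=u(0)$, $u(T_+):=u(T)$);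 $J_u=\{t:u(t_-)\ne u(t)\text{ or }u(t)\ne u(t_+)\}$. Finsler cost (conventions $\inf\emptyset=+\infty$, $0\cdot\infty=0$). $\mathfrak e_t(u)=\inf\{\|\xi-z\|_*:\xi\in-\partial\mathcal E_t(u),\,z\in K^*\}$. For $u_0,u_1\in D$, $\mathcal T_t(u_0,u_1)$ is the set of $\vartheta\in AC([0,1];D_E,\Psi)$ (for some $E>0$) with $\vartheta(0)=u_0$, $\vartheta(1)=u_1$ that are locally absolutely continuous in $V$ on the relatively open set $G_t[\vartheta]=\{r\in[0,1]:\mathfrak e_t(\vartheta(r))>0\}$. Put $\mathfrak f_t[\vartheta,\vartheta'](r)=\Psi(\dot\vartheta(r))+\mathfrak e_t(\vartheta(r))\|\dot\vartheta(r)\|$ if $r\in G_t[\vartheta]$, and $=\Psi[\vartheta'](r)$ otherwise, and $\Delta_{\mathfrak f_t}(u_0,u_1)=\inf_{\vartheta\in\mathcal T_t(u_0,u_1)}\int_0^1\mathfrak f_t[\vartheta,\vartheta'](r)\,dr$. For $u\in BV([0,T];D_E,\Psi)$, $\mathrm{Jmp}_{\mathfrak f}(u;[a,b])=\Delta_{\mathfrak f_a}(u(a),u(a_+))+\Delta_{\mathfrak f_b}(u(b_-),u(b))+\sum_{t\in J_u\cap(a,b)}(\Delta_{\mathfrak f_t}(u(t_-),u(t))+\Delta_{\mathfrak f_t}(u(t),u(t_+)))$; $\mathrm{Jmp}_\Psi$ is defined in the same way with $\Psi(u_1-u_0)$ in place of $\Delta_{\mathfrak f_t}(u_0,u_1)$;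 $\mathrm{Var}_{\mathfrak f}(u;[a,b])=\mathrm{Var}_\Psi(u;[a,b])-\mathrm{Jmp}_\Psi(u;[a,b])+\mathrm{Jmp}_{\mathfrak f}(u;[a,b])$. *)

(* Defs.v *)
From HB Require Import structures.
Set Warnings "-notation-overridden,-ambiguous-paths,-notation-incompatible-prefix,-deprecated".
From mathcomp Require Import all_boot all_order all_algebra.
From mathcomp Require Import all_classical all_reals all_analysis.
From mathcomp Require Import measurable_realfun.

Set Implicit Arguments.
Unset Strict Implicit.
Unset Printing Implicit Defensive.

Import Order.TTheory GRing.Theory Num.Theory.
Import numFieldNormedType.Exports.

Local Open Scope classical_set_scope.
Local Open Scope ring_scope.

Section generalities.
Context {R : realType}.
Local Notation mu := (@lebesgue_measure R).

(* In the topology of [subspace A] the points outside A are isolated, so only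
   the values of f on A matter. *)
Definition lsc_on {X : topologicalType} (A : set X) (f : X -> R) : Prop :=
  lower_semicontinuous (fun x : subspace A => (f x)%:E).

Definition usc_on {X : topologicalType} (A : set X) (f : X -> R) : Prop :=
  lsc_on A (fun x => - f x).

(* [l] is the derivative of f at x relative to A: at an endpoint of an interval
   A it is the one-sided derivative. *)
Definition is_derive_on {V : normedModType R} (A : set R) (f : R -> V) (x : R)
    (l : V) : Prop :=
  ((y - x)^-1 *: (f y - f x)) @[y --> within A x^'] --> l.

(* [completed_algebra_gen mu] consists of the Lebesgue measurable sets, whereas
   [measurable] on R denotes the Borel sets. *)
Definition lebesgue_measurable_on {X : topologicalType} (A : set R)
    (f : R -> X) : Prop :=
  forall O : set X, open O -> completed_algebra_gen mu (A `&` f @^-1` O).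

Definition separable (X : topologicalType) : Prop :=
  exists S : set X, countable S /\ dense S.

End generalities.

Section radon_nikodym_property.
Context {R : realType} {V : normedModType R}.
Context {d : measure_display} {Om : measurableType d}.
Implicit Types (mu : {finite_measure set Om -> \bar R}) (A : set Om).

Definition simple_map (s : Om -> V) : Prop :=
  finite_set (range s) /\ forall x : V, measurable (s @^-1` [set x]).

Definition simple_integral mu A (s : Om -> V) : V :=
  \sum_(x \in range s) fine (mu (A `&` s @^-1` [set x])) *: x.

(* [I] is the Bochner integral of g over A: its value does not depend on the
   choice of the approximating simple maps s. *)
Definition is_bochner_integral mu A (g : Om -> V) (I : V) : Prop :=
  exists s : nat -> Om -> V,
    [/\ forall n, simple_map (s n),
        {ae mu, forall x, s n x @[n --> \oo] --> g x},
        (\int[mu]_x (`|g x - s n x|)%:E)%E @[n --> \oo] --> 0%E &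
        simple_integral mu A (s n) @[n --> \oo] --> I].

Definition vector_measure (nu : set Om -> V) : Prop :=
  forall F : nat -> set Om, (forall i, measurable (F i)) -> trivIset setT F ->
    (\sum_(0 <= i < n) nu (F i)) @[n --> \oo] --> nu (\bigcup_i F i).

Definition bounded_vector_variation (nu : set Om -> V) : Prop :=
  exists M : R, forall (n : nat) (F : nat -> set Om),
    (forall i, measurable (F i)) -> trivIset setT F ->
    \sum_(0 <= i < n) `|nu (F i)| <= M.

Definition vector_dominates (nu : set Om -> V) mu : Prop :=
  forall A, measurable A -> mu A = 0%E -> nu A = 0.

End radon_nikodym_property.

(* The vector-measure form of the property (Diestel and Uhl). *)
Definition radon_nikodym_property {R : realType} (V : normedModType R) : Prop :=
  forall (d : measure_display) (Om : measurableType d)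
    (mu : {finite_measure set Om -> \bar R}) (nu : set Om -> V),
    vector_measure nu -> bounded_vector_variation nu ->
    vector_dominates nu mu ->
    exists g : Om -> V,
      forall A, measurable A -> is_bochner_integral mu A g (nu A).

Section dual.
Context {R : realType} {V : normedModType R}.

(* Elements of V^* are kept as plain functions, so that their sums and
   opposites are the pointwise ones. *)
Definition dual : set (V -> R^o) :=
  [set xi : V -> R^o | linear xi /\ continuous xi].

(* As V^* need not be separable, measurability of a V^*-valued map is taken in
   the weakest usual sense: it follows both from Bochner measurability and from
   measurability with respect to the norm-Borel sets of V^*. *)
Definition weakstar_measurable_on (A : set R) (xi : R -> V -> R^o) : Prop :=
  forall v : V, lebesgue_measurable_on A (fun t => xi t v).

Definition dual_norm (xi : V -> R^o) : \bar R :=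
  ereal_sup [set (`|xi v|)%:E | v in [set v : V | `|v| <= 1]].

End dual.

Section potentials.
Context {R : realType} {V : normedModType R}.
Implicit Types (Psi Phi : V -> R) (F : R -> R).

Record dissipation_potential Psi : Prop := {
  dp_cont : continuous Psi;
  dp_convex : convex_function [set: convex_lmodType V] Psi;
  dp_ge0 : forall v, 0 <= Psi v;
  dp_gt0 : forall v, v != 0 -> 0 < Psi v
}.

Definition positively_homogeneous Psi : Prop :=
  forall (l : R) (v : V), 0 <= l -> Psi (l *: v) = l * Psi v.

Record viscous_profile F : Prop := {
  vp_convex : convex_function (`[0, +oo[%classic : set R) F;
  vp_gt0 : forall r, 0 < r -> 0 < F r;
  vp_0 : F 0 = 0;
  vp_C1 : exists dF : R -> R,
    [/\ forall r, 0 <= r -> is_derive_on `[0, +oo[ (F : R -> R^o) r (dF r),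
        {within `[0, +oo[%classic, continuous dF},
        dF 0 = 0 &
        dF r @[r --> +oo] --> +oo]
}.

Definition Psi_eps Psi Phi (eps : R) (v : V) : R :=
  Psi v + eps^-1 * Phi (eps *: v).

Definition Psi_eps_conj Psi Phi (eps : R) (xi : V -> R^o) : \bar R :=
  ereal_sup (range (fun v : V => (xi v - Psi_eps Psi Phi eps v)%:E)).

Definition Kstar Psi : set (V -> R^o) :=
  [set xi | dual xi /\ forall w, xi w <= Psi w].

Definition Psi_wedge Psi (w : V) : R := Num.min (Psi w) (Psi (- w)).

End potentials.

(* A time-dependent energy is given by its domain D and a real-valued function
   En, of which only the values on `[0, T] * D are relevant. *)
Section energy.
Context {R : realType} {V : normedModType R}.
Context (Psi : V -> R) (T : R) (D : set V) (En : R -> V -> R).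

Definition energy (t : R) (u : V) : \bar R :=
  if `[< D u >] then (En t u)%:E else +oo%E.

Definition energy_sup (u : V) : \bar R :=
  ((Psi u)%:E + ereal_sup [set energy t u | t in `[0%R, T]])%E.

Definition sublevel (E : R) : set V :=
  [set u | D u /\ (energy_sup u <= E%:E)%E].

Definition subdiff (t : R) (u : V) : set (V -> R^o) :=
  [set xi | [/\ dual xi, D u &
    forall e : R, 0 < e -> \forall v \near u,
      ((- e * `|v - u|)%:E <=
         energy t v - energy t u - (xi (v - u))%:E)%E]].

Record admissible_energy : Prop := {
  en_lsc : lsc_on (`[0, T] `*` D) (fun p : R * V => En p.1 p.2);
  en_compact : forall E, 0 < E -> compact (sublevel E);
  en_power : exists P : R -> V -> R,
    (forall t u, t \in `[0, T] -> D u ->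
       is_derive_on `[0, T] (fun s => En s u : R^o) t (P t u)) /\
    exists2 CP : R, 0 <= CP &
      forall t u, t \in `]0, T[ -> D u ->
        `|P t u| <= CP * (Psi u + En t u) /\
        forall E, 0 < E ->
          (limf_esup (fun w => (P t w)%:E) (within (sublevel E) (nbhs u))
             <= (P t u)%:E)%E;
  en_subdiff : forall E, 0 < E -> exists omega : R -> V -> V -> R,
    [/\ usc_on (`[0, T] `*` sublevel E `*` sublevel E)
          (fun p : R * V * V => omega p.1.1 p.1.2 p.2),
        forall t u, t \in `[0, T] -> sublevel E u -> omega t u u = 0 &
        forall t u v xi, t \in `[0, T] -> sublevel E u -> sublevel E v ->
          subdiff t u xi ->
          En t u + xi (v - u) - omega t u v * Psi_wedge Psi (v - u) <= En t v]
}.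

End energy.

Section curves.
Context {R : realType} {V : normedModType R}.
Local Notation mu := (@lebesgue_measure R).
Implicit Types (Psi : V -> R) (u : R -> V).

Definition ac_curve (a b : R) (Z : set V) Psi u : Prop :=
  (forall t, t \in `[a, b] -> Z (u t)) /\
  exists m : R -> R,
    [/\ forall s, s \in `[a, b] -> 0 <= m s,
        mu.-integrable `[a, b] (EFin \o m) &
        forall t0 t1, a <= t0 -> t0 < t1 -> t1 <= b ->
          ((Psi (u t1 - u t0))%:E <= \int[mu]_(s in `[t0, t1]) (m s)%:E)%E].

Definition ac_norm (a b : R) u : Prop := ac_curve a b setT (fun v => `|v|) u.

Definition loc_ac_norm (G : set R) u : Prop :=
  forall c d, c <= d -> `[c, d] `<=` G -> ac_norm c d u.

(* The limit exists at almost every t when u is in [ac_curve a b Z Psi] for a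
   compact Z; elsewhere [lim] returns an irrelevant default value. *)
Definition Psi_speed Psi u (t : R) : R :=
  lim (Psi (h^-1 *: (u (t + h) - u t)) @[h --> 0^']).

Definition Psi_variation (a b : R) Psi u (s : seq R) : R :=
  let U := u \o nth b (a :: s) in
  \sum_(0 <= n < size s) Psi (U n.+1 - U n).

Definition Var_Psi Psi u (a b : R) : \bar R :=
  ereal_sup [set (Psi_variation a b Psi u s)%:E | s in itv_partition a b].

Definition BV_Psi (T : R) (Z : set V) Psi u : Prop :=
  (forall t, t \in `[0, T] -> Z (u t)) /\ (Var_Psi Psi u 0 T < +oo)%E.

Definition left_lim u (t : R) : V :=
  if 0 < t then lim (u s @[s --> t^'-]) else u t.

Definition right_lim (T : R) u (t : R) : V :=
  if t < T then lim (u s @[s --> t^'+]) else u t.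

Definition jump_set (T : R) u : set R :=
  [set t | t \in `[0, T] /\
     (left_lim u t <> u t \/ u t <> right_lim T u t)].

Definition Jmp (T : R) (cost : R -> V -> V -> \bar R) u (a b : R) : \bar R :=
  (cost a (u a) (right_lim T u a) + cost b (left_lim u b) (u b) +
   \esum_(t in jump_set T u `&` `]a, b[)
      (cost t (left_lim u t) (u t) + cost t (u t) (right_lim T u t)))%E.

Definition Jmp_Psi (T : R) Psi u (a b : R) : \bar R :=
  Jmp T (fun _ v0 v1 => (Psi (v1 - v0))%:E) u a b.

End curves.

Section finsler_cost.
Context {R : realType} {V : normedModType R}.
Local Notation mu := (@lebesgue_measure R).
Context (Psi : V -> R) (T : R) (D : set V) (En : R -> V -> R).

Definition stability_gap (t : R) (u : V) : \bar R :=
  ereal_inf [set dual_norm (xi - z) |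
    xi in [set xi | subdiff D En t u (- xi)] & z in Kstar Psi].

Definition unstable_set (t : R) (theta : R -> V) : set R :=
  [set r | r \in `[0, 1] /\ (0 < stability_gap t (theta r))%E].

Definition transitions (t : R) (u0 u1 : V) : set (R -> V) :=
  [set theta | [/\ exists2 E : R, 0 < E &
                     ac_curve 0 1 (sublevel Psi T D En E) Psi theta,
                   theta 0 = u0, theta 1 = u1 &
                   loc_ac_norm (unstable_set t theta) theta]].

(* In the extended reals of the library 0 * +oo = 0. *)
Definition finsler_density (t : R) (theta : R -> V) (r : R) : \bar R :=
  if `[< unstable_set t theta r >] then
    ((Psi (derive1 theta r))%:E + stability_gap t (theta r) * (`|derive1 theta r|)%:E)%E
  else (Psi_speed Psi theta r)%:E.

Definition finsler_cost (t : R) (u0 u1 : V) : \bar R :=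
  ereal_inf [set (\int[mu]_(r in `[0%R, 1%R]) finsler_density t theta r)%E |
    theta in transitions t u0 u1].

Definition Jmp_f (u : R -> V) (a b : R) : \bar R :=
  Jmp T finsler_cost u a b.

Definition Var_f (u : R -> V) (a b : R) : \bar R :=
  (Var_Psi Psi u a b - Jmp_Psi T Psi u a b + Jmp_f u a b)%E.

(* 0 belongs to K^* + (subdifferential of the energy at time t). *)
Definition locally_stable (t : R) (u : V) : Prop :=
  [set z + xi | z in Kstar Psi & xi in subdiff D En t u] 0.

End finsler_cost.

Definition total_dissipation {R : realType} {V : normedModType R}
    (Psi Phi : V -> R) (eps : R) (u : R -> V) (xi : R -> V -> R^o) (r s : R)
    : \bar R :=
  (\int[@lebesgue_measure R]_(t in `[r, s])
     ((Psi_eps Psi Phi eps (derive1 u t))%:E + Psi_eps_conj Psi Phi eps (xi t)))%E.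

(* Main.v *)
Require Import Defs.
Set Warnings "-notation-overridden,-ambiguous-paths,-notation-incompatible-prefix,-deprecated".
From HB Require Import structures.
From mathcomp Require Import all_boot all_order all_algebra finmap.
From mathcomp Require Import all_classical all_reals all_analysis.
From mathcomp Require Import measurable_realfun lra ring.

Set Implicit Arguments.
Unset Strict Implicit.
Unset Printing Implicit Defensive.

Import Order.TTheory GRing.Theory Num.Theory.
Import numFieldNormedType.Exports.

Local Open Scope classical_set_scope.
Local Open Scope ring_scope.

(** Why the theorem holds.  The dissipation of the n-th curve over [r, s] is
[A_n s - A_n r] for a continuous nondecreasing function [A_n] that vanishes at
0 and is bounded by [C], and [A_n] controls the curve in two ways.  By the
Hahn-Banach theorem a functional [xi] lies at distance more than [c] from the
stable set only if it exceeds [Psi + c |.|] somewhere; hence, wherever the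
stability gap is larger than [c], the integrand [Psi_eps v + Psi_eps^* xi] is
at least [Psi v + c |v|] (contact_ge), and, because [F r = o(r)] at 0, it is
also at least [k / eps] for some [k > 0] (contact_blowup).  To integrate the
first bound along the curve one needs its derivative: this is what the
Radon-Nikodym property provides, through the vector measure of the increments
of the curve (ac_norm_derivative).

Helly's selection principle for the [A_n] and the compactness of the sublevels
give a subsequence along which [A_n] converges to some [G] and [u_n] to some
[u], at every time (helly_selection); then [Psi (u s - u r) <= G s - G r].
Compactness arguments use limits along ultrafilters instead of subsequences:
bounded families of functionals converge pointwise along these, and this
yields the lower semicontinuity of the stability gap (gap_lsc).

If the gap were positive at a continuity point [t] of [G], it would stay above
some [c > 0] on a neighbourhood of [t] along the curves, and the dissipation
would be of order [1 / eps_n] there.  So the gap vanishes at the continuity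
points of [G], which are dense, and by semicontinuity it vanishes off the jump
set of [u] (stable_off_jumps).

Around a jump time the curves are reparametrised by the arclength of [A_n].
The limit is Lipschitz with respect to [Psi], its constant [J] is the jump of
[G], and it inherits the bound on [Psi + c |.|] where the gap exceeds [c].
Therefore it is an admissible transition whose density is at most [J], so the
Finsler cost of the jump is at most the jump of [G]
(rescaled_transition_cost).

Finally, replacing in [G] the jumps at finitely many times by those of [Psi]
leaves a function that still controls the increments of [u].  Comparing its
total increment with that of [G] bounds the variation with corrected jumps by
[G s - G r], which is the limit of the dissipations
(jump_corrected_variation_le). *)

(** * Sublinear functionals and the contact inequalities *)

Section linear_forms.
Context {R : realType} {V : lmodType R} (f : V -> R^o).
Hypothesis lf : linear f.

Lemma linear_form0 : f 0 = 0.
Proof.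
by have := lf (-1) 0 0; rewrite scaler0 addr0 scaleN1r addNr.
Qed.

Lemma linear_formD v w : f (v + w) = f v + f w.
Proof. by have := lf 1 v w; rewrite !scale1r. Qed.

Lemma linear_formZ r v : f (r *: v) = r * f v.
Proof. by have := lf r v 0; rewrite linear_form0 !addr0. Qed.

Lemma linear_formN v : f (- v) = - f v.
Proof. by rewrite -scaleN1r linear_formZ mulN1r. Qed.

Lemma linear_formB v w : f (v - w) = f v - f w.
Proof. by rewrite linear_formD linear_formN. Qed.

End linear_forms.

Lemma linear_form_opp {R : realType} {V : lmodType R} (f : V -> R^o) :
  linear f -> linear (- f).
Proof. by move=> lf r v w; rewrite !fctE lf opprD /GRing.scale /= mulrN. Qed.

Lemma linear_form_oppK {R : realType} {V : lmodType R} (f : V -> R^o) :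
  linear (- f) -> linear f.
Proof. by move=> /linear_form_opp; rewrite opprK. Qed.

Lemma linear_form_sub {R : realType} {V : lmodType R} (f g : V -> R^o) :
  linear f -> linear g -> linear (f - g).
Proof.
move=> lf lg r v w; rewrite !fctE lf lg /GRing.scale /=.
by rewrite opprD addrACA -mulrN -mulrDr.
Qed.

Section sublinear.
Context {R : realType} {V : lmodType R}.
Implicit Types p q : V -> R.

Definition sublinear p : Prop :=
  (forall v w, p (v + w) <= p v + p w) /\
  (forall r v, 0 <= r -> p (r *: v) = r * p v).

Lemma sublinear0 p : sublinear p -> p 0 = 0.
Proof. by case=> _ h; rewrite -(scale0r (0 : V)) h// mul0r. Qed.

Lemma sublinear_ge p v : sublinear p -> - p (- v) <= p v.
Proof.
move=> sp; have [h _] := sp; have := h v (- v).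
by rewrite subrr (sublinear0 sp); lra.
Qed.

(** A minimal sublinear functional is additive: otherwise the infimum over
[t >= 0] of [p (v + t w) - t p w] is a strictly smaller sublinear functional
of [v]. *)
Lemma sublinear_minimal_linear p : sublinear p ->
  (forall q, sublinear q -> (forall v, q v <= p v) -> q = p) ->
  linear (p : V -> R^o).
Proof.
move=> sp pmin; have [sD sZ] := sp.
have low w v t : 0 <= t -> - p (- v) <= p (v + t *: w) - t * p w.
  move=> t0; have := sD (v + t *: w) (- v); rewrite addrAC subrr add0r sZ//.
  by lra.
have addp v w : p v + p w <= p (v + w).
  pose S v := [set p (v + t *: w) - t * p w | t in [set t | 0 <= t]].
  have S0 x : S x !=set0 by exists (p (x + 0 *: w) - 0 * p w); exists 0 => /=.
  have Slb x : has_lbound (S x).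
    by exists (- p (- x)) => _ [t t0 <-]; exact: low.
  have Sinf x : has_inf (S x) by [].
  pose q x := inf (S x).
  have qle x t : 0 <= t -> q x <= p (x + t *: w) - t * p w.
    by move=> t0; apply: ge_inf => //; exists t.
  have qge x z : (forall t, 0 <= t -> z <= p (x + t *: w) - t * p w) -> z <= q x.
    by move=> h; apply: lb_le_inf => // _ [t t0 <-]; exact: h.
  have qsub : sublinear q.
    split=> [x y|r x r0].
      rewrite -lerBlDr; apply: (qge) => s s0; rewrite lerBlDl -lerBlDr.
      apply: (qge) => t t0; rewrite lerBlDl.
      apply: le_trans (qle (x + y) (t + s) (addr_ge0 t0 s0)) _.
      have := sD (x + s *: w) (y + t *: w).
      rewrite [x + _ + _]addrACA -scalerDl [s + t]addrC mulrDl; lra.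
    have [->|rn0] := eqVneq r 0.
      rewrite scale0r mul0r; apply/le_anti/andP; split.
        by have := qle 0 0 (lexx _); rewrite scale0r addr0 (sublinear0 sp); lra.
      apply: (qge) => t t0; rewrite add0r sZ//; lra.
    have rp : 0 < r by rewrite lt_neqAle eq_sym rn0.
    apply/le_anti/andP; split.
      rewrite -ler_pdivrMl//; apply: (qge) => t t0; rewrite ler_pdivrMl//.
      apply: le_trans (qle _ (r * t) (mulr_ge0 r0 t0)) _.
      rewrite -scalerA -scalerDr sZ//; lra.
    apply: (qge) => t t0; rewrite -ler_pdivlMl//.
    apply: le_trans (qle _ (r^-1 * t) _) _; first by rewrite mulr_ge0// invr_ge0.
    have -> : r *: x + t *: w = r *: (x + (r^-1 * t) *: w).
      by rewrite scalerDr scalerA mulVKf.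
    by rewrite sZ// mulrBr !mulrA mulVf// !mul1r.
  have /pmin qp := qsub.
  have {qp}qp : q = p.
    apply: qp => x; have := qle x 0 (lexx _); rewrite scale0r addr0; lra.
  by have := qle v 1 ler01; rewrite qp scale1r mul1r; lra.
have addE v w : p (v + w) = p v + p w by apply/le_anti; rewrite sD addp.
have oppE v : p (- v) = - p v.
  by have := addE v (- v); rewrite subrr (sublinear0 sp); lra.
have scaleE r v : p (r *: v) = r * p v.
  have [r0|/ltW r0] := leP 0 r; first exact: sZ.
  by rewrite -[in LHS](opprK r) scaleNr oppE sZ ?oppr_ge0// mulNr opprK.
by move=> r x y; rewrite addE scaleE.
Qed.

(** Zorn's lemma among the sublinear functionals below [p].  A chain of them is
bounded below by its pointwise infimum, which is finite because every member
[q] satisfies [q v >= - p (- v)]. *)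
Theorem hahn_banach p : sublinear p ->
  exists f : V -> R^o, linear f /\ forall v, f v <= p v.
Proof.
move=> sp.
pose T := {q : V -> R | sublinear q /\ forall v, q v <= p v}.
pose below (a b : T) := `[< forall v, sval b v <= sval a v >].
have [|r s t|s t|A Atot|m mmin] := @Zorn T below.
- by move=> t; apply/asboolP => v.
- by move=> /asboolP rs /asboolP st; apply/asboolP => v; exact: le_trans (st v) (rs v).
- move: s t => [s ps] [t pt] /asboolP/= st /asboolP/= ts; apply: eq_exist; apply/funext => v.
  by apply/le_anti; rewrite st ts.
- have [[a0 Aa0]|A0] := pselect (A !=set0); last first.
    exists (exist _ p (conj sp (fun=> lexx _))) => s As; exfalso; apply: A0.
    by exists s.
  pose S v := [set sval a v | a in A].
  have lowS v : lbound (S v) (- p (- v)).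
    move=> _ [[q [sq qp]] Aq <-] /=.
    by apply: le_trans (sublinear_ge v sq); rewrite lerN2.
  have S0 v : S v !=set0 by exists (sval a0 v), a0.
  have Slb v : has_lbound (S v) by exists (- p (- v)).
  pose q v := inf (S v).
  have qle a v : A a -> q v <= sval a v by move=> Aa; apply: ge_inf => //; exists a.
  have qge v z : (forall a, A a -> z <= sval a v) -> z <= q v.
    by move=> h; apply: lb_le_inf => // _ [a Aa <-]; exact: h.
  have sq : sublinear q.
    split=> [v w|r v r0].
      rewrite -lerBlDr; apply: (qge) => a Aa; rewrite lerBlDl -lerBlDr.
      apply: (qge) => b Ab; rewrite lerBlDl.
      have [/asboolP ab|/asboolP ba] := Atot _ _ Aa Ab.
        apply: le_trans (qle b (v + w) Ab) _.
        apply: le_trans ((svalP b).1.1 v w) _; rewrite lerD2r; exact: ab.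
      apply: le_trans (qle a (v + w) Aa) _.
      apply: le_trans ((svalP a).1.1 v w) _; rewrite lerD2l; exact: ba.
    have [->|rn0] := eqVneq r 0.
      rewrite scale0r mul0r; apply/le_anti/andP; split.
        by rewrite -(sublinear0 (svalP a0).1); exact: qle.
      by apply: (qge) => a Aa; rewrite (sublinear0 (svalP a).1).
    have rp : 0 < r by rewrite lt_neqAle eq_sym rn0.
    apply/le_anti/andP; split.
      rewrite -ler_pdivrMl//; apply: (qge) => a Aa; rewrite ler_pdivrMl//.
      by rewrite -(svalP a).1.2//; exact: qle.
    apply: (qge) => a Aa; rewrite (svalP a).1.2// ler_pM2l//; exact: qle.
  have qp v : q v <= p v by exact: le_trans (qle a0 v Aa0) ((svalP a0).2 v).
  exists (exist _ q (conj sq qp)) => s As; apply/asboolP => v /=; exact: qle.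
have [sm mp] := svalP m.
exists (sval m); split => //; apply: sublinear_minimal_linear => // q sq qm.
have qp v : q v <= p v by exact: le_trans (qm v) (mp v).
have := mmin (exist _ q (conj sq qp)).
have : below m (exist _ q (conj sq qp)) by apply/asboolP.
by move=> /[swap] /[apply] <-.
Qed.

End sublinear.

Section dissipation_potential_facts.
Context {R : realType} {V : normedModType R} (Psi : V -> R).
Hypothesis Psi_potential : dissipation_potential Psi.
Hypothesis Psi_homogeneous : positively_homogeneous Psi.

Lemma potential_sublinear : sublinear Psi.
Proof.
split=> [v w|]; last exact: Psi_homogeneous.
have h0 : 0 <= 2^-1 :> R by [].
have h1 : 2^-1 <= 1 :> R by rewrite invf_le1// ler1n.
have := dp_convex Psi_potential (Itv01 h0 h1).
move=> /(_ (2 *: v) (2 *: w)); rewrite !inE => /(_ I I).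
rewrite convRE /conv/= !Psi_homogeneous// !scalerA.
have -> : unstable.onem 2^-1 = 2^-1 :> R by rewrite /unstable.onem; field.
by rewrite !mulrA !mulVf ?pnatr_eq0// !scale1r !mul1r.
Qed.

Lemma potential_bounded : exists2 M : R, 0 < M & forall v, Psi v <= M * `|v|.
Proof.
have Psi0 := sublinear0 potential_sublinear.
have /cvgr_norm_lt : Psi v @[v --> (0 : V)] --> (0 : R).
  by rewrite -[X in _ --> X]Psi0; exact: (dp_cont Psi_potential).
rewrite normr0 => /(_ 1 ltr01) /nbhs_ballP [d /= d0 dP].
exists (2 / d); first by rewrite divr_gt0.
move=> v; have [->|v0] := eqVneq v 0; first by rewrite Psi0 normr0 mulr0.
have nv : 0 < `|v| by rewrite normr_gt0.
have k0 : 0 < d / 2 / `|v| by rewrite !divr_gt0.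
have : ball (0 : V) d ((d / 2 / `|v|) *: v).
  rewrite -ball_normE /= sub0r normrN normrZ gtr0_norm// divfK ?gt_eqF//.
  by rewrite ltr_pdivrMr// ltr_pMr// ltr1n.
move=> /dP/= /(le_lt_trans (ler_norm _)).
rewrite (Psi_homogeneous _ (ltW k0)) => /ltW h.
rewrite -(ler_pM2l k0); apply: le_trans h _.
by rewrite le_eqVlt; apply/orP; left; apply/eqP; field; rewrite gt_eqF//= gt_eqF.
Qed.

Lemma potential_sub_eq0 x y : Psi (x - y) <= 0 -> x = y.
Proof.
move=> h; apply/eqP; rewrite -subr_eq0; apply/negPn/negP => /(dp_gt0 Psi_potential).
by rewrite ltNge h.
Qed.

End dissipation_potential_facts.

Section weak_star.
Context {R : realType} {V : normedModType R}.
Implicit Types xi z : V -> R^o.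

Lemma linear_bounded_dual xi (M : R) : linear xi ->
  (forall v, `|xi v| <= M * `|v|) -> dual xi.
Proof.
move=> lxi bxi; split => // x.
have sub y : xi y - xi x = xi (y - x).
  by rewrite linear_formB.
apply/cvgrPdist_lt => e e0; near=> y.
rewrite distrC sub; apply: le_lt_trans (bxi _) _.
have : `|y - x| < e / (1 + `|M|).
  near: y; have := @cvgr_distC_lt _ _ _ _ _ _ _ (@cvg_id _ (nbhs x)) (e / (1 + `|M|)).
  by apply; rewrite divr_gt0// ltr_wpDr.
rewrite ltr_pdivlMr ?ltr_wpDr// => h.
apply: le_lt_trans h; rewrite mulrC ler_wpM2l//.
by apply: le_trans (ler_norm M) _; rewrite lerDr.
Unshelve. all: by end_near. Qed.

Lemma dual_norm_leP xi (c : R) : linear xi -> 0 <= c ->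
  (dual_norm xi <= c%:E)%E <-> (forall v, `|xi v| <= c * `|v|).
Proof.
move=> lxi c0; split=> [h v|h].
  have [->|v0] := eqVneq v 0.
    by rewrite (linear_form0 lxi) !normr0 mulr0.
  have nv : 0 < `|v| by rewrite normr_gt0.
  have x0 : xi 0 = 0 by exact: linear_form0.
  have xZ r : xi (r *: v) = r * xi v by exact: linear_formZ.
  have : ((`|xi (`|v|^-1 *: v)|)%:E <= dual_norm xi)%E.
    apply: ereal_sup_ubound; exists (`|v|^-1 *: v) => //=.
    by rewrite normrZ ger0_norm ?invr_ge0// mulVf ?gt_eqF.
  move=> /le_trans/(_ h); rewrite lee_fin xZ normrM ger0_norm ?invr_ge0//.
  by rewrite mulrC ler_pdivrMr.
apply: ge_ereal_sup => _ [v /= v1 <-]; rewrite lee_fin.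
by apply: le_trans (h v) _; rewrite ler_piMr.
Qed.

End weak_star.

Section distance_to_Kstar.
Context {R : realType} {V : normedModType R} (Psi : V -> R).
Hypothesis Psi_potential : dissipation_potential Psi.
Hypothesis Psi_homogeneous : positively_homogeneous Psi.
Implicit Types xi z : V -> R^o.

Lemma Kstar_bounded (M : R) z : (forall v, Psi v <= M * `|v|) ->
  Kstar Psi z -> forall v, `|z v| <= M * `|v|.
Proof.
move=> PM [[lz _] zP] v.
have z0 : z 0 = 0 by exact: linear_form0.
have zN : z (- v) = - z v by have := lz (-1) v 0; rewrite !addr0 z0 addr0 !scaleN1r.
rewrite ler_norml (le_trans (zP v) (PM v)) andbT lerNl -zN -normrN.
exact: le_trans (zP _) (PM _).
Qed.

(** The infimal convolution of [Psi] with [xi + c |.|] is sublinear, and finite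
by the assumption on [xi].  A linear functional below it is below both
functions: it belongs to the stable set, and the second bound, applied to a
vector and to its opposite, puts it within [c] of [xi]. *)
Lemma Kstar_decomposition xi (c : R) : dual xi -> 0 <= c ->
  (forall v, xi v <= Psi v + c * `|v|) ->
  exists2 z, Kstar Psi z & (dual_norm (xi - z)%R <= c%:E)%E.
Proof.
move=> [lxi cxi] c0 xiP.
have [pD pZ] := potential_sublinear Psi_potential Psi_homogeneous.
have x0 : xi 0 = 0 by exact: linear_form0.
have xD a b : xi (a + b) = xi a + xi b by exact: linear_formD.
have xZ r a : xi (r *: a) = r * xi a by exact: linear_formZ.
pose h v w := Psi w + xi (v - w) + c * `|v - w|.
have low v w : xi v - c * `|v| <= h v w.
  rewrite /h linear_formB//.
  have : c * `|w| <= c * `|v| + c * `|v - w|.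
    by rewrite -mulrDr ler_wpM2l// -[in leLHS](subKr v w) ler_normB.
  have := xiP w; lra.
pose S v := range (h v).
have S0 v : S v !=set0 by exists (h v 0), 0.
have Slb v : has_lbound (S v) by exists (xi v - c * `|v|) => _ [w _ <-].
pose p v := inf (S v).
have ple v w : p v <= h v w by apply: ge_inf => //; exists w.
have pge v y : (forall w, y <= h v w) -> y <= p v.
  by move=> H; apply: lb_le_inf => // _ [w _ <-].
have sp : sublinear p.
  split=> [v w|r v r0].
    rewrite -lerBlDr; apply: (pge) => b; rewrite lerBlDl -lerBlDr.
    apply: (pge) => a; rewrite lerBlDl.
    apply: le_trans (ple _ (b + a)) _; rewrite /h.
    have -> : v + w - (b + a) = (v - b) + (w - a) by rewrite opprD addrACA.
    rewrite xD.
    have := pD b a; have : c * `|v - b + (w - a)| <= c * `|v - b| + c * `|w - a|.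
      by rewrite -mulrDr ler_wpM2l// ler_normD.
    lra.
  have hZ w : h (r *: v) (r *: w) = r * h v w.
    by rewrite /h -scalerBr xZ pZ// normrZ ger0_norm// !mulrDr mulrCA.
  have [->|rn0] := eqVneq r 0.
    rewrite scale0r mul0r; apply/le_anti/andP; split.
      have := ple 0 0; rewrite /h subrr normr0 mulr0 x0.
      by have /sublinear0 -> : sublinear Psi by []; rewrite !addr0.
    by apply: (pge) => w; apply: le_trans (low 0 w); rewrite x0 normr0 mulr0 subrr.
  have rp : 0 < r by rewrite lt_neqAle eq_sym rn0.
  apply/le_anti/andP; split.
    rewrite -ler_pdivrMl//; apply: (pge) => w; rewrite ler_pdivrMl// -hZ.
    exact: ple.
  apply: (pge) => w; rewrite -[w](scalerKV rn0) hZ ler_pM2l//; exact: ple.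
have [z [lz zp]] := hahn_banach sp.
have z0 : z 0 = 0 by exact: linear_form0.
have zN v : z (- v) = - z v by exact: linear_formN.
have zPsi v : z v <= Psi v.
  apply: le_trans (zp v) _; apply: le_trans (ple v v) _.
  by rewrite /h subrr x0 normr0 mulr0 !addr0.
have zxi v : z v <= xi v + c * `|v|.
  apply: le_trans (zp v) _; apply: le_trans (ple v 0) _.
  by rewrite /h subr0 (sublinear0 (conj pD pZ)) add0r.
have [M M0 PM] := potential_bounded Psi_potential Psi_homogeneous.
have bz v : `|z v| <= M * `|v|.
  rewrite ler_norml (le_trans (zPsi v) (PM v)) andbT lerNl -zN -normrN.
  exact: le_trans (zPsi _) (PM _).
exists z; first by split => //; exact: linear_bounded_dual bz.
apply/dual_norm_leP => //; first exact: linear_form_sub.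
move=> v; rewrite !fctE ler_norml.
have := zxi v; have := zxi (- v).
by rewrite zN linear_formN// normrN => h1 h2; apply/andP; split; lra.
Qed.

End distance_to_Kstar.

Section vanishing_viscosity_contact.
Context {R : realType} {V : normedModType R} (Psi Phi : V -> R) (F : R -> R).
Hypothesis Psi_potential : dissipation_potential Psi.
Hypothesis Psi_homogeneous : positively_homogeneous Psi.
Hypothesis F_profile : viscous_profile F.
Hypothesis Phi_F : forall v, Phi v = F `|v|.
Implicit Types (xi z : V -> R^o) (eps c r : R).

Lemma profile_below_line c : 0 < c -> exists2 r, 0 < r & F r < c * r.
Proof.
move=> c0; have [dF [/(_ 0 (lexx _)) + _ dF0 _]] := vp_C1 F_profile.
rewrite /is_derive_on dF0 => /cvgr_norm_lt; rewrite normr0 => /(_ c c0).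
rewrite /prop_near1 /within /=.
move=> /nbhs_ballP [d /= d0 dP]; exists (d / 2); first by rewrite divr_gt0.
have h : 0 < d / 2 by rewrite divr_gt0.
have := dP (d / 2); rewrite -ball_normE /= sub0r normrN gtr0_norm//.
rewrite ltr_pdivrMr// ltr_pMr// ltr1n => /(_ isT).
rewrite gt_eqF// => /(_ isT); rewrite in_itv/= andbT (ltW h) => /(_ isT).
rewrite subr0 (vp_0 F_profile) subr0 normrZ normfV !gtr0_norm//.
  by rewrite (ltr_pdivrMl _ _ h) [_ * c]mulrC.
exact: vp_gt0.
Qed.

Lemma conj_ge0 eps xi : linear xi -> (0 <= Psi_eps_conj Psi Phi eps xi)%E.
Proof.
move=> lxi; apply: ereal_sup_ubound; exists 0 => //.
rewrite (linear_form0 lxi) /Psi_eps Phi_F scaler0 normr0 (vp_0 F_profile) mulr0.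
by rewrite (sublinear0 (potential_sublinear Psi_potential Psi_homogeneous)) addr0 subr0.
Qed.

(** The supremum is tested on the vector of norm [r] in a direction where [xi]
exceeds [Psi + c |.|]; such a direction exists by [Kstar_decomposition]. *)
Lemma conj_ge eps xi c r : 0 < eps -> dual xi -> 0 <= c -> 0 <= r ->
  (forall z, Kstar Psi z -> (c%:E < dual_norm (xi - z)%R)%E) ->
  ((r * c - eps^-1 * F (eps * r))%:E <= Psi_eps_conj Psi Phi eps xi)%E.
Proof.
move=> e0 dxi c0 r0 far; have [lxi _] := dxi.
have P0 := sublinear0 (potential_sublinear Psi_potential Psi_homogeneous).
have [v vP] : exists v, Psi v + c * `|v| < xi v.
  apply: contrapT => nv; have [v|z zK] := Kstar_decomposition Psi_potential Psi_homogeneous dxi c0.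
    by rewrite leNgt; apply/negP => h; apply: nv; exists v.
  by rewrite leNgt far.
have nv : 0 < `|v|.
  rewrite normr_gt0; apply/eqP => v0; move: vP.
  by rewrite v0 P0 (linear_form0 lxi) normr0 mulr0 addr0 ltxx.
have k0 : 0 <= r / `|v| by rewrite divr_ge0// ltW.
apply: (@le_trans _ _ (xi ((r / `|v|) *: v) - Psi_eps Psi Phi eps ((r / `|v|) *: v))%:E); last first.
  by apply: ereal_sup_ubound; exists ((r / `|v|) *: v).
rewrite lee_fin /Psi_eps Phi_F scalerA normrZ Psi_homogeneous// (linear_formZ lxi).
rewrite ger0_norm ?mulr_ge0 ?(ltW e0)//.
have -> : eps * (r / `|v|) * `|v| = eps * r by rewrite -mulrA divfK// gt_eqF.
rewrite opprD addrA lerD2r -mulrBr.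
rewrite -[leLHS](_ : r / `|v| * (c * `|v|) = _); last by field; rewrite gt_eqF.
by rewrite ler_wpM2l//; move: vP; lra.
Qed.

Context (D : set V) (En : R -> V -> R).

Lemma gap_lt_dual_norm t w c xi z : (c%:E < stability_gap Psi D En t w)%E ->
  subdiff D En t w (- xi) -> Kstar Psi z -> (c%:E < dual_norm (xi - z)%R)%E.
Proof.
move=> cg xiw zK; apply: lt_le_trans cg _; apply: ereal_inf_lbound.
by exists xi => //; exists z.
Qed.

(** With [r = |v|] in [conj_ge], the viscous part of [Psi_eps v] cancels the one
lost in the conjugate. *)
Lemma contact_ge eps t w c xi v : 0 < eps -> 0 <= c -> dual xi ->
  (c%:E < stability_gap Psi D En t w)%E -> subdiff D En t w (- xi) ->
  ((Psi v + c * `|v|)%:E <=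
     (Psi_eps Psi Phi eps v)%:E + Psi_eps_conj Psi Phi eps xi)%E.
Proof.
move=> e0 c0 dxi cg xiw.
have h z : Kstar Psi z -> (c%:E < dual_norm (xi - z)%R)%E by exact: gap_lt_dual_norm cg xiw.
apply: le_trans (leeD2l _ (conj_ge e0 dxi c0 (normr_ge0 v) h)).
rewrite -EFinD lee_fin /Psi_eps Phi_F normrZ gtr0_norm//; lra.
Qed.

Lemma contact_ge0 eps xi v : 0 < eps -> linear xi ->
  ((Psi v)%:E <= (Psi_eps Psi Phi eps v)%:E + Psi_eps_conj Psi Phi eps xi)%E.
Proof.
move=> e0 lxi; rewrite -[leLHS]adde0; apply: leeD; last exact: conj_ge0.
rewrite lee_fin /Psi_eps lerDl mulr_ge0 ?invr_ge0 ?(ltW e0)// Phi_F.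
have [->|n0] := eqVneq (eps *: v) 0; first by rewrite normr0 (vp_0 F_profile).
by apply/ltW/vp_gt0; rewrite ?normr_gt0.
Qed.

(** With [r = r0 / eps] in [conj_ge], where [F r0 < c r0], the bound scales like
[1 / eps]. *)
Lemma contact_blowup c : 0 < c -> exists2 k : R, 0 < k &
  forall eps t w xi v, 0 < eps -> dual xi ->
  (c%:E < stability_gap Psi D En t w)%E -> subdiff D En t w (- xi) ->
  ((k / eps)%:E <= (Psi_eps Psi Phi eps v)%:E + Psi_eps_conj Psi Phi eps xi)%E.
Proof.
move=> c0; have [r r0 rP] := profile_below_line c0.
exists (c * r - F r); first by rewrite subr_gt0.
move=> eps t w xi v e0 dxi cg xiw.
have h z : Kstar Psi z -> (c%:E < dual_norm (xi - z)%R)%E by exact: gap_lt_dual_norm cg xiw.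
have re0 : 0 <= r / eps by rewrite divr_ge0 ?ltW.
have := conj_ge e0 dxi (ltW c0) re0 h.
rewrite [eps * _]mulrC divfK ?gt_eqF// => le1.
rewrite -[leLHS]add0e; apply: leeD; last first.
  apply: le_trans le1; rewrite lee_fin le_eqVlt; apply/orP; left; apply/eqP; field.
  by rewrite gt_eqF.
rewrite lee_fin /Psi_eps addr_ge0 ?(dp_ge0 Psi_potential)//.
rewrite mulr_ge0 ?invr_ge0 ?(ltW e0)// Phi_F.
have [->|n0] := eqVneq (eps *: v) 0; first by rewrite normr0 (vp_0 F_profile).
by apply/ltW/vp_gt0; rewrite ?normr_gt0.
Qed.

End vanishing_viscosity_contact.

(** * Limits along ultrafilters *)

Section ultrafilters.

Lemma ultraP T (F : set_system T) : ProperFilter F ->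
  (forall A, F A \/ F (~` A)) -> UltraFilter F.
Proof.
move=> FF Fdec; split=> // G GF FG; rewrite predeqE => A; split; last exact: FG.
move=> GA; case: (Fdec A) => // /FG GnA.
have GAA : G (A `&` ~` A) by exact: filterI.
by have [? []] := filter_ex GAA.
Qed.

Lemma fmap_ultra I X (U : set_system I) (f : I -> X) :
  UltraFilter U -> UltraFilter (f @ U).
Proof. by move=> UU; apply: ultraP => A; exact: (in_ultra_setVsetC (f @^-1` A)). Qed.

Lemma ultra_compact_cvg (X : topologicalType) I (U : set_system I) (f : I -> X) K :
  UltraFilter U -> compact K -> (\forall i \near U, K (f i)) ->
  exists2 p, K p & f i @[i --> U] --> p.
Proof.
move=> UU; rewrite compact_ultra => cK fK.
by have [p [Kp fp]] := cK _ (fmap_ultra f UU) fK; exists p.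
Qed.

(** A filter is the intersection of the finer ultrafilters.  It is thus enough to
prove an eventual property, or a convergence, along these, where compactness
provides limits. *)
Lemma near_ultraP I (F : set_system I) (B : set I) : ProperFilter F ->
  (forall W, UltraFilter W -> F `<=` W -> W B) -> F B.
Proof.
move=> FF h; apply: contrapT => nFB.
have GF : ProperFilter (within (~` B) F).
  apply: Build_ProperFilter_ex => A FA; apply: contrapT => nA; apply: nFB.
  apply: (@filterS _ F _ _ _ _ FA) => i /= Ai; apply: contrapT => nBi; apply: nA; exists i; exact: Ai.
have [W [UW GW]] := ultraFilterLemma GF.
have FW : F `<=` W by move=> A FA; apply: GW; apply: (@filterS _ F _ A _ _ FA) => i + _.
have WB := h W UW FW.
have WnB : W (~` B) by apply: GW; apply: (@filterE _ F).
have WBB : W (B `&` ~` B) by exact: filterI.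
by have [? []] := filter_ex WBB.
Qed.

Lemma cvg_ultraP (X : topologicalType) I (F : set_system I) (f : I -> X) (p : X) :
  ProperFilter F ->
  (forall W, UltraFilter W -> F `<=` W -> f i @[i --> W] --> p) ->
  f i @[i --> F] --> p.
Proof. by move=> FF h A pA; apply: (@near_ultraP _ F) => W UW FW; exact: (h W UW FW A pA). Qed.

Lemma ultra_le I (U : set_system I) (F : set_system I) : F `<=` U ->
  forall (X : topologicalType) (f : I -> X) (p : X), f i @[i --> F] --> p ->
  f i @[i --> U] --> p.
Proof. by move=> FU X f p fp A /fp/FU. Qed.

End ultrafilters.

Section limits.
Context {R : realType} {I : Type} (U : set_system I) {UF : ProperFilter U}.
Implicit Types (f g : I -> R).

Lemma ler_limit f g (a b : R) : f i @[i --> U] --> a -> g i @[i --> U] --> b ->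
  (\forall i \near U, f i <= g i) -> a <= b.
Proof.
move=> fa gb fg; rewrite -subr_ge0.
have gfba : g i - f i @[i --> U] --> b - a by exact: cvgB.
have := @closed_cvg _ _ _ UF _ (fun y : R => 0 <= y) (@closed_ge _ 0) _ _ gfba.
by apply; apply: filterS fg => i; rewrite subr_ge0.
Qed.

Lemma bounded_ultra_cvg f (M : R) : UltraFilter U ->
  (\forall i \near U, `|f i| <= M) -> exists l : R, f i @[i --> U] --> l.
Proof.
move=> UU fM; have [||p _ fp] := @ultra_compact_cvg R I U f `[- M, M] UU; last by exists p.
  exact: segment_compact.
by apply: filterS fM => i /=; rewrite in_itv/= ler_norml.
Qed.

Lemma ler_eps_mul (a b k : R) : (forall e, 0 < e -> a <= b + e * k) -> a <= b.
Proof.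
move=> h; apply/ler_addgt0Pr => e e0.
have k1 : 0 < `|k| + 1 by rewrite ltr_wpDl.
have := h (e / (`|k| + 1)); rewrite divr_gt0// => /(_ isT) /le_trans; apply.
rewrite lerD2l -mulrA ger_pMr// mulrC ler_pdivrMr// mul1r.
by rewrite (le_trans (ler_norm k))// lerDl.
Qed.

End limits.

Section relative_derivative.
Context {R : realType}.

Lemma is_derive_on_cvg {V : normedModType R} (A : set R) (f : R -> V) x l :
  is_derive_on A f x l -> f y @[y --> within A (nbhs x)] --> f x.
Proof.
move=> fl; apply/cvgrPdist_lt => e e0.
have l1 : 0 < `|l| + 1 by rewrite ltr_wpDl.
have /cvgr_norm_lt /(_ (`|l| + 1)) := fl; rewrite ltrDl => /(_ ltr01).
rewrite /prop_near1 /within /= => /nbhs_ballP[d /= d0 dP].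
apply/nbhs_ballP; exists (Num.min d (e / (`|l| + 1))) => /=.
  by rewrite lt_min d0 divr_gt0.
move=> y; rewrite -ball_normE /= lt_min => /andP[yd ye] Ay.
have [->|yx] := eqVneq y x; first by rewrite subrr normr0.
have := dP y; rewrite -ball_normE /= => /(_ yd yx Ay).
rewrite normrZ normfV ltr_pdivrMl ?normr_gt0 ?subr_eq0// distrC => h.
apply: lt_le_trans h _; rewrite -ler_pdivlMr// distrC; exact: ltW.
Qed.

Lemma is_derive_on_is_derive (f : R -> R) (a b x l : R) : x \in `]a, b[ ->
  is_derive_on `[a, b] (f : R -> R^o) x l -> is_derive x (1 : R) f l.
Proof.
rewrite in_itv/= => /andP[ax xb] fl.
have h : h^-1 *: (f (h *: (1 : R) + x) - f x) @[h --> 0^'] --> (l : R).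
  have : (fun h => h + x) @ (0:R)^' --> within `[a, b]%classic x^'.
    move=> A; rewrite /within /= /nbhs /= => /nbhs_ballP[d /= d0 dP].
    apply/nbhs_ballP; exists (Num.min d (Num.min (x - a) (b - x))) => /=.
      by rewrite !lt_min d0 !subr_gt0 ax.
    move=> h; rewrite -ball_normE /= sub0r normrN !lt_min => /and3P[hd ha hb] h0.
    apply: dP.
    - by rewrite -ball_normE /= opprD addrCA subrr addr0 normrN.
    - by apply: contra h0 => /eqP h0; rewrite -(addrK x h) h0 subrr.
    - rewrite in_itv/=; move: ha hb; rewrite !ltr_norml => /andP[? ?] /andP[? ?].
      by apply/andP; split; lra.
  move=> /cvg_comp /(_ fl); apply: cvg_trans; apply: near_eq_cvg.
  by near=> h; rewrite /= addrK [h *: _]mulr1.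
by apply: DeriveDef; [apply/cvg_ex; exists l|apply/cvg_lim => //].
Unshelve. all: by end_near. Qed.

End relative_derivative.

(** * Lower semicontinuity of the stability gap *)

Section exponential_gronwall.
Context {R : realType}.

Lemma exp_gronwall (g dg : R -> R) (k T : R) :
  (forall x, x \in `]0, T[ -> is_derive x (1 : R) g (dg x)) ->
  {within `[0, T], continuous g} ->
  (forall x, x \in `]0, T[ -> 0 <= k * g x + dg x) ->
  forall x y, 0 <= x -> x <= y -> y <= T ->
    expR (k * x) * g x <= expR (k * y) * g y.
Proof.
move=> dgP cg kP.
pose f := - ((fun x : R => expR (k * x)) * g).
have der x : x \in `]0, T[ ->
    is_derive x (1 : R) f (- (expR (k * x) * (k * g x + dg x))).
  move=> xT; have d2 := dgP x xT.
  have d3 : is_derive x (1 : R) (fun x => expR (k * x)) (k * expR (k * x)).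
    have -> : k * expR (k * x) = expR (k * x) * (k *: 1).
      by rewrite /GRing.scale/= mulr1 mulrC.
    exact: (@is_derive1_comp _ expR ( *%R k)).
  have dd := is_deriveN (is_deriveM d3 d2).
  by apply: (@is_derive_eq _ _ _ _ _ _ _ _ dd); rewrite /GRing.scale /=; ring.
have cont : {within `[0, T], continuous f}.
  apply/subspace_continuousP => x xT; apply: cvgN; apply: cvgM.
    apply: (cvg_trans (cvg_app _ (@cvg_within _ _ _ _))).
    have : {for x, continuous (fun x : R => expR (k * x))}.
      apply: continuous_comp; last exact: continuous_expR.
      exact: mulrl_continuous.
    exact.
  by move/subspace_continuousP : cg; exact.
move=> x y x0 xy yT; rewrite -lerN2.
apply: (@ler0_derive1_nincr _ f 0 T) => //.
- by move=> z zT; have [] := der z zT.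
- move=> z zT; rewrite derive1E; have [_ ->] := der z zT.
  by rewrite oppr_le0 mulr_ge0 ?expR_ge0// kP.
Qed.

End exponential_gronwall.

Section energy_estimates.
Context {R : realType} {V : normedModType R} (Psi : V -> R) (T : R).
Context (D : set V) (En : R -> V -> R).
Hypothesis En_admissible : admissible_energy Psi T D En.

Lemma energy_time_cvg t v : t \in `[0, T] -> D v ->
  En s v @[s --> within `[0, T]%classic (nbhs t)] --> En t v.
Proof.
move=> tT Dv; have [P [PD _]] := en_power En_admissible.
exact: (is_derive_on_cvg (PD t v tT Dv)).
Qed.

(** Gronwall's inequality forwards and backwards in time: the energies at two times
are comparable, with one constant for all the points of the domain. *)
Lemma energy_growth : exists2 c : R, 0 < c & forall v s t, D v ->
  s \in `[0, T] -> t \in `[0, T] -> 0 < Psi v + En s v ->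
  Psi v + En s v <= c * (Psi v + En t v).
Proof.
have [P [PD [CP CP0 PE]]] := en_power En_admissible.
exists (expR (CP * T)); first exact: expR_gt0.
move=> v s t Dv sT tT gs.
pose g r := Psi v + En r v.
have dg x : x \in `]0, T[ -> is_derive x (1 : R) g (P x v).
  move=> xT; have xT' : x \in `[0, T] by apply: subset_itv_oo_cc.
  have d1 := is_derive_on_is_derive xT (PD x v xT' Dv).
  have dd := is_deriveD (is_derive_cst (Psi v) x (1 : R)) d1.
  by apply: (@is_derive_eq _ _ _ _ _ _ _ _ dd); rewrite add0r.
have cg : {within `[0, T], continuous g}.
  apply/subspace_continuousP => x xT.
  by apply: cvgD; [exact: cvg_cst|exact: energy_time_cvg].
have up : forall x, x \in `]0, T[ -> 0 <= CP * g x + P x v.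
  by move=> x xT; have [+ _] := PE x v xT Dv; rewrite ler_norml -/(g x); lra.
have h1 := exp_gronwall dg cg up.
have h2 : forall x y, 0 <= x -> x <= y -> y <= T -> expR (- CP * y) * g y <= expR (- CP * x) * g x.
  move=> x y x0 xy yT; rewrite -lerN2 -!mulrN.
  apply: (@exp_gronwall _ (- g) (- P ^~ v) (- CP) T) => //.
  - by move=> z zT; exact: is_deriveN (dg z zT).
  - by apply/subspace_continuousP => z zT; apply: cvgN; move/subspace_continuousP : cg; exact.
  - move=> z zT; have [+ _] := PE z v zT Dv; rewrite ler_norml -/(g z) !fctE /=; lra.
have gE r : g r = Psi v + En r v by [].
rewrite -!gE in gs *.
move: sT tT; rewrite !in_itv/= => /andP[s0 sT] /andP[t0 tT].
have [st|/ltW ts] := leP s t.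
  have h := h1 s t s0 st tT.
  have gt : 0 < g t.
    rewrite -(pmulr_rgt0 _ (expR_gt0 (CP * t))); apply: lt_le_trans h.
    by rewrite mulr_gt0// expR_gt0.
  have h3 : g s <= expR (CP * s) * g s.
    by rewrite ler_peMl ?(ltW gs)// -expR0 ler_expR mulr_ge0.
  apply: le_trans h3 _; apply: le_trans h _; rewrite ler_pM2r// ler_expR.
  exact: ler_wpM2l.
have h := h2 t s t0 ts sT.
have gt : 0 < g t.
  rewrite -(pmulr_rgt0 _ (expR_gt0 (- CP * t))); apply: lt_le_trans h.
  by rewrite mulr_gt0// expR_gt0.
rewrite -(ler_pM2l (expR_gt0 (- CP * s))); apply: le_trans h _.
rewrite mulrA -expRD ler_pM2r// ler_expR.
have := ler_wpM2l CP0 sT; have := mulr_ge0 CP0 t0; lra.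
Qed.

Lemma sublevel_le E E' v : E <= E' -> sublevel Psi T D En E v -> sublevel Psi T D En E' v.
Proof. by move=> EE [Dv vE]; split => //; apply: le_trans vE _; rewrite lee_fin. Qed.

Lemma notin_sublevel E v : D v -> ~ sublevel Psi T D En E v ->
  exists2 s, s \in `[0, T] & E < Psi v + En s v.
Proof.
move=> Dv nv; apply: contrapT => h; apply: nv; split => //.
apply: (@le_trans _ _ ((Psi v)%:E + (E - Psi v)%:E)%E); last first.
  by rewrite -EFinD lee_fin addrC subrK.
rewrite /energy_sup leeD2l//.
apply: ge_ereal_sup => _ [s sT <-]; rewrite /energy asboolT// lee_fin.
rewrite lerBrDl leNgt; apply/negP => lt; apply: h; exists s => //.
Qed.

End energy_estimates.

Lemma cvg_to_pair {X Y : topologicalType} {I : Type} (F : set_system I)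
    {FF : Filter F} (f : I -> X) (g : I -> Y) (x : X) (y : Y) :
  f i @[i --> F] --> x -> g i @[i --> F] --> y ->
  (f i, g i) @[i --> F] --> (x, y).
Proof. by move=> fx gy; exact: (cvg_pair fx gy). Qed.

Lemma lsc_on_near {R : realType} {X : topologicalType} {I : Type}
    (F : set_system I) {FF : Filter F} (A : set X) (f : X -> R) (y : I -> X) p e :
  lsc_on A f -> A p -> (\forall i \near F, A (y i)) -> y i @[i --> F] --> p ->
  0 < e -> \forall i \near F, f p - e < f (y i).
Proof.
move=> fl Ap Ay yp e0.
have [|B pB BP] := fl p (f p - e); first by rewrite lte_fin ltrBlDr ltrDl.
have pB' : within A (nbhs p) B by rewrite (nbhs_subspace_in Ap).
have yB : F (fun i => A (y i) -> B (y i)) := yp _ pB'.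
near=> i; rewrite -lte_fin; apply: BP.
have Ai : A (y i) by near: i.
by move: Ai; near: i.
Unshelve. all: by end_near. Qed.

Section subdifferential_closed.
Context {R : realType} {V : normedModType R} (Psi : V -> R) (T : R).
Context (D : set V) (En : R -> V -> R).
Hypothesis Psi_potential : dissipation_potential Psi.
Hypothesis Psi_homogeneous : positively_homogeneous Psi.
Hypothesis En_admissible : admissible_energy Psi T D En.

Lemma Psi_wedge_continuous : continuous (Psi_wedge Psi).
Proof.
move=> v; rewrite /Psi_wedge.
have h : continuous (fun w : V => Psi (- w)).
  move=> w; apply: continuous_comp; [exact: opp_continuous|exact: (dp_cont Psi_potential)].
apply: continuous_min; [exact: (dp_cont Psi_potential)|exact: h].
Qed.

Lemma Psi_wedge_ge0 v : 0 <= Psi_wedge Psi v.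
Proof. by rewrite /Psi_wedge le_min !(dp_ge0 Psi_potential). Qed.

(** A global inequality on sublevels suffices for a Frechet subgradient.  A point
[v] near [x] that lies outside a high enough sublevel has, by [energy_growth],
an energy at time [t] so large that the inequality is trivial there.  In the
level [E1] below, 3 leaves room for the oscillations of [Psi] and of [xi]
near [x], both less than 1. *)
Lemma subdiff_of_inequality (E t : R) x (xi : V -> R^o) : 0 < E ->
  t \in `[0, T] -> D x -> dual xi ->
  (forall E' : R, 0 < E' -> sublevel Psi T D En E' x -> E <= E' -> exists om : V -> R,
     (forall e : R, 0 < e -> \forall v \near within (sublevel Psi T D En E') (nbhs x), om v < e) /\
     forall v, sublevel Psi T D En E' v ->
       En t x + xi (v - x) - om v * Psi_wedge Psi (v - x) <= En t v) ->
  sublevel Psi T D En E x ->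
  subdiff D En t x xi.
Proof.
move=> E0 tT Dx dxi h Ex; have [lxi cxi] := dxi.
have [M M0 PM] := potential_bounded Psi_potential Psi_homogeneous.
have [cg cg0 growth] := energy_growth En_admissible.
(* Above this level, growth back to time t exceeds the value at x by 3. *)
pose E1 := Num.max E (cg * (Psi x + En t x + 3)).
have EE1 : E <= E1 by rewrite le_max lexx.
have E10 : 0 < E1 by exact: lt_le_trans EE1.
have [om [omx omP]] := h E1 E10 (sublevel_le EE1 Ex) EE1.
split => // e e0.
have small : \forall v \near x, `|xi (v - x)| < 1.
  have : xi (v - x) @[v --> x] --> xi (x - x).
    apply: continuous_cvg; first exact: cxi.
    by apply: cvgB; [exact: cvg_id|exact: cvg_cst].
  by move/cvgr_norm_lt; apply; rewrite subrr (linear_form0 lxi) normr0.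
have Psmall : \forall v \near x, Psi v < Psi x + 1.
  have /cvgr_lt : Psi v @[v --> x] --> Psi x by exact: (dp_cont Psi_potential).
  by apply; rewrite ltrDl.
have omsmall : \forall v \near x, sublevel Psi T D En E1 v -> om v < e / M.
  exact: omx (e / M) (divr_gt0 e0 M0).
near=> v; rewrite /energy.
rewrite (asboolT Dx).
have [Dv|nDv] := pselect (D v); last by rewrite asboolF//= leey.
rewrite (asboolT Dv) -!EFinB lee_fin.
have v1 : `|xi (v - x)| < 1 by near: v.
have v2 : Psi v < Psi x + 1 by near: v.
have [Ev|nEv] := pselect (sublevel Psi T D En E1 v).
  have v3 : om v < e / M by move: Ev; near: v.
  have := omP v Ev.
  have : om v * Psi_wedge Psi (v - x) <= e * `|v - x|.
    have Pw0 := Psi_wedge_ge0 (v - x).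
    have PwM : Psi_wedge Psi (v - x) <= M * `|v - x|.
      by rewrite /Psi_wedge ge_min PM.
    apply: le_trans (ler_wpM2r Pw0 (ltW v3)) _.
    apply: le_trans (ler_wpM2l (ltW (divr_gt0 e0 M0)) PwM) _.
    by rewrite mulrA divfK// gt_eqF.
  lra.
have [s sT Es] := notin_sublevel Dv nEv.
have Es0 : 0 < Psi v + En s v by exact: lt_trans Es.
have := growth v s t Dv sT tT Es0.
have : cg * (Psi x + En t x + 3) <= E1 by rewrite le_max lexx orbT.
move=> a1 a2; have := lt_le_trans (le_lt_trans a1 Es) a2.
rewrite ltr_pM2l// => a3.
have : 0 <= e * `|v - x| by rewrite mulr_ge0// ltW.
move: v1; rewrite ltr_norml; lra.
Unshelve. all: by end_near. Qed.

(** The functionals [xi i] and [z i] are bounded by a fixed multiple of the norm,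
so they converge pointwise along the ultrafilter, to bounded linear limits.
The subdifferential inequality with modulus [omega] passes to the limit by the
semicontinuities of the energy and of [omega]. *)
Lemma dual_pair_closed {I : Type} (U : set_system I) (UU : UltraFilter U) (E : R)
    (s : I -> R) (x : I -> V) (xi z : I -> V -> R^o) (c : I -> R) (t : R) x0 (c0 : R) :
  0 < E -> t \in `[0, T] -> sublevel Psi T D En E x0 ->
  s i @[i --> U] --> t -> x i @[i --> U] --> x0 -> c i @[i --> U] --> c0 ->
  (\forall i \near U, s i \in `[0, T] /\ sublevel Psi T D En E (x i)) ->
  (\forall i \near U, subdiff D En (s i) (x i) (- xi i) /\ Kstar Psi (z i)) ->
  (\forall i \near U, 0 <= c i /\ (dual_norm (xi i - z i)%R <= (c i)%:E)%E) ->
  exists xi0 z0 : V -> R^o, [/\ subdiff D En t x0 (- xi0), Kstar Psi z0 &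
    (dual_norm (xi0 - z0)%R <= c0%:E)%E].
Proof.
move=> E0 tT Ex0 st xx0 cc0 sx xiz cP.
have [M M0 PM] := potential_bounded Psi_potential Psi_homogeneous.
have c00 : 0 <= c0.
  by apply: (ler_limit (cvg_cst _) cc0); apply: filterS cP => i [].
have linP : \forall i \near U, linear (xi i) /\ linear (z i).
  by apply: filterS xiz => i [[[l _] _ _] [[lz _] _]]; split => //; exact: linear_form_oppK.
have zM v : \forall i \near U, `|z i v| <= M * `|v|.
  by apply: filterS xiz => i [_ zK]; exact: Kstar_bounded PM zK v.
have [zl zlP] : exists zl : V -> R^o, forall v, z i v @[i --> U] --> (zl v : R).
  suff /choice[zl zlP] : forall v, exists y : R^o, z i v @[i --> U] --> (y : R) by exists zl.
  by move=> v; exact: bounded_ultra_cvg (zM v).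
have dn : \forall i \near U, forall v, `|xi i v - z i v| <= (c0 + 1) * `|v|.
  have cc : \forall i \near U, c i < c0 + 1 by move/cvgr_lt : cc0; apply; rewrite ltrDl.
  near=> i; have [lx lz] : linear (xi i) /\ linear (z i) by near: i.
  have [ci0 ciP] : 0 <= c i /\ (dual_norm (xi i - z i)%R <= (c i)%:E)%E by near: i.
  move=> v; have /dual_norm_leP h := ciP.
  apply: le_trans (h _ ci0 v) _; first exact: linear_form_sub.
  by rewrite ler_wpM2r// ltW//; near: i.
have xM : \forall i \near U, forall v, `|xi i v| <= (M + (c0 + 1)) * `|v|.
  near=> i => v; rewrite -[xi i v](subrK (z i v)).
  apply: le_trans (ler_normD _ _) _; rewrite addrC mulrDl lerD//.
    have zK : Kstar Psi (z i) by have [] : subdiff D En (s i) (x i) (- xi i) /\ Kstar Psi (z i) by near: i.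
    exact: Kstar_bounded PM zK v.
  by move: v; near: i.
have [xl xlP] : exists xl : V -> R^o, forall v, xi i v @[i --> U] --> (xl v : R).
  suff /choice[xl xlP] : forall v, exists y : R^o, xi i v @[i --> U] --> (y : R) by exists xl.
  move=> v; apply: (@bounded_ultra_cvg _ _ _ _ _ ((M + (c0 + 1)) * `|v|)).
  by apply: filterS xM => i; exact.
have lim_lin (f : I -> V -> R^o) (fl : V -> R^o) : (forall v, f i v @[i --> U] --> (fl v : R)) ->
    (\forall i \near U, linear (f i)) -> linear fl.
  move=> ffl lf r a b.
  have h1 : r * f i a + f i b @[i --> U] --> (r * fl a + fl b : R).
    by apply: cvgD => //; apply: cvgMr; exact: ffl.
  apply/le_anti/andP; split.
    by apply: (ler_limit (ffl _) h1); apply: filterS lf => i ->.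
  by apply: (ler_limit h1 (ffl _)); apply: filterS lf => i ->.
have lzl : linear zl by apply: lim_lin zlP _; apply: filterS linP => i [].
have lxl : linear xl by apply: lim_lin xlP _; apply: filterS linP => i [].
have bxl v : `|xl v| <= (M + (c0 + 1)) * `|v|.
  apply: (ler_limit (cvg_norm (xlP v)) (cvg_cst _)).
  by apply: filterS xM => i; exact.
have bzl v : `|zl v| <= M * `|v| by exact: (ler_limit (cvg_norm (zlP v)) (cvg_cst _)).
have dxl : dual (- xl).
  apply: (@linear_bounded_dual _ _ _ (M + (c0 + 1))); first exact: linear_form_opp.
  by move=> v; rewrite fctE normrN.
exists xl, zl; split; last 2 first.
- split; first exact: linear_bounded_dual bzl.
  move=> v; apply: (ler_limit (zlP v) (cvg_cst _)).
  by apply: filterS xiz => i [_ [_]]; exact.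
- apply/dual_norm_leP => //; first exact: linear_form_sub.
  move=> v; rewrite !fctE.
  have h1 : `|xi i v - z i v| @[i --> U] --> `|xl v - zl v|.
    by apply: cvg_norm; apply: cvgB; [exact: xlP|exact: zlP].
  have h2 : c i * `|v| @[i --> U] --> c0 * `|v| by apply: cvgMl.
  apply: (ler_limit h1 h2); near=> i.
  have [lx lz] : linear (xi i) /\ linear (z i) by near: i.
  have [ci0 ciP] : 0 <= c i /\ (dual_norm (xi i - z i)%R <= (c i)%:E)%E by near: i.
  by have /dual_norm_leP := ciP; apply => //; exact: linear_form_sub.
have [Dx0 _] := Ex0.
apply: (subdiff_of_inequality E0) => // E1 E10 E1x EE1.
have [om [omu om0 omP]] := en_subdiff En_admissible E10.
have tT' : t \in `[0, T]%classic by rewrite inE.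
exists (fun v => om t x0 v); split.
  move=> e e0.
  have := @lsc_on_near R (R * V * V)%type V (within (sublevel Psi T D En E1) (nbhs x0)) _ _ _
    (fun v => ((t, x0), v)) ((t, x0), x0) e omu.
  rewrite /= om0// oppr0 sub0r => h.
  have {}h : \forall v \near within (sublevel Psi T D En E1) (nbhs x0), - e < - om t x0 v.
    apply: h => //.
    - by apply: filterS (withinT _ _) => v Ev; split.
    - by apply: cvg_to_pair; [exact: cvg_cst|exact: cvg_within].
  by apply: filterS h => v; rewrite ltrN2.
move=> v Ev.
set Pw := Psi_wedge Psi (v - x0).
apply: (@ler_eps_mul _ _ _ (1 + Pw)) => e e0.
have cx : v - x i @[i --> U] --> v - x0 by apply: cvgB => //; exact: cvg_cst.
have c1 : xi i (v - x i) @[i --> U] --> xl (v - x0).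
  have h1 : xi i (x0 - x i) @[i --> U] --> (0 : R).
    apply/cvgr0Pnorm_lt => d d0.
    have K0 : 0 < M + (c0 + 1) by rewrite addr_gt0// ltr_wpDl.
    have xs : \forall i \near U, `|x0 - x i| < d / (M + (c0 + 1)).
      by move/cvgrPdist_lt : xx0; apply; rewrite divr_gt0.
    near=> i; have bi : forall v, `|xi i v| <= (M + (c0 + 1)) * `|v| by near: i.
    apply: le_lt_trans (bi _) _; rewrite mulrC -ltr_pdivlMr//; near: i; exact: xs.
  have h2 : xi i (v - x0) + xi i (x0 - x i) @[i --> U] --> (xl (v - x0) + 0 : R).
    by apply: cvgD => //; exact: xlP.
  rewrite addr0 in h2; apply: cvg_trans h2; apply: near_eq_cvg.
  near=> i; have [lx _] : linear (xi i) /\ linear (z i) by near: i.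
  by rewrite -(linear_formD lx) addrA subrK.
have c2 : Psi_wedge Psi (v - x i) @[i --> U] --> Pw.
  by apply: continuous_cvg => //; exact: Psi_wedge_continuous.
have c3 : En (s i) v @[i --> U] --> En t v.
  move=> B /(energy_time_cvg En_admissible tT Ev.1) /st sB.
  have sB' : \forall i \near U, s i \in `[0, T] -> B (En (s i) v) by exact: sB.
  suff : \forall i \near U, B (En (s i) v) by [].
  near=> i; have [si _] : s i \in `[0, T] /\ sublevel Psi T D En E (x i) by near: i.
  by move: si; near: i.
have n1 : \forall i \near U, En t x0 - e < En (s i) (x i).
  apply: (@lsc_on_near R _ _ U _ _ (fun p : R * V => En p.1 p.2) (fun i => (s i, x i)) (t, x0) e (en_lsc En_admissible)) => //.
  - by apply: filterS sx => i [? [? _]]; split.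
  - by apply: cvg_to_pair.
have n2 : \forall i \near U, om (s i) (x i) v < om t x0 v + e.
  have h : \forall i \near U, - om t x0 v - e < - om (s i) (x i) v.
    apply: (@lsc_on_near R _ _ U _ _ _ (fun i => ((s i, x i), v)) ((t, x0), v) e omu) => //.
    - by apply: filterS sx => i [? ?]; split => //; split => //; exact: sublevel_le EE1 _.
    - by apply: cvg_to_pair; [apply: cvg_to_pair|exact: cvg_cst].
  by apply: filterS h => i; lra.
have c4 : En t x0 - e - xi i (v - x i) - (om t x0 v + e) * Psi_wedge Psi (v - x i) @[i --> U]
    --> En t x0 - e - xl (v - x0) - (om t x0 v + e) * Pw.
  apply: cvgB; last by apply: cvgMr.
  by apply: cvgB => //; exact: cvg_cst.
have H : \forall i \near U, En t x0 - e - xi i (v - x i) - (om t x0 v + e) * Psi_wedge Psi (v - x i) <= En (s i) v.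
  near=> i.
  have [si xsi] : s i \in `[0, T] /\ sublevel Psi T D En E (x i) by near: i.
  have [di _] : subdiff D En (s i) (x i) (- xi i) /\ Kstar Psi (z i) by near: i.
  have := omP (s i) (x i) v _ si (sublevel_le EE1 xsi) Ev di.
  have : En t x0 - e < En (s i) (x i) by near: i.
  have : om (s i) (x i) v * Psi_wedge Psi (v - x i) <= (om t x0 v + e) * Psi_wedge Psi (v - x i).
    apply: ler_wpM2r; first exact: Psi_wedge_ge0.
    by apply: ltW; near: i.
  rewrite fctE; lra.
have := ler_limit c4 c3 H => /(_ (@ultra_proper _ _ UU)).
by rewrite (_ : (- xl) _ = - xl (v - x0))// mulrDr mulr1 mulrDl; lra.
Unshelve. all: by end_near. Qed.
Lemma gap_lt_witness t x (c : R) : (stability_gap Psi D En t x < c%:E)%E ->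
  exists p : (V -> R^o) * (V -> R^o), [/\ subdiff D En t x (- p.1), Kstar Psi p.2 &
    (dual_norm (p.1 - p.2)%R <= c%:E)%E].
Proof.
by move=> /ereal_inf_lt[_ [xi xix [z zK <-]] lt]; exists (xi, z); split => //; exact: ltW.
Qed.

(** Pairs that almost realise the gap have a limit pair by [dual_pair_closed]. *)
Lemma gap_lsc {I : Type} (U : set_system I) (UU : UltraFilter U) (E : R)
    (s : I -> R) (x : I -> V) (t : R) x0 (c : R) :
  0 < E -> 0 <= c -> t \in `[0, T] -> sublevel Psi T D En E x0 ->
  s i @[i --> U] --> t -> x i @[i --> U] --> x0 ->
  (\forall i \near U, s i \in `[0, T] /\ sublevel Psi T D En E (x i)) ->
  (\forall i \near U, (stability_gap Psi D En (s i) (x i) <= c%:E)%E) ->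
  (stability_gap Psi D En t x0 <= c%:E)%E.
Proof.
move=> E0 c0 tT Ex0 st xx0 sx gc; apply/lee_addgt0Pr => e e0.
have /choice[p pP] : forall i, exists p : (V -> R^o) * (V -> R^o),
    (stability_gap Psi D En (s i) (x i) <= c%:E)%E ->
    [/\ subdiff D En (s i) (x i) (- p.1), Kstar Psi p.2 &
    (dual_norm (p.1 - p.2)%R <= (c + e)%:E)%E].
  move=> i; have [gi|ngi] := pselect (stability_gap Psi D En (s i) (x i) <= c%:E)%E.
    have /gap_lt_witness[p pP] : (stability_gap Psi D En (s i) (x i) < (c + e)%:E)%E.
      by apply: le_lt_trans gi _; rewrite lte_fin ltrDl.
    by exists p.
  by exists (0, 0).
have [||xi0 [z0 [xiP zP dn]]] := @dual_pair_closed I U UU E s x (fun i => (p i).1)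
  (fun i => (p i).2) (fun=> c + e) t x0 (c + e) E0 tT Ex0 st xx0 (cvg_cst _) sx.
- by apply: filterS gc => i /pP[].
- by apply: filterS gc => i /pP[_ _ ?]; split => //; rewrite addr_ge0// ltW.
rewrite -EFinD; apply: le_trans dn; apply: ereal_inf_lbound.
by exists xi0 => //; exists z0.
Qed.

(** The infimum in the gap is attained: [dual_pair_closed] is applied to one point
and to pairs at distance [1 / (n + 1)]. *)
Lemma gap_eq0_locally_stable (E t : R) x : 0 < E -> t \in `[0, T] ->
  sublevel Psi T D En E x -> (stability_gap Psi D En t x <= 0)%E ->
  locally_stable Psi D En t x.
Proof.
move=> E0 tT Ex gx.
have /choice[p pP] : forall n : nat, exists p : (V -> R^o) * (V -> R^o),
    [/\ subdiff D En t x (- p.1), Kstar Psi p.2 &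
    (dual_norm (p.1 - p.2)%R <= (n.+1%:R^-1)%:E)%E].
  by move=> n; apply: gap_lt_witness; apply: le_lt_trans gx _; rewrite lte_fin invr_gt0.
have [U [UU oU]] := @ultraFilterLemma _ \oo _.
have [|||xi0 [z0 [xiP zP dn]]] := @dual_pair_closed nat U UU E (fun=> t) (fun=> x)
  (fun i => (p i).1) (fun i => (p i).2) (fun n => n.+1%:R^-1) t x 0 E0 tT Ex
  (cvg_cst _) (cvg_cst _) (ultra_le oU (@cvg_harmonic R)).
- by apply: filterE.
- by apply: filterE => i; have [] := pP i.
- by apply: filterE => i; have [] := pP i.
exists z0 => //; exists (- xi0) => //; apply/funext => v.
have [[lxi _] _ _] := xiP; have [[lz _] _] := zP.
have lxi0 := linear_form_oppK lxi.
have /dual_norm_leP := dn => /(_ _ (lexx _) v).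
rewrite !fctE mul0r normr_le0 => h; apply/eqP; rewrite -oppr_eq0 opprD opprK addrC.
by apply: h; exact: linear_form_sub.
Qed.

End subdifferential_closed.

(** * Integrals of functions without measurability *)

Section lower_integral.
Context {d : measure_display} {T : measurableType d} {R : realType}.
Variable mu : {measure set T -> \bar R}.
Local Open Scope ereal_scope.
Import HBNNSimple.
Implicit Types (f g : T -> \bar R) (D A : set T).

Lemma nnsfun_le_ae_integral f g (h : {nnsfun T >-> R}) :
  (forall x, 0 <= g x) -> {ae mu, forall x, f x <= g x} ->
  (forall x, (h x)%:E <= f x) -> sintegral mu h <= \int[mu]_x g x.
Proof.
move=> g0 [N [mN N0 fgN]] hf.
have mNc : measurable (~` N) by exact: measurableC.
have -> : sintegral mu h = sintegral mu (proj_nnsfun h mNc).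
  rewrite -!integralT_nnsfun; apply: ge0_ae_eq_integral => //.
  - by apply/measurable_EFinP; exact: measurable_funP.
  - by apply/measurable_EFinP; exact: measurable_funP.
  - by move=> x _; rewrite lee_fin.
  - by move=> x _; rewrite lee_fin.
  exists N; split => // x /= hx; apply: contrapT => nN; apply: hx => _.
  by rewrite mindicE /= mem_set// mulr1.
rewrite ge0_integralTE//; apply: ereal_sup_ubound.
exists (proj_nnsfun h mNc) => // x /=; rewrite mindicE.
have [Nx|nNx] := pselect (N x).
  by rewrite memNset ?mulr0//= => /(_ Nx).
rewrite mem_set// mulr1; apply: le_trans (hf x) _.
by apply: contrapT => h1; apply: nNx; apply: fgN.
Qed.

(** The integral of a nonnegative function is by definition the supremum of the
integrals of its simple minorants, so it is monotone, even for inequalities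
valid almost everywhere and for functions that are not measurable.  This serves
for the dissipation, whose integrand need not be Borel. *)
Lemma ae_le_lower_integral D f g :
  (forall x, D x -> 0 <= f x) -> (forall x, D x -> 0 <= g x) ->
  {ae mu, forall x, D x -> f x <= g x} ->
  \int[mu]_(x in D) f x <= \int[mu]_(x in D) g x.
Proof.
move=> f0 g0 fg; rewrite integral_mkcond [leRHS]integral_mkcond.
have f0' x : 0 <= (f \_ D) x by rewrite patchE; case: ifPn => // /set_mem/f0.
have g0' x : 0 <= (g \_ D) x by rewrite patchE; case: ifPn => // /set_mem/g0.
rewrite [leLHS]ge0_integralTE//; apply: ge_ereal_sup => _ [h hf <-].
apply: nnsfun_le_ae_integral hf => //; apply: filterS fg => x fg.
by rewrite !patchE; case: ifPn => // /set_mem/fg.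
Qed.

(** The integral of [f] is at most that of its positive part. *)
Lemma lower_integral_le D f g : (forall x, D x -> 0 <= g x) ->
  {ae mu, forall x, D x -> f x <= g x} ->
  \int[mu]_(x in D) f x <= \int[mu]_(x in D) g x.
Proof.
move=> g0 fg; rewrite [leLHS]integralE.
apply: (@le_trans _ _ (\int[mu]_(x in D) f^\+ x)).
  rewrite geeDl// oppe_le0; apply: integral_ge0 => x _; exact: funeneg_ge0.
apply: ae_le_lower_integral => //.
apply: filterS fg => x fg Dx; rewrite funeposE ge_max fg//=; exact: g0.
Qed.

(** [g] is the supremum of a sequence of simple minorants whose integrals tend to
that of [f].  If a simple minorant of [f] did better than [g] on some [A], then
glued with [g] outside [A] it would do better on [D]. *)
Lemma measurable_minorant D f : measurable D -> (forall x, D x -> 0 <= f x) ->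
  \int[mu]_(x in D) f x \is a fin_num ->
  exists g : T -> \bar R, [/\ measurable_fun setT g, forall x, 0 <= g x,
    forall x, D x -> g x <= f x &
    forall A, measurable A -> A `<=` D ->
      \int[mu]_(x in A) f x = \int[mu]_(x in A) g x].
Proof.
move=> mD f0 If.
have f0' x : 0 <= (f \_ D) x by rewrite patchE; case: ifPn => // /set_mem/f0.
move: (If); rewrite integral_mkcond ge0_integralTE//.
set S := (X in ereal_sup X) => supS.
have /choice[h hP] : forall k : nat, exists h : {nnsfun T >-> R},
    (forall x, (h x)%:E <= (f \_ D) x) /\
    \int[mu]_(x in D) f x - (k.+1%:R^-1)%:E <= sintegral mu h.
  move=> k; have k0 : (0 < k.+1%:R^-1 :> R)%R by rewrite invr_gt0.
  have [_ [h hf <-] hk] := ub_ereal_sup_adherent k0 supS.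
  by exists h; split => //; rewrite integral_mkcond ge0_integralTE//; exact: ltW.
pose g x := esups (fun k => (h k x)%:E) 0%N.
have hg k x : (h k x)%:E <= g x by apply: ereal_sup_ubound; exists k.
have gf x : g x <= (f \_ D) x by apply: ge_ereal_sup => _ [k _ <-]; exact: (hP k).1.
have g0 x : 0 <= g x by apply: le_trans (hg 0%N x); rewrite lee_fin.
have mg : measurable_fun setT g.
  apply: (@measurable_fun_esups _ _ _ setT (fun k x => (h k x)%:E)) => k.
  by apply/measurable_EFinP; exact: measurable_funP.
exists g; split => // [x Dx|A mA AD].
  by have := gf x; rewrite patchE mem_set.
have mgD B : measurable_fun B g by exact: measurable_funTS.
have Ig : \int[mu]_(x in D) f x <= \int[mu]_(x in D) g x.
  apply/lee_addgt0Pr => e e0.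
  have [k ke] : exists k : nat, (k.+1%:R^-1 < e)%R.
    have [k _ /(_ _ (leqnn k)) kP] := near_infty_natSinv_lt (PosNum e0).
    by exists k.
  have : \int[mu]_(x in D) f x - (k.+1%:R^-1)%:E <= \int[mu]_(x in D) g x.
    apply: le_trans (hP k).2 _; rewrite [leRHS]integral_mkcond.
    apply: (@nnsfun_le_ae_integral (fun x => (h k x)%:E)) => //.
      by move=> x; rewrite patchE; case: ifPn.
    apply: aeW => x; rewrite patchE; case: ifPn => [_|xD]; first exact: hg.
    by have := (hP k).1 x; rewrite patchE (negbTE xD).
  rewrite leeBlDr// => /le_trans; apply; apply: leeD2l.
  by rewrite lee_fin ltW.
apply/le_anti/andP; split; last first.
  apply: ae_le_lower_integral => // [x /AD/f0//|].
  by apply: aeW => x /AD Dx; have := gf x; rewrite patchE mem_set.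
have Ifin : \int[mu]_(x in D `\` A) g x \is a fin_num.
  rewrite ge0_fin_numE ?integral_ge0//.
  apply: (@le_lt_trans _ _ (\int[mu]_(x in D) f x)); last by rewrite ltey_eq If.
  apply: (@le_trans _ _ (\int[mu]_(x in D) g x)).
    by apply: ge0_subset_integral => //; exact: measurableD.
  apply: ae_le_lower_integral => //.
  by apply: aeW => x Dx; have := gf x; rewrite patchE mem_set.
have mDA : measurable (D `\` A) by exact: measurableD.
rewrite integral_mkcond ge0_integralTE; last first.
  by move=> x; rewrite patchE; case: ifPn => // /set_mem/AD/f0.
apply: ge_ereal_sup => _ [k kf <-].
(* Adding the finite integral of g outside A reduces the claim to D. *)
rewrite -(leeD2rE _ _ Ifin).
have <- : \int[mu]_(x in D) g x = \int[mu]_(x in A) g x + \int[mu]_(x in D `\` A) g x.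
  rewrite -ge0_integral_setU//; last by apply/disj_setPS => x [Ax [_]].
  by rewrite setDUK.
apply: le_trans Ig; rewrite -integralT_nnsfun [X in _ + X]integral_mkcond.
rewrite -ge0_integralD//; last 4 first.
- by move=> x _; rewrite lee_fin.
- by apply/measurable_EFinP; exact: measurable_funP.
- by move=> x _; rewrite patchE; case: ifPn.
- by apply/measurable_restrict => //; exact: measurable_funTS.
rewrite [leRHS]integral_mkcond.
apply: ae_le_lower_integral => //.
  move=> x _; apply: adde_ge0; first by rewrite lee_fin.
  by rewrite patchE; case: ifPn.
apply: aeW => x _.
have := kf x; rewrite !patchE.
have [Ax|nAx] := pselect (A x).
  rewrite (mem_set Ax) (mem_set (AD _ Ax)) memNset ?adde0//.
  by move=> [].
rewrite (memNset nAx) => kx.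
have -> : (k x)%:E = 0.
  by apply/le_anti; rewrite kx lee_fin fun_ge0.
rewrite add0e; have [Dx|nDx] := pselect (D x).
  by rewrite (mem_set Dx) mem_set//; have := gf x; rewrite patchE mem_set.
by rewrite !memNset// => -[].
Qed.

End lower_integral.

Section dissipation_primitive.
Context {R : realType}.
Local Notation mu := (@lebesgue_measure R).

(** Additivity over adjacent intervals fails for integrals of arbitrary functions;
here it comes from the minorant, which has the same integrals as [f]. *)
Lemma integral_primitive (T : R) (f : R -> \bar R) : 0 <= T ->
  (forall x, x \in `[0, T] -> (0 <= f x)%E) ->
  (\int[mu]_(x in `[0%R, T]%classic) f x < +oo)%E ->
  exists A : R -> R, [/\ {within `[0, T], continuous A}, A 0 = 0 &
    forall r s : R, 0 <= r -> r <= s -> s <= T ->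
      (\int[mu]_(x in `[r, s]%classic) f x = (A s - A r)%:E)%E].
Proof.
move=> T0 f0 If.
have Ifn : (\int[mu]_(x in `[0%R, T]) f x)%E \is a fin_num.
  by rewrite ge0_fin_numE// integral_ge0.
have mI : measurable (`[0, T]%classic : set (measurableTypeR R)) by exact: measurable_itv.
have [g [mg g0 gf gE]] := @measurable_minorant _ _ _ mu _ f mI f0 Ifn.
have ig : mu.-integrable `[0, T] g.
  apply/integrableP; split; first exact: measurable_funTS.
  under eq_integral do rewrite gee0_abs//.
  by rewrite -gE.
have gfin := integrable_ae mI ig.
pose k := fine \o g.
have mk : measurable_fun setT (EFin \o k).
  by apply/measurable_EFinP; apply: measurableT_comp mg; exact: fine_measurable.
have k0 x : 0 <= k x by rewrite /k /= fine_ge0.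
have kE A : measurable A -> A `<=` `[0, T] ->
    (\int[mu]_(x in A) f x = \int[mu]_(x in A) (k x)%:E)%E.
  move=> mA A0T; rewrite gE//; apply: ge0_ae_eq_integral => //.
  - exact: measurable_funTS.
  - exact: (measurable_funTS mk).
  - by move=> x _; rewrite lee_fin.
  - by apply: filterS gfin => x gx /A0T/gx gx'; rewrite /k /= fineK.
have ik : mu.-integrable `[0, T] (EFin \o k).
  apply/integrableP; split; first exact: measurable_funTS.
  under eq_integral do rewrite gee0_abs ?lee_fin//.
  by rewrite -kE//.
exists (fun x => parameterized_integral mu 0 x k); split.
- exact: parameterized_integral_continuous.
- by rewrite /parameterized_integral set_itv1 Rintegral_set1.
- move=> r s r0 rs sT.
  have sub : `[r, s] `<=` `[0, T] by apply: subset_itv; rewrite bnd_simp.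
  rewrite kE//.
  have sub1 : `[0, r] `<=` `[0, T] by apply: subset_itv; rewrite bnd_simp// (le_trans rs).
  have sub2 : `[0, s] `<=` `[0, T] by apply: subset_itv; rewrite bnd_simp.
  have int1 : mu.-integrable `[0, s] (EFin \o k) by apply: integrableS ik.
  have int2 : mu.-integrable `]r, s] (EFin \o k).
    apply: integrableS ik => //; apply: subset_trans sub.
    exact: subset_itv_oc_cc.
  rewrite -(@integral_itv_obnd_cbnd _ _ (BRight s)); last exact: measurable_funTS.
  rewrite /parameterized_integral Rintegral_itvB ?bnd_simp//.
  by rewrite /Rintegral fineK// integrable_fin_num.
Qed.

End dissipation_primitive.

(** * Extension of an additive set function to a vector measure *)

Ltac solve_measurable := try solve [repeat first
  [assumption | apply: measurableD | apply: measurableU | apply: measurableI | apply: measurableC]].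

Section vector_measure_extension.
Context {d : measure_display} {Om : measurableType d} {R : realType}.
Context {V : completeNormedModType R}.
Variable lam : {finite_measure set Om -> \bar R}.
Implicit Types (A B C : set Om).

Definition meas A : R := fine (lam A).
(** The measure of the symmetric difference, as a sum of two terms so that each can
be estimated by an inclusion. *)
Definition sdist A B : R := meas (A `\` B) + meas (B `\` A).

Lemma meas_fin A : measurable A -> (meas A)%:E = lam A.
Proof. by move=> mA; rewrite fineK// fin_num_measure. Qed.

Lemma meas_ge0 A : 0 <= meas A.
Proof. by rewrite fine_ge0. Qed.

Lemma meas0 : meas set0 = 0.
Proof. by rewrite /meas measure0. Qed.

Lemma meas_sub A B C : measurable A -> measurable B -> measurable C ->
  A `<=` B `|` C -> meas A <= meas B + meas C.
Proof.
move=> mA mB mC ABC; rewrite -lee_fin EFinD !meas_fin//.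
apply: (@le_trans _ _ (lam (B `|` C))); first by rewrite le_measure ?inE//; exact: measurableU.
exact: measureU2.
Qed.

Lemma meas_le A B : measurable A -> measurable B -> A `<=` B -> meas A <= meas B.
Proof.
move=> mA mB AB; rewrite -[leRHS]addr0 -meas0; apply: meas_sub => //.
by rewrite setU0.
Qed.

Lemma measD A B : measurable A -> measurable B -> A `<=` B ->
  meas (B `\` A) = meas B - meas A.
Proof.
move=> mA mB AB; apply: EFin_inj; rewrite EFinB !meas_fin//; last exact: measurableD.
rewrite measureD//; first by rewrite setIidr.
by rewrite ltey_eq fin_num_measure.
Qed.

Lemma sdistC A B : sdist A B = sdist B A.
Proof. by rewrite /sdist addrC. Qed.

Lemma sdist_triangle A B C : measurable A -> measurable B -> measurable C ->
  sdist A C <= sdist A B + sdist B C.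
Proof.
move=> mA mB mC; rewrite /sdist addrACA [X in _ <= _ + X]addrC.
apply: lerD; apply: meas_sub; solve_measurable.
- move=> x [Ax nC]; have [Bx|nB] := pselect (B x); [by right|by left].
- move=> x [Cx nA]; have [Bx|nB] := pselect (B x); [by right|by left].
Qed.

Lemma sdistU A A' B B' : measurable A -> measurable A' -> measurable B -> measurable B' ->
  sdist (A `|` A') (B `|` B') <= sdist A B + sdist A' B'.
Proof.
move=> mA mA' mB mB'; rewrite /sdist addrACA.
apply: lerD; apply: meas_sub; solve_measurable.
- by move=> x [[Ax|Ax] /not_orP[? ?]]; [left|right].
- by move=> x [[Ax|Ax] /not_orP[? ?]]; [left|right].
Qed.

Lemma sdistCC A B : sdist (~` A) (~` B) = sdist A B.
Proof. by rewrite /sdist !setDE !setCK setIC addrC; congr (_ + _); rewrite setIC. Qed.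

Lemma sdist0 A : sdist A set0 = meas A.
Proof. by rewrite /sdist setD0 set0D meas0 addr0. Qed.

Lemma sdist_sub A B : A `<=` B -> sdist A B = meas (B `\` A).
Proof. by rewrite -setD_eq0 => AB; rewrite /sdist AB meas0 add0r. Qed.

Lemma meas_bigcup_tail (F : nat -> set Om) e : (forall i, measurable (F i)) -> 0 < e ->
  \forall n \near \oo, meas ((\bigcup_i F i) `\` \big[setU/set0]_(i < n) F i) < e.
Proof.
move=> mF e0.
pose G n := \big[setU/set0]_(i < n) F i.
have mG n : measurable (G n) by exact: bigsetU_measurable.
have mUF : measurable (\bigcup_i F i) by exact: bigcup_measurable.
have UG : \bigcup_n G n = \bigcup_i F i.
  apply/seteqP; split=> x.
    by move=> [n _]; rewrite /G -bigcup_mkord => -[i _ Fx]; exists i.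
  by move=> [i _ Fx]; exists i.+1 => //; rewrite /G -bigcup_mkord; exists i => /=.
have ndG : nondecreasing_seq G.
  by move=> n m nm; apply/subsetPset; exact: subset_bigsetU.
have := @nondecreasing_cvg_mu _ _ _ lam G mG _ ndG.
rewrite UG => /(_ mUF) cG.
have {cG}cG : meas (G n) @[n --> \oo] --> meas (\bigcup_i F i).
  apply: (@fine_cvg _ _ _ _ (lam \o G)).
  by rewrite fineK ?fin_num_measure//; exact: cG.
have h0 : \forall n \near \oo, meas (\bigcup_i F i) - e < meas (G n).
  by move/cvgr_gt : cG; apply; rewrite ltrBlDr ltrDl.
apply: filterS h0 => n h.
rewrite measD//; first by rewrite -/(G n); lra.
  exact: mG.
by rewrite -UG; exact: (@bigcup_sup _ _ _ _ G).
Qed.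

Variable AA : set (set Om).
Hypothesis AA_measurable : AA `<=` measurable.
Hypothesis AA0 : AA set0.
Hypothesis AAC : forall A, AA A -> AA (~` A).
Hypothesis AAU : forall A B, AA A -> AA B -> AA (A `|` B).

Definition approximable : set (set Om) :=
  [set A | measurable A /\ forall e, 0 < e -> exists2 B, AA B & sdist A B < e].

Lemma approximableU A B : approximable A -> approximable B -> approximable (A `|` B).
Proof.
move=> [mA apA] [mB apB]; split=> [|e e0]; first exact: measurableU.
have [A' AA' dA] := apA (e / 2) ltac:(by rewrite divr_gt0).
have [B' BB' dB] := apB (e / 2) ltac:(by rewrite divr_gt0).
exists (A' `|` B'); first exact: AAU.
apply: le_lt_trans (sdistU mA mB (AA_measurable AA') (AA_measurable BB')) _.
by rewrite [ltRHS]splitr ltrD.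
Qed.

Lemma approximableC A : approximable A -> approximable (~` A).
Proof.
move=> [mA apA]; split=> [|e e0]; first exact: measurableC.
by have [B BB dB] := apA e e0; exists (~` B); [exact: AAC|rewrite sdistCC].
Qed.

(** Only countable unions require an argument: a finite partial union is close to
the union by continuity of the measure from below. *)
Lemma approximable_sigma_algebra : sigma_algebra setT approximable.
Proof.
split.
- by split => // e e0; exists set0 => //; rewrite sdist0 meas0.
- by move=> A; rewrite setTD; exact: approximableC.
- move=> F apF; have mF i : measurable (F i) by have [] := apF i.
  split=> [|e e0]; first exact: bigcup_measurable.
  have e20 : 0 < e / 2 by rewrite divr_gt0.
  have [n _ /(_ _ (leqnn n)) hn] := meas_bigcup_tail mF e20.
  have [mU apU] : approximable (\big[setU/set0]_(i < n) F i).
    elim/big_ind : _ => //; last exact: approximableU.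
    by split => // e' e'0; exists set0 => //; rewrite sdist0 meas0.
  have [B BB dB] := apU _ e20.
  exists B => //.
  apply: le_lt_trans (sdist_triangle _ mU (AA_measurable BB)) _.
    exact: bigcup_measurable.
  rewrite [ltRHS]splitr ltrD// sdistC sdist_sub//.
  by rewrite -bigcup_mkord => x [i _ Fx]; exists i.
Qed.

Variable L : set Om -> V.
Hypothesis L0 : L set0 = 0.
Hypothesis LU : forall A B, AA A -> AA B -> A `&` B = set0 -> L (A `|` B) = L A + L B.
Hypothesis L_le : forall A B, AA A -> AA B -> `|L A - L B| <= sdist A B.
Hypothesis approximable_measurable : measurable `<=` approximable.

(** [L] is 1-Lipschitz for the pseudometric [sdist], so it takes a Cauchy sequence
of approximations of [A] to a Cauchy sequence. *)
Lemma extension_point A : measurable A ->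
  exists v : V, forall B, AA B -> `|v - L B| <= sdist A B.
Proof.
move=> mA; have [_ apA] := approximable_measurable mA.
have /choice[B BP] : forall n : nat, exists B, AA B /\ sdist A B < n.+1%:R^-1.
  by move=> n; have [|B BB dB] := apA n.+1%:R^-1; [rewrite invr_gt0|exists B].
have mB n : measurable (B n) := AA_measurable (BP n).1.
have cL : cvg (L (B n) @[n --> \oo]).
  apply: cauchy_cvg; apply: cauchy_exP => e e0.
  have e20 : 0 < e / 2 by rewrite divr_gt0.
  have [N _ hN] := near_infty_natSinv_lt (PosNum e20).
  exists (L (B N)); exists N => // n /= Nn.
  rewrite -ball_normE /=; apply: le_lt_trans (L_le (BP N).1 (BP n).1) _.
  apply: le_lt_trans (sdist_triangle (mB N) mA (mB n)) _.
  rewrite sdistC [ltRHS]splitr ltrD//.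
    by apply: lt_trans (BP N).2 _; apply: hN => /=.
  by apply: lt_trans (BP n).2 _; exact: hN.
exists (lim (L (B n) @[n --> \oo])) => B' BB'.
have h1 : `|L (B n) - L B'| @[n --> \oo] --> `|lim (L (B n) @[n --> \oo]) - L B'|.
  by apply: cvg_norm; apply: cvgB => //; exact: cvg_cst.
have h2 : n.+1%:R^-1 + sdist A B' @[n --> \oo] --> 0 + sdist A B'.
  by apply: cvgD; [exact: cvg_harmonic|exact: cvg_cst].
rewrite add0r in h2; apply: (ler_limit h1 h2); apply: nearW => n.
apply: le_trans (L_le (BP n).1 BB') _.
apply: le_trans (sdist_triangle (mB n) mA (AA_measurable BB')) _.
by rewrite lerD2r sdistC ltW//; exact: (BP n).2.
Qed.

(** The extension of [L] by density is additive and bounded by [lam]; countable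
additivity follows, since the measure of the tail of a disjoint union tends to
0. *)
Theorem vector_measure_extension : exists nu : set Om -> V,
  [/\ vector_measure nu, forall A, measurable A -> `|nu A| <= meas A,
    forall A B, measurable A -> measurable B -> A `&` B = set0 ->
      nu (A `|` B) = nu A + nu B &
    forall A B, measurable A -> AA B -> `|nu A - L B| <= sdist A B].
Proof.
have /choice[nu nuP] : forall A, exists v : V, measurable A ->
    forall B, AA B -> `|v - L B| <= sdist A B.
  move=> A; have [mA|nmA] := pselect (measurable A); last by exists 0.
  by have [v vP] := extension_point mA; exists v.
have nu_le A : measurable A -> `|nu A| <= meas A.
  by move=> mA; have := nuP A mA set0 AA0; rewrite L0 subr0 sdist0.
have nuU A A' : measurable A -> measurable A' -> A `&` A' = set0 ->
    nu (A `|` A') = nu A + nu A'.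
  move=> mA mA' AA'0; apply/eqP; rewrite -subr_eq0 -normr_le0.
  apply: (@ler_eps_mul _ _ _ 6) => e e0; rewrite add0r.
  have [_ /(_ e e0)[B BB dB]] := approximable_measurable mA.
  have [_ /(_ e e0)[B' BB' dB']] := approximable_measurable mA'.
  have mB := AA_measurable BB; have mB' := AA_measurable BB'.
  have AAI X Y : AA X -> AA Y -> AA (X `&` Y).
    by move=> aX aY; rewrite -[X `&` Y]setCK setCI; apply: AAC; apply: AAU; exact: AAC.
  have LE : L (B `|` B') = L B + L B' - L (B' `&` B).
    have E1 : L B' = L (B' `\` B) + L (B' `&` B).
      rewrite -LU; first by rewrite setUC setUIDK.
      - exact: AAI (AAC BB).
      - exact: AAI.
      - by rewrite setDE setIACA setIid setICl setI0.
    have -> : B `|` B' = B `|` (B' `\` B) by rewrite setUDr setDv setD0 setUC.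
    rewrite LU//; first by rewrite E1 addrA addrK.
      exact: AAI (AAC BB).
    by rewrite setDE setICA setICr setI0.
  have h1 := nuP _ (measurableU _ _ mA mA') _ (AAU BB BB').
  have h2 := nuP _ mA _ BB.
  have h3 := nuP _ mA' _ BB'.
  have h4 : `|L (B' `&` B)| <= sdist A B + sdist A' B'.
    have := L_le (AAI _ _ BB' BB) AA0; rewrite L0 subr0 sdist0 => /le_trans; apply.
    apply: (@le_trans _ _ (meas (B `\` A) + meas (B' `\` A'))).
      apply: meas_sub; solve_measurable.
      move=> x [B'x Bx]; have [Ax|nAx] := pselect (A x); last by left.
      right; split => // A'x; have : (A `&` A') x by [].
      by rewrite AA'0.
    by apply: lerD; rewrite /sdist lerDr meas_ge0.
  have h5 := sdistU mA mA' mB mB'.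
  have -> : nu (A `|` A') - (nu A + nu A') =
      (nu (A `|` A') - L (B `|` B')) - (nu A - L B) - (nu A' - L B') - L (B' `&` B).
    rewrite LE; move: (nu (A `|` A')) (nu A) (nu A') (L B) (L B') (L (B' `&` B)) => a b c x y z.
    rewrite -[in LHS](subrK (x + y - z) a) -[in LHS](subrK x b) -[in LHS](subrK y c).
    move: (a - (x + y - z)) (b - x) (c - y) => p q r.
    rewrite [q + x + _]addrACA [q + r + _]addrC [x + y - z]addrC addrA addrKA.
    by rewrite opprD !addrA [p - z - q]addrAC [p - q - z - r]addrAC.
  apply: le_trans (ler_normB _ _) _.
  have g1 := ler_normB (nu (A `|` A') - L (B `|` B') - (nu A - L B)) (nu A' - L B').
  have g2 := ler_normB (nu (A `|` A') - L (B `|` B')) (nu A - L B).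
  lra.
exists nu; split => //; last by move=> A B mA BB; exact: nuP.
move=> F mF tF.
have mUF : measurable (\bigcup_i F i) by exact: bigcup_measurable.
have nu0 : nu set0 = 0.
  by apply/eqP; rewrite -normr_le0 -meas0; exact: nu_le.
have fin n : \sum_(0 <= i < n) nu (F i) = nu (\big[setU/set0]_(i < n) F i).
  elim: n => [|n IH]; first by rewrite big_nil big_ord0 nu0.
  rewrite big_nat_recr//= IH big_ord_recr/= nuU//; first exact: bigsetU_measurable.
  rewrite -bigcup_mkord setI_bigcupl; apply: bigcup0 => i /= ni.
  apply: contrapT => /eqP/set0P Fin.
  by have E := tF i n I I Fin; rewrite E ltnn in ni.
apply/cvgrPdist_lt => e e0.
apply: filterS (meas_bigcup_tail mF e0) => n; apply: le_lt_trans; rewrite fin.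
set G := \big[setU/set0]_(i < n) F i.
have mG : measurable G by exact: bigsetU_measurable.
have GU : G `<=` \bigcup_i F i.
  by rewrite /G -bigcup_mkord => x [i _ Fx]; exists i.
have -> : nu (\bigcup_i F i) = nu G + nu ((\bigcup_i F i) `\` G).
  rewrite -nuU//; first by rewrite setDUK.
    exact: measurableD.
  by rewrite setDE setICA setICr setI0.
by rewrite [nu G + _]addrC addrK; apply: nu_le; exact: measurableD.
Qed.

End vector_measure_extension.

(** * The vector measure of the increments of a curve *)

Section density_measure.
Context {d : measure_display} {T : measurableType d} {R : realType}.
Variable mu : {measure set T -> \bar R}.
Local Open Scope ereal_scope.

(** Integrability and positivity of [f] are arguments so that the set function can
carry the structure of a finite measure. *)
Definition density_measure (f : T -> \bar R) (intf : mu.-integrable setT f)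
    (f0 : forall x, 0 <= f x) : set T -> \bar R :=
  fun A => \int[mu]_(x in A) f x.

Context (f : T -> \bar R) (intf : mu.-integrable setT f) (f0 : forall x, 0 <= f x).
Local Notation lam := (density_measure intf f0).

Let lam0 : lam set0 = 0. Proof. by rewrite /density_measure integral_set0. Qed.

Let lam_ge0 A : 0 <= lam A. Proof. exact: integral_ge0. Qed.

Let lam_additive : semi_sigma_additive lam.
Proof. exact: semi_sigma_additive_nng_induced (measurable_int mu intf) f0. Qed.

HB.instance Definition _ := isMeasure.Build _ _ _ lam lam0 lam_ge0 lam_additive.

Let lam_fin : fin_num_fun lam.
Proof.
move=> A mA; rewrite /density_measure; apply: integrable_fin_num => //.
exact: integrableS intf.
Qed.

HB.instance Definition _ := Measure_isFinite.Build _ _ _ lam lam_fin.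

End density_measure.

Section dyadic_increments.
Context {R : realType} {V : completeNormedModType R}.
Local Notation mu := (@lebesgue_measure R).
Variable lam : {finite_measure set (measurableTypeR R) -> \bar R}.
Variables (a b : R) (u : R -> V).
Hypothesis ab : a < b.
Hypothesis u_le : forall s t, a <= s -> s <= t -> t <= b -> `|u t - u s| <= meas lam `]s, t].
Implicit Types (A B : set (measurableTypeR R)) (x y : R).

Definition grid (k j : nat) : R := a + (b - a) * j%:R / 2 ^+ k.

Lemma grid0 k : grid k 0 = a.
Proof. by rewrite /grid mulr0 mul0r addr0. Qed.

Lemma grid_end k : grid k (2 ^ k) = b.
Proof. by rewrite /grid natrX mulfK ?expf_neq0// addrC subrK. Qed.

Lemma grid_le k i j : (i <= j)%N -> grid k i <= grid k j.
Proof.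
move=> ij; rewrite /grid lerD2l ler_pM2r ?invr_gt0 ?exprn_gt0//.
by rewrite ler_pM2l ?subr_gt0// ler_nat.
Qed.

Lemma grid_ge k j : a <= grid k j.
Proof. by rewrite -(grid0 k); exact: grid_le. Qed.

Lemma grid_leb k j : (j <= 2 ^ k)%N -> grid k j <= b.
Proof. by move=> jk; rewrite -(grid_end k); exact: grid_le. Qed.

Lemma grid_double k j : grid k.+1 j.*2 = grid k j.
Proof.
rewrite /grid -muln2 natrM exprS invfM; congr (_ + _).
by rewrite -!mulrA; congr (_ * (_ * _)); rewrite mulrA divff ?mul1r.
Qed.

Lemma grid_step k j : grid k j.+1 = grid k j + (b - a) / 2 ^+ k.
Proof. by rewrite /grid -natr1 mulrDr mulr1 mulrDl addrA. Qed.

Lemma grid_find k y : a < y -> y <= b ->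
  exists2 j, (j < 2 ^ k)%N & grid k j < y /\ y <= grid k j.+1.
Proof.
move=> ay yb.
have ex : exists j, y <= grid k j by exists (2 ^ k)%N; rewrite grid_end.
case: (ex_minnP ex) => [[|j] yj jmin]; first by move: yj; rewrite grid0 leNgt ay.
exists j; first by have := jmin (2 ^ k)%N; rewrite grid_end; exact.
by split => //; rewrite ltNge; apply/negP => /jmin; rewrite ltnn.
Qed.

Definition cell k j : set (measurableTypeR R) := `]grid k j, grid k j.+1]%classic.

(** Up to its part outside [`]a, b]], which is arbitrary, [B] is a union of dyadic
cells of level [k]. *)
Definition cell_constant k B := forall j, (j < 2 ^ k)%N ->
  forall x y, cell k j x -> cell k j y -> B x -> B y.

Lemma cell_constantS k B : cell_constant k B -> cell_constant k.+1 B.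
Proof.
move=> kB j jk x y xj yj.
have sub z : cell k.+1 j z -> cell k j./2 z.
  rewrite /cell /= !in_itv/= => /andP[z1 z2]; apply/andP; split.
    apply: le_lt_trans z1; rewrite -grid_double; apply: grid_le.
    by rewrite -[leqRHS]odd_double_half leq_addl.
  apply: le_trans z2 _; rewrite -(grid_double k j./2.+1); apply: grid_le.
  by rewrite doubleS -[leqLHS]addn1 -[X in (X + 1)%N]odd_double_half; case: (odd j); rewrite ?add1n ?add0n ?addn1.
apply: (kB j./2); [|exact: sub|exact: sub].
by rewrite ltn_half_double -muln2 mulnC -expnS.
Qed.

Lemma cell_constant_le k k' B : (k <= k')%N -> cell_constant k B -> cell_constant k' B.
Proof.
move=> /subnK <- kB; elim: (k' - k)%N => [|n IH]; first by rewrite add0n.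
by rewrite addSn; exact: cell_constantS.
Qed.

Definition cell_algebra : set (set (measurableTypeR R)) :=
  [set B | measurable B /\ exists k, cell_constant k B].

(** The increment of [u] over [B]; for a union of cells the value does not depend
on the level, by [cell_sum_le]. *)
Definition cell_sum k B : V :=
  \sum_(0 <= j < 2 ^ k) (if `[< B (grid k j.+1) >] then u (grid k j.+1) - u (grid k j) else 0).

Lemma grid_lt k j : grid k j < grid k j.+1.
Proof. by rewrite grid_step ltrDl divr_gt0 ?subr_gt0// exprn_gt0. Qed.

Lemma cell_end k j : cell k j (grid k j.+1).
Proof. by rewrite /cell /= in_itv/= lexx andbT grid_lt. Qed.

Lemma sum_double n (f : nat -> V) :
  \sum_(0 <= j < n.*2) f j = \sum_(0 <= j < n) (f j.*2 + f j.*2.+1).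
Proof.
elim: n => [|n IH]; first by rewrite !big_nil.
by rewrite doubleS !big_nat_recr//= IH addrA.
Qed.

Lemma cell_sumS k B : cell_constant k B -> cell_sum k.+1 B = cell_sum k B.
Proof.
move=> kB; rewrite /cell_sum expnS mul2n sum_double.
apply: eq_big_nat => j /andP[_ jk].
rewrite -doubleS !grid_double.
have c1 : cell k j (grid k.+1 j.*2.+1).
  rewrite /cell /= in_itv/= -grid_double grid_lt/=.
  by rewrite -(grid_double k j.+1) doubleS; exact: grid_le.
have -> : `[< B (grid k.+1 j.*2.+1) >] = `[< B (grid k j.+1) >].
  apply/asbool_equiv_eq; split; apply: (kB _ jk) => //; exact: cell_end.
case: ifP => _; last by rewrite addr0.
by rewrite addrC addrA subrK.
Qed.

Lemma cell_sum_le k k' B : (k <= k')%N -> cell_constant k B -> cell_sum k' B = cell_sum k B.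
Proof.
move=> /subnK <- kB; elim: (k' - k)%N => [|n IH]; first by rewrite add0n.
by rewrite addSn cell_sumS//; apply: cell_constant_le kB; rewrite leq_addl.
Qed.

Lemma cell_algebra_common A B : cell_algebra A -> cell_algebra B ->
  exists k, cell_constant k A /\ cell_constant k B.
Proof.
move=> [_ [k kA]] [_ [l lB]]; exists (maxn k l); split.
  by apply: cell_constant_le kA; rewrite leq_maxl.
by apply: cell_constant_le lB; rewrite leq_maxr.
Qed.

Lemma cell_algebraC A : cell_algebra A -> cell_algebra (~` A).
Proof.
move=> [mA [k kA]]; split; first exact: measurableC.
by exists k => j jk x y xj yj nAx Ay; apply: nAx; exact: (kA j jk y x).
Qed.

Lemma cell_algebraU A B : cell_algebra A -> cell_algebra B -> cell_algebra (A `|` B).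
Proof.
move=> cA cB; have [k [kA kB]] := cell_algebra_common cA cB.
split; first exact: measurableU cA.1 cB.1.
exists k => j jk x y xj yj [Ax|Bx]; [left; exact: (kA j jk x y)|right; exact: (kB j jk x y)].
Qed.

Lemma cell_algebra0 : cell_algebra set0.
Proof. by split; [exact: measurable0|exists 0%N]. Qed.

(** The two sums differ only on the cells contained in the symmetric difference. *)
Lemma cell_sum_dist k A B : measurable A -> measurable B ->
  cell_constant k A -> cell_constant k B ->
  `|cell_sum k A - cell_sum k B| <= sdist lam A B.
Proof.
move=> mA mB kA kB.
pose S := (A `\` B) `|` (B `\` A).
have mS : measurable S by apply: measurableU; exact: measurableD.
apply: (@le_trans _ _ (meas lam S)); last by apply: meas_sub; solve_measurable.
have mc (x y : R) : measurable (`]x, y]%classic : set (measurableTypeR R)) by exact: measurable_itv.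
suff h n : (n <= 2 ^ k)%N ->
    `|\sum_(0 <= j < n) (if `[< A (grid k j.+1) >] then u (grid k j.+1) - u (grid k j) else 0) -
      \sum_(0 <= j < n) (if `[< B (grid k j.+1) >] then u (grid k j.+1) - u (grid k j) else 0)|
    <= meas lam (S `&` `]a, grid k n]).
  apply: le_trans (h _ (leqnn _)) _; apply: meas_le => //; exact: measurableI.
elim: n => [|n IH] nk.
  by rewrite !big_nil subrr normr0 meas_ge0.
rewrite !big_nat_recr//= opprD addrACA.
apply: le_trans (ler_normD _ _) _.
have -> : S `&` `]a, grid k n.+1] = (S `&` `]a, grid k n]) `|` (S `&` cell k n).
  rewrite -setIUr; congr (_ `&` _); apply/seteqP; split => x /=; rewrite !in_itv/=.
    move=> /andP[ax xn]; have [xn'|nx] := leP x (grid k n); [left|right].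
      by rewrite ax.
    by rewrite /cell /= in_itv/= nx.
  case=> [/andP[-> /=]|]; first by move=> /le_trans; apply; exact: grid_le.
  rewrite /cell /= in_itv/= => /andP[nx ->]; rewrite andbT.
  by apply: le_lt_trans nx; exact: grid_ge.
have disj : (S `&` `]a, grid k n]) `&` (S `&` cell k n) = set0.
  apply/seteqP; split => // x [[_ +] [_]]; rewrite /cell /= !in_itv/=.
  by move=> /andP[_ xn] /andP[]; rewrite ltNge xn.
have -> : meas lam ((S `&` `]a, grid k n]) `|` (S `&` cell k n)) =
    meas lam (S `&` `]a, grid k n]) + meas lam (S `&` cell k n).
  apply: EFin_inj; rewrite EFinD !meas_fin; solve_measurable.
  - rewrite measureU; solve_measurable => //.
    + by apply: measurableI => //; exact: mc.
    + by apply: measurableI => //; exact: mc.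
  - by apply: measurableI => //; exact: mc.
  - by apply: measurableI => //; exact: mc.
  - by apply: measurableU; apply: measurableI => //; exact: mc.
apply: lerD; first exact: IH (ltnW nk).
have full : `|u (grid k n.+1) - u (grid k n)| <= meas lam (cell k n).
  by apply: u_le; [exact: grid_ge|exact: grid_le|exact: grid_leb].
have cellS x : cell k n x -> S x -> meas lam (cell k n) <= meas lam (S `&` cell k n).
  move=> xn Sx; apply: meas_le; [exact: mc|by apply: measurableI => //; exact: mc|].
  move=> y yn; split => //; case: Sx => -[X1 X2]; [left|right]; split.
  - exact: kA _ nk _ _ xn yn X1.
  - by move=> By; apply: X2; exact: kB _ nk _ _ yn xn By.
  - exact: kB _ nk _ _ xn yn X1.
  - by move=> Ay; apply: X2; exact: kA _ nk _ _ yn xn Ay.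
have ce := cell_end k n.
have [An|nAn] := pselect (A (grid k n.+1)); have [Bn|nBn] := pselect (B (grid k n.+1)).
- by rewrite !asboolT// subrr normr0 meas_ge0.
- by rewrite asboolT// asboolF// subr0 (le_trans full)// (cellS _ ce)//; left.
- by rewrite asboolF// asboolT// sub0r normrN (le_trans full)// (cellS _ ce)//; right.
- by rewrite !asboolF// subrr normr0 meas_ge0.
Qed.

(** The intervals decrease to the empty set, because they are open on the left;
cells are chosen of the same kind. *)
Lemma small_right y e : 0 < e -> exists k : nat, meas lam `]y, y + (b - a) / 2 ^+ k] < e.
Proof.
move=> e0; pose F (i : nat) : set (measurableTypeR R) := `]y + (b - a) / 2 ^+ i, +oo[%classic.
have mF i : measurable (F i) by exact: measurable_itv.
have [n _ /(_ _ (leqnn n)) hn] := meas_bigcup_tail lam mF e0.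
exists n; apply: le_lt_trans hn; apply: meas_le; first exact: measurable_itv.
  by apply: measurableD; [exact: bigcup_measurable|exact: bigsetU_measurable].
move=> x /=; rewrite in_itv/= => /andP[yx xn]; split.
  have xy0 : 0 < (x - y) / (b - a) by rewrite divr_gt0 ?subr_gt0.
  have [i _ /(_ _ (leqnn i)) hi] := near_infty_natSinv_lt (PosNum xy0).
  exists i => //; rewrite /F /= in_itv/= andbT -ltrBrDl.
  move: hi => /=; rewrite ltr_pdivlMr ?subr_gt0// => hi.
  apply: le_lt_trans hi; rewrite [leLHS]mulrC ler_pM2r ?subr_gt0//.
  by rewrite lef_pV2 ?posrE ?exprn_gt0// -natrX ler_nat ltn_expl.
rewrite -bigcup_mkord => -[i /= ni]; rewrite /F /= in_itv/= andbT.
rewrite ltNge => /negP; apply; apply: le_trans xn _; rewrite lerD2l.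
rewrite ler_pM2l ?subr_gt0// lef_pV2 ?posrE ?exprn_gt0//.
by rewrite ler_eXn2l// ?ltr1n// ltnW.
Qed.

Definition ray y : set (measurableTypeR R) := `]-oo, y]%classic.

Lemma measurable_ray y : measurable (ray y).
Proof. exact: measurable_itv. Qed.

Lemma ray_constant k j : cell_constant k (ray (grid k j)).
Proof.
move=> i ik x y; rewrite /cell /ray /= !in_itv/= => /andP[x1 x2] /andP[y1 y2] xj.
have : (i < j)%N.
  rewrite ltnNge; apply/negP => ji.
  by move: (lt_le_trans x1 xj); rewrite ltNge grid_le.
by move=> /(grid_le k); exact: le_trans.
Qed.

Lemma ray_close y e : a < y -> y <= b -> 0 < e ->
  exists k j, [/\ (j < 2 ^ k)%N, y <= grid k j.+1 & meas lam `]y, grid k j.+1] < e].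
Proof.
move=> ay yb e0; have [k hk] := small_right y e0.
have [j jk [jy yj]] := grid_find k ay yb.
exists k, j; split => //; apply: le_lt_trans hk; apply: meas_le; [exact: measurable_itv..|].
apply: subset_itvl; rewrite bnd_simp grid_step lerD2r; exact: ltW.
Qed.

Lemma sdist_ray y z : y <= z -> sdist lam (ray y) (ray z) = meas lam `]y, z].
Proof.
move=> yz; rewrite sdist_sub; last by apply: subset_itvl; rewrite bnd_simp.
congr (meas _ _); apply/seteqP; split => x; rewrite /ray /= !in_itv/=.
  by move=> [-> /negP]; rewrite -ltNge => ->.
by move=> /andP[yx ->]; split => //; apply/negP; rewrite -ltNge.
Qed.

Lemma approximable_ray y : approximable lam cell_algebra (ray y).
Proof.
split; first exact: measurable_ray.
move=> e e0; have [ya|ay] := leP y a.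
  exists (ray y); last by rewrite /sdist setDv meas0 addr0.
  split; first exact: measurable_ray.
  exists 0%N => j jk x z; rewrite /cell /ray /= !in_itv/= => /andP[xj _] _ xy.
  by have := lt_le_trans xj (le_trans xy ya); rewrite ltNge grid_ge.
have [yb|yb] := leP y b.
  have [k [j [jk yj mj]]] := ray_close ay yb e0.
  exists (ray (grid k j.+1)); last by rewrite sdist_ray.
  by split; [exact: measurable_ray|exists k; exact: ray_constant].
exists (ray y); last by rewrite /sdist setDv meas0 addr0.
split; first exact: measurable_ray.
exists 0%N => j jk x z; rewrite /cell /ray /= !in_itv/= => _ /andP[_ zj] _.
by apply: le_trans zj (le_trans (grid_leb jk) (ltW yb)).
Qed.

(** Half-lines generate the Borel sets, and a half-line is approximated by the one
that ends at the next grid point. *)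
Lemma cell_algebra_dense : measurable `<=` approximable lam cell_algebra.
Proof.
have mAA : cell_algebra `<=` measurable by move=> A [].
have sA : sigma_algebra setT (approximable lam cell_algebra).
  by apply: approximable_sigma_algebra => //; [exact: cell_algebra0|exact: cell_algebraC|exact: cell_algebraU].
suff : R.-ocitv.-measurable `<=` approximable lam cell_algebra by exact: (smallest_sub sA).
move=> _ [[x y] _ <-] /=.
have -> : `]x, y]%classic = ~` (~` ray y `|` ray x).
  rewrite setCU setCK; apply/seteqP; split => z; rewrite /ray /= !in_itv/=.
    by move=> /andP[xz zy]; split => //; apply/negP; rewrite -ltNge.
  by move=> [zy /negP]; rewrite -ltNge => ->.
apply: approximableC => //; first exact: cell_algebraC.
apply: approximableU => //; [exact: cell_algebraU|..|exact: approximable_ray].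
by apply: approximableC => //; [exact: cell_algebraC|exact: approximable_ray].
Qed.

(** The additive set function [cell_sum] extends to all Borel sets by
[vector_measure_extension], and half-lines identify its values on intervals. *)
Theorem increment_measure : exists nu : set (measurableTypeR R) -> V,
  [/\ vector_measure nu, forall A, measurable A -> `|nu A| <= meas lam A &
    forall s t, a <= s -> s <= t -> t <= b -> nu `]s, t]%classic = u t - u s].
Proof.
have mAA : cell_algebra `<=` measurable by move=> A [].
have /choice[L LP] : forall B, exists v : V, cell_algebra B ->
    forall k, cell_constant k B -> cell_sum k B = v.
  move=> B; have [[_ [k kB]]|nB] := pselect (cell_algebra B); last by exists 0.
  exists (cell_sum k B) => _ l lB.
  rewrite -(cell_sum_le (leq_maxl k l) kB) -(cell_sum_le (leq_maxr k l) lB)//.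
have [|||nu [vnu nu_le nuU nuL]] := @vector_measure_extension _ _ _ V lam cell_algebra mAA
  cell_algebra0 cell_algebraC cell_algebraU L _ _ _ cell_algebra_dense.
- rewrite -(LP set0 cell_algebra0 0%N)//; rewrite /cell_sum big1// => j _.
  by rewrite asboolF.
- move=> A B cA cB AB0; have [k [kA kB]] := cell_algebra_common cA cB.
  have cU := cell_algebraU cA cB.
  have kU : cell_constant k (A `|` B).
    by move=> j jk x y xj yj [Ax|Bx]; [left; exact: (kA j jk x y)|right; exact: (kB j jk x y)].
  rewrite -(LP _ cA k)// -(LP _ cB k)// -(LP _ cU k)// /cell_sum -big_split/=.
  apply: eq_bigr => j _; rewrite asbool_or.
  have [Aj|nAj] := pselect (A (grid k j.+1)); have [Bj|nBj] := pselect (B (grid k j.+1)).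
  + by have : (A `&` B) (grid k j.+1) by []; rewrite AB0.
  + by rewrite asboolT//= asboolF// addr0.
  + by rewrite asboolF//= asboolT// add0r.
  + by rewrite !asboolF// addr0.
- move=> A B cA cB; have [k [kA kB]] := cell_algebra_common cA cB.
  by rewrite -(LP _ cA k)// -(LP _ cB k)//; exact: cell_sum_dist cA.1 cB.1 kA kB.
exists nu; split => //.
have nuray y : a <= y -> y <= b -> nu (ray y) = u y - u a.
  rewrite le_eqVlt => /predU1P[<- _|ay yb].
    have ca : cell_algebra (ray a).
      by split; [exact: measurable_ray|exists 0%N; rewrite -(grid0 0); exact: ray_constant].
    have := nuL _ _ (measurable_ray a) ca; rewrite sdist_ray// set_itvoc0 meas0 normr_le0 subr_eq0 => /eqP ->.
    rewrite subrr -(LP _ ca 0%N); last by rewrite -(grid0 0); exact: ray_constant.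
    rewrite /cell_sum big1// => j _; rewrite asboolF// /ray /= in_itv/=.
    by apply/negP; rewrite -ltNge; apply: le_lt_trans (grid_lt _ _); exact: grid_ge.
  apply/eqP; rewrite -subr_eq0 -normr_le0; apply: (@ler_eps_mul _ _ _ 2) => e e0; rewrite add0r.
  have [k [j [jk yj mj]]] := ray_close ay yb e0.
  have cr : cell_algebra (ray (grid k j.+1)).
    by split; [exact: measurable_ray|exists k; exact: ray_constant].
  have h1 := nuL _ _ (measurable_ray y) cr.
  rewrite sdist_ray// in h1.
  have h2 := u_le (ltW ay) yj (grid_leb jk).
  have Lr : L (ray (grid k j.+1)) = u (grid k j.+1) - u a.
    rewrite -(LP _ cr k); last exact: ray_constant.
    rewrite /cell_sum (@big_cat_nat _ _ _ j.+1)//= [X in _ + X]big1_seq ?addr0; last first.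
      move=> i /andP[_]; rewrite mem_index_iota => /andP[ji _]; rewrite asboolF// /ray /= in_itv/=.
      apply/negP; rewrite -ltNge; apply: le_lt_trans (grid_lt _ _); exact: grid_le.
    rewrite (eq_big_nat _ _ (F2 := fun i => u (grid k i.+1) - u (grid k i))).
      by rewrite telescope_sumr// grid0.
    by move=> i /andP[_ ij]; rewrite asboolT// /ray /= in_itv/=; exact: grid_le.
  rewrite Lr in h1.
  have -> : nu (ray y) - (u y - u a) = nu (ray y) - (u (grid k j.+1) - u a) + (u (grid k j.+1) - u y).
    by rewrite -[RHS]addrA; congr (_ + _); rewrite !opprB addrA subrK.
  apply: le_trans (ler_normD _ _) _; lra.
move=> s t as_ st tb.
have -> : u t - u s = (u t - u a) - (u s - u a) by rewrite opprB addrA subrK.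
rewrite -!nuray//; [|exact: le_trans st tb|exact: le_trans as_ st].
have -> : ray t = `]s, t]%classic `|` ray s.
  apply/seteqP; split => z; rewrite /ray /= !in_itv/=.
    by move=> zt; have [zs|sz] := leP z s; [right|left; rewrite zt].
  by case=> [/andP[]//|/le_trans]; exact.
rewrite nuU ?addrK//; try exact: measurable_itv.
apply/seteqP; split => // z; rewrite /ray /= !in_itv/= => -[/andP[sz _]].
by rewrite leNgt sz.
Qed.

End dyadic_increments.

(** * Bochner integrals and sublinear functionals *)

Section bochner_estimates.
Context {R : realType} {V : normedModType R}.
Context {d : measure_display} {Om : measurableType d}.
Variable mu : {finite_measure set Om -> \bar R}.
Implicit Types (A : set Om) (s : Om -> V) (p : V -> R).

Lemma simple_map_comp_measurable s (phi : V -> R) : simple_map s ->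
  measurable_fun setT (phi \o s).
Proof.
move=> [fs ms] _ Y mY; rewrite setTI.
have -> : (phi \o s) @^-1` Y = \bigcup_(v in range s `&` phi @^-1` Y) (s @^-1` [set v]).
  apply/seteqP; split => [y Yy|y [v [_ Yv] /= sy]]; last by rewrite /= sy.
  by exists (s y) => //; split => //; exists y.
apply: fin_bigcup_measurable; last by move=> v _; exact: ms.
by apply: sub_finite_set fs; exact: subIsetl.
Qed.

Lemma simple_mapB s s' : simple_map s -> simple_map s' -> simple_map (s - s').
Proof.
move=> [fs ms] [fs' ms']; split.
  apply: (@sub_finite_set _ _ [set v - v' | v in range s & v' in range s']).
    by move=> _ [y _ <-]; exists (s y); [exists y|exists (s' y); [exists y|]].
  exact: finite_image2.
move=> z.
have -> : (s - s') @^-1` [set z] =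
    \bigcup_(v in range s') (s' @^-1` [set v] `&` s @^-1` [set z + v]).
  apply/seteqP; split => [y /= <-|y [v _ [/= s'y sy]]].
    by exists (s' y) => //; split => //=; rewrite !fctE subrK.
  by rewrite !fctE s'y sy addrK.
by apply: fin_bigcup_measurable => // v _; apply: measurableI.
Qed.

Lemma sublinear_sum (I : Type) (r : seq I) (l : I -> R) (v : I -> V) p :
  sublinear p -> (forall i, 0 <= l i) ->
  p (\sum_(i <- r) l i *: v i) <= \sum_(i <- r) l i * p (v i).
Proof.
move=> sp l0; elim: r => [|i r IH]; first by rewrite !big_nil sublinear0.
have [pD pZ] := sp; rewrite !big_cons; apply: le_trans (pD _ _) _.
by rewrite pZ// lerD2l.
Qed.

Lemma simple_integral_decomposition A s (f : Om -> \bar R) (phi : V -> R) :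
  simple_map s -> measurable A -> (forall v, 0 <= phi v) ->
  (forall y, f y = (phi (s y))%:E) ->
  (\int[mu]_(y in A) f y = \sum_(v <- fset_set (range s)) (fine (mu (A `&` s @^-1` [set v])) * phi v)%:E)%E.
Proof.
move=> ss mA phi0 fE; have [fs ms] := ss.
pose F v := A `&` s @^-1` [set v].
have mF v : measurable (F v) by exact: measurableI.
have AE : A = \big[setU/set0]_(v <- fset_set (range s)) F v.
  rewrite -bigcup_seq; apply/seteqP; split => [y Ay|y [v _ []]//].
  by exists (s y) => //=; rewrite in_fset_set// inE; exists y.
have mf : measurable_fun setT f.
  have -> : f = EFin \o (phi \o s) by apply/funext => y; rewrite fE.
  by apply/measurable_EFinP; exact: simple_map_comp_measurable.
rewrite [in LHS]AE ge0_integral_bigsetU//=.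
- apply: eq_bigr => v _.
  rewrite (eq_integral (cst (phi v)%:E)); last first.
    by move=> y; rewrite inE => -[_ /= sy]; rewrite fE sy.
  rewrite integral_cst; last exact: mF.
  rewrite EFinM fineK; first exact: muleC.
  by apply: fin_num_measure; exact: mF.
- move=> v v' _ _ [y [[_ /= sy] [_ /= s'y]]]; by rewrite -sy -s'y.
- exact: measurable_funTS.
- by move=> y _; rewrite fE lee_fin.
Qed.

(** Jensen's inequality for the weights [mu (A `&` s @^-1` [set v])]. *)
Lemma simple_integral_le A s p x : simple_map s -> measurable A ->
  sublinear p -> (forall v, 0 <= p v) ->
  ((p (simple_integral mu A s - fine (mu A) *: x))%:E <=
   \int[mu]_(y in A) (p (s y - x))%:E)%E.
Proof.
move=> ss mA sp p0; have [fs ms] := ss.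
rewrite (@simple_integral_decomposition A s _ (fun v => p (v - x)))// sumEFin lee_fin.
have muA : fine (mu A) = \sum_(v <- fset_set (range s)) fine (mu (A `&` s @^-1` [set v])).
  have := @simple_integral_decomposition A s (fun=> 1%E) (fun=> 1) ss mA (fun=> ler01) (fun=> erefl).
  rewrite sumEFin integral_cst// mul1e => ->/=.
  by apply: eq_bigr => v _; rewrite mulr1.
rewrite /simple_integral fsbig_finite//= muA scaler_suml -sumrB.
rewrite (eq_bigr (fun v => fine (mu (A `&` s @^-1` [set v])) *: (v - x))); last first.
  by move=> v _; rewrite scalerBr.
by apply: sublinear_sum => // v; exact: fine_ge0.
Qed.

Context (g : Om -> V) (I : V) (A : set Om).
Hypothesis mA : measurable A.
Variable s : nat -> Om -> V.
Hypothesis s_simple : forall n, simple_map (s n).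
Hypothesis s_cvg : {ae mu, forall x, s n x @[n --> \oo] --> g x}.

(** A Bochner integrable map is only almost everywhere a limit of simple maps, so
the measurable function is obtained by cutting off a null set. *)
Lemma ae_limit_measurable (phi : V -> R) : continuous phi ->
  exists q : Om -> R, measurable_fun setT q /\ {ae mu, forall y, q y = phi (g y)}.
Proof.
move=> cphi; have [N [mN N0 sN]] := s_cvg.
have mNc : measurable (~` N) by exact: measurableC.
exists ((phi \o g) \_ (~` N)); split.
  apply/(measurable_restrictT _ _).1 => //.
  apply: (@measurable_fun_cvg _ _ _ _ (fun n => phi \o s n)) => [n|y Ny].
    by apply: measurable_funTS; exact: simple_map_comp_measurable.
  apply: continuous_cvg; first exact: cphi.
  by apply: contrapT => h; apply: Ny; apply: sN.
exists N; split => // y /=; apply: contra_notP => Ny.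
by rewrite patchE mem_set.
Qed.

Lemma ae_dist_measurable n : exists q : Om -> R, [/\ measurable_fun setT q, forall y, 0 <= q y &
  {ae mu, forall y, q y = `|g y - s n y|}].
Proof.
have [N [mN N0 sN]] := s_cvg.
have mNc : measurable (~` N) by exact: measurableC.
exists ((fun y => `|g y - s n y|) \_ (~` N)); split.
- apply/(measurable_restrictT _ _).1 => //.
  apply: (@measurable_fun_cvg _ _ _ _ (fun m => (fun v : V => `|v|) \o (s m - s n))) => [m|y Ny].
    by apply: measurable_funTS; apply: simple_map_comp_measurable; exact: simple_mapB.
  apply: cvg_norm; apply: cvgB; last exact: cvg_cst.
  by apply: contrapT => h; apply: Ny; apply: sN.
- by move=> y; rewrite patchE; case: ifP.
- exists N; split => // y /=; apply: contra_notP => Ny.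
  by rewrite patchE mem_set.
Qed.

Hypothesis s_L1 : (\int[mu]_x (`|g x - s n x|)%:E)%E @[n --> \oo] --> 0%E.
Hypothesis s_int : simple_integral mu A (s n) @[n --> \oo] --> I.

(** The limit of [simple_integral_le] along the approximating simple maps.  The
shift by [x] serves for Lebesgue differentiation of [g]. *)
Lemma bochner_integral_le p x (M : R) : sublinear p -> (forall v, 0 <= p v) ->
  continuous p -> 0 <= M -> (forall v, p v <= M * `|v|) ->
  ((p (I - fine (mu A) *: x))%:E <= \int[mu]_(y in A) (p (g y - x))%:E)%E.
Proof.
move=> sp p0 cp M0 pM; have [pD pZ] := sp.
have [P [mP PE]] : exists q : Om -> R, measurable_fun setT q /\ {ae mu, forall y, q y = p (g y - x)}.
  apply: (ae_limit_measurable (phi := fun v => p (v - x))).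
  move=> v; apply: (@continuous_comp _ _ _ (fun v : V => v - x) p); last exact: cp.
  by apply: cvgB; [exact: cvg_id|exact: cvg_cst].
pose P' y := Num.max (P y) 0.
have mP' : measurable_fun setT P' by apply: measurable_maxr.
have P'0 y : 0 <= P' y by rewrite le_max lexx orbT.
have P'E : {ae mu, forall y, P' y = p (g y - x)}.
  by apply: filterS PE => y yE; rewrite /P' yE max_l.
have main n : ((p (simple_integral mu A (s n) - fine (mu A) *: x))%:E <=
    \int[mu]_(y in A) (P' y)%:E + M%:E * \int[mu]_y (`|g y - s n y|)%:E)%E.
  have [h [mh h0 hE]] := ae_dist_measurable n.
  apply: (le_trans (simple_integral_le x (s_simple n) mA sp p0)).
  apply: (@le_trans _ _ (\int[mu]_(y in A) (P' y + M * h y)%:E)%E).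
    apply: ae_le_lower_integral.
    - by move=> y _; rewrite lee_fin.
    - by move=> y _; rewrite lee_fin addr_ge0// mulr_ge0.
    apply: filterS2 P'E hE => y -> -> _; rewrite lee_fin.
    have -> : s n y - x = (g y - x) + (s n y - g y) by rewrite [RHS]addrC subrKA.
    apply: le_trans (pD _ _) _; rewrite lerD2l distrC; exact: pM.
  rewrite (eq_integral (fun y => (P' y)%:E + (M * h y)%:E)%E)//.
  rewrite ge0_integralD//.
  - apply: leeD2l.
    under eq_integral do rewrite EFinM.
    rewrite ge0_integralZl//.
    + apply: lee_wpmul2l; first by rewrite lee_fin.
      apply: (@le_trans _ _ (\int[mu]_y (h y)%:E)%E).
        apply: ge0_subset_integral => //; first by apply/measurable_EFinP.
        by move=> y _; rewrite lee_fin.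
      apply: ae_le_lower_integral.
      * by move=> y _; rewrite lee_fin.
      * by move=> y _; rewrite lee_fin.
      * by apply: filterS hE => y -> _.
    + by apply/measurable_EFinP; exact: measurable_funTS.
    + by move=> y _; rewrite lee_fin.
  - by move=> y _; rewrite lee_fin.
  - by apply/measurable_EFinP; exact: measurable_funTS.
  - by move=> y _; rewrite lee_fin mulr_ge0.
  - apply/measurable_EFinP; apply: measurable_funTS; exact: measurable_funM.
have le2 : (\int[mu]_(y in A) (P' y)%:E <= \int[mu]_(y in A) (p (g y - x))%:E)%E.
  apply: ae_le_lower_integral.
  - by move=> y _; rewrite lee_fin.
  - by move=> y _; rewrite lee_fin.
  - by apply: filterS P'E => y -> _.
apply: le_trans le2.
have c1 : (p (simple_integral mu A (s n) - fine (mu A) *: x))%:E @[n --> \oo]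
    --> (p (I - fine (mu A) *: x))%:E.
  apply: cvg_EFin; first by apply: nearW.
  apply: continuous_cvg; first exact: cp.
  by apply: cvgB => //; exact: cvg_cst.
have c2 : (\int[mu]_(y in A) (P' y)%:E + M%:E * \int[mu]_y (`|g y - s n y|)%:E)%E @[n --> \oo]
    --> (\int[mu]_(y in A) (P' y)%:E + M%:E * 0)%E.
  apply: cvgeD; [by rewrite mule0 adde_defC fin_num_adde_defr|exact: cvg_cst|].
  exact: cvgeZl.
rewrite mule0 adde0 in c2.
by apply: (lee_cvg_to c1 c2); apply: nearW => n; exact: main.
Qed.

End bochner_estimates.

(** * Derivatives of absolutely continuous curves *)

(** Monotonicity of the almost everywhere filter, stated for predicates: on the line
the same null sets are displayed with several measurable structures. *)
Lemma ae_imp2 {d : measure_display} {T : measurableType d} {R : realType}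
    (mu : {measure set T -> \bar R}) (P Q S : T -> Prop) :
  {ae mu, forall x, P x} -> {ae mu, forall x, Q x} ->
  (forall x, P x -> Q x -> S x) -> {ae mu, forall x, S x}.
Proof. by move=> aP aQ PQS; apply: filterS2 aP aQ. Qed.

Lemma ae_imp {d : measure_display} {T : measurableType d} {R : realType}
    (mu : {measure set T -> \bar R}) (P S : T -> Prop) :
  {ae mu, forall x, P x} -> (forall x, P x -> S x) -> {ae mu, forall x, S x}.
Proof. by move=> aP PS; apply: filterS aP. Qed.

Lemma derivable1_cvg {R : realType} (F : R -> R) t (c : R) :
  derivable F t 1 -> derive1 F t = c -> h^-1 *: (F (h + t) - F t) @[h --> 0^'] --> c.
Proof.
move=> dF <-; rewrite derive1E.
have -> : (fun h => h^-1 *: (F (h + t) - F t)) = (fun h => h^-1 *: ((F \o shift t) (h *: 1) - F t)).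
  by apply/funext => h; rewrite /= [h *: _]mulr1.
exact: dF.
Qed.

Section radon_nikodym_derivative.
Context {R : realType} {V : completeNormedModType R}.
Local Notation mu := (@lebesgue_measure R).
Hypothesis V_RNP : radon_nikodym_property V.
Implicit Types (a b : R) (u : R -> V).

Lemma ac_norm_density a b u : a < b -> ac_norm a b u ->
  exists lam : {finite_measure set (measurableTypeR R) -> \bar R},
    (forall s t, a <= s -> s <= t -> t <= b -> `|u t - u s| <= meas lam `]s, t]) /\
    (forall A, measurable A -> mu (A `&` `[a, b]) = 0%E -> lam A = 0%E).
Proof.
move=> ab [_ [m [m0 im um]]].
have mI : measurable (`[a, b]%classic : set (measurableTypeR R)) by exact: measurable_itv.
pose k := (EFin \o m) \_ `[a, b]%classic.
have ik : mu.-integrable setT k by apply/(integrable_mkcond _ mI).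
have k0 x : (0 <= k x)%E.
  by rewrite /k patchE; case: ifPn => //; rewrite inE/= => xab; rewrite lee_fin m0.
exists (density_measure ik k0); split.
  move=> s t as_ st tb.
  have [->|st'] := eqVneq s t; first by rewrite subrr normr0 meas_ge0.
  have {st'}st' : s < t by rewrite lt_neqAle st'.
  have mst : measurable (`]s, t]%classic : set (measurableTypeR R)) by exact: measurable_itv.
  rewrite -lee_fin meas_fin//; apply: le_trans (um s t as_ st' tb) _.
  rewrite /density_measure -(@integral_itv_obnd_cbnd _ s (BRight t)); last first.
    apply: measurable_funS (measurable_int mu im) => //.
    by apply: subset_itv; rewrite bnd_simp.
  rewrite le_eqVlt; apply/orP; left; apply/eqP; apply: eq_integral => x.
  rewrite inE/= in_itv/= => /andP[sx xt]; rewrite /k patchE mem_set//= in_itv/=.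
  by rewrite (le_trans as_ (ltW sx)) (le_trans xt).
move=> A mA A0; rewrite /= /density_measure.
rewrite /k -integral_mkcondr.
apply: null_set_integral => //; first exact: measurableI.
by apply: measurable_funS (measurable_int mu im).
Qed.

Lemma ac_norm_bochner_density a b u : a < b -> ac_norm a b u ->
  exists (mu0 : {finite_measure set (measurableTypeR R) -> \bar R}) (g : R -> V)
    (nu : set (measurableTypeR R) -> V),
  [/\ forall A, measurable A -> mu0 A = mu (A `&` `[a, b]),
    forall A, measurable A -> is_bochner_integral mu0 A g (nu A) &
    forall s t, a <= s -> s <= t -> t <= b -> nu `]s, t]%classic = u t - u s].
Proof.
move=> ab uac; have [lam [ule lam0]] := ac_norm_density ab uac.
have [nu [vnu nu_le nuE]] := increment_measure ab ule.
have mI : measurable (`[a, b]%classic : set (measurableTypeR R)) by exact: measurable_itv.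
have fI : (mu `[a, b]%classic < +oo)%E by rewrite /= lebesgue_measure_itv; case: ifP => _; rewrite ltry.
pose mu0 : {finite_measure set (measurableTypeR R) -> \bar R} := mfrestr mI fI.
have [||g gP] := V_RNP (mu := mu0) vnu.
- exists (meas lam setT) => n F mF tF.
  apply: (@le_trans _ _ (\sum_(0 <= i < n) meas lam (F i))).
    by apply: ler_sum => i _; exact: nu_le.
  have -> : \sum_(0 <= i < n) meas lam (F i) = meas lam (\big[setU/set0]_(i < n) F i).
    apply: EFin_inj; rewrite meas_fin; last exact: bigsetU_measurable.
    rewrite measure_bigsetU// -sumEFin big_mkord; apply: eq_bigr => i _.
    by rewrite meas_fin.
  by apply: meas_le => //; exact: bigsetU_measurable.
- move=> A mA A0; apply/eqP; rewrite -normr_le0; apply: le_trans (nu_le A mA) _.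
  by rewrite /meas lam0.
by exists mu0, g, nu.
Qed.

(** The density [g] of the increment measure is the derivative of [u] almost
everywhere.  For a fixed vector [x] the real function [|g - x|] has almost all
points as Lebesgue points, so the difference quotients of [u] are within about
[|g t - x|] of [x].  The countably many values of simple maps that converge to
[g] come arbitrarily close to [g t], whence the result without any measurability
of [g] itself. *)
Lemma ac_norm_derivative a b u : a < b -> ac_norm a b u ->
  exists g : R -> V,
  {ae mu, forall t, t \in `]a, b[ -> h^-1 *: (u (h + t) - u t) @[h --> 0^'] --> g t} /\
  forall (p : V -> R) (M : R), sublinear p -> (forall v, 0 <= p v) -> continuous p -> 0 <= M ->
    (forall v, p v <= M * `|v|) -> forall s t, a <= s -> s < t -> t <= b ->
    ((p (u t - u s))%:E <= \int[mu]_(y in `]s, t]) (p (g y))%:E)%E.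
Proof.
move=> ab uac; have [mu0 [g [nu [mu0E gP nuE]]]] := ac_norm_bochner_density ab uac.
have mI : measurable (`[a, b]%classic : set (measurableTypeR R)) by exact: measurable_itv.
have main p (M : R) : sublinear p -> (forall v, 0 <= p v) -> continuous p -> 0 <= M ->
    (forall v, p v <= M * `|v|) -> forall s t x, a <= s -> s < t -> t <= b ->
    ((p (u t - u s - (t - s) *: x))%:E <= \int[mu]_(y in `]s, t]) (p (g y - x))%:E)%E.
  move=> sp p0 cp M0 pM s t x as_ st tb.
  have mst : measurable (`]s, t]%classic : set (measurableTypeR R)) by exact: measurable_itv.
  have sub : `]s, t]%classic `<=` `[a, b] by apply: subset_itv; rewrite bnd_simp.
  have [sq [sqs sqc sqL sqI]] := gP _ mst.
  have := bochner_integral_le mst sqs sqc sqL sqI x sp p0 cp M0 pM.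
  rewrite nuE//; last exact: ltW.
  have -> : fine (mu0 `]s, t]%classic) = t - s.
    by rewrite mu0E// setIidl// lebesgue_measure_itv/= lte_fin st.
  move/le_trans; apply; rewrite le_eqVlt; apply/orP; left; apply/eqP.
  by apply: eq_measure_integral => A mA As; have := mu0E A mA; rewrite (setIidl (subset_trans As sub)).
exists g; split; last first.
  move=> p M sp p0 cp M0 pM s t as_ st tb.
  have := main p M sp p0 cp M0 pM s t 0 as_ st tb.
  by rewrite scaler0 subr0; under eq_integral do rewrite subr0.
have [s [ss sc sL _]] := gP setT measurableT.
pose x (n i : nat) : V := nth 0 (enum_fset (fset_set (range (s n)))) i.
have Fx n i : {ae mu, forall t, t \in `]a, b[ ->
    exists F : R -> R, (forall s t, a <= s -> s < t -> t <= b ->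
       `|u t - u s - (t - s) *: x n i| <= F t - F s) /\
     h^-1 *: (F (h + t) - F t) @[h --> 0^'] --> `|g t - x n i|}.
  have [q [mq q0 qE]] : exists q : R -> R, [/\ measurable_fun setT q, forall y, 0 <= q y &
      {ae mu0, forall y, q y = `|g y - x n i|}].
    have [|P [mP PE]] := ae_limit_measurable ss sc (phi := fun v => `|v - x n i|).
      by move=> v; apply: cvg_norm; apply: cvgB; [exact: cvg_id|exact: cvg_cst].
    exists (fun y => Num.max (P y) 0); split.
    - exact: measurable_maxr.
    - by move=> y; rewrite le_max lexx orbT.
    - by apply: (ae_imp PE) => y ->; rewrite max_l.
  have q_fin : (\int[mu0]_y (q y)%:E < +oo)%E.
    have [N hN] : exists N, (\int[mu0]_y (`|g y - s N y|)%:E)%E \is a fin_num.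
      by move/fine_cvgP : sL => [[N _ /(_ _ (leqnn N)) hN] _]; exists N.
    have [h [mh h0 hE]] := ae_dist_measurable ss sc N.
    have [B B0 sB] : exists2 B : R, 0 <= B & forall y, `|s N y - x n i| <= B.
      exists (\sum_(v <- enum_fset (fset_set (range (s N)))) `|v - x n i|); first exact: sumr_ge0.
      move=> y; have sy : s N y \in enum_fset (fset_set (range (s N))).
        by have := (ss N).1 => fs; rewrite -[_ \in _]/(s N y \in fset_set (range (s N))) in_fset_set// inE; exists y.
      by rewrite (big_rem _ sy)/= lerDl sumr_ge0.
    apply: (@le_lt_trans _ _ (\int[mu0]_y ((h y)%:E + B%:E))%E).
      apply: ae_le_lower_integral.
      - by move=> y _; rewrite lee_fin.
      - by move=> y _; rewrite -EFinD lee_fin addr_ge0.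
      apply: (ae_imp2 qE hE) => y -> -> _; rewrite -EFinD lee_fin.
      rewrite -[g y](subrK (s N y)) addrK -addrA; apply: le_trans (ler_normD _ _) _.
      by rewrite lerD2l.
    rewrite ge0_integralD//; try solve [exact/measurable_EFinP | by move=> y _; rewrite lee_fin].
    apply: lte_add_pinfty.
      apply: (@le_lt_trans _ _ (\int[mu0]_y (`|g y - s N y|)%:E)%E); last by rewrite ltey_eq hN.
      apply: ae_le_lower_integral => [y _|y _|]; rewrite ?lee_fin//.
      by apply: (ae_imp hE) => y ->.
    rewrite integral_cst//= ltey_eq; apply/orP; left.
    by rewrite fin_numM// fin_num_measure.
  pose f := q \_ `[a, b].
  have f0 y : 0 <= f y by rewrite /f patchE; case: ifP.
  have if_ : mu.-integrable setT (EFin \o f).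
    apply/integrableP; split.
      by apply/measurable_EFinP; apply/(measurable_restrictT _ _).1 => //; exact: measurable_funTS.
    under eq_integral do rewrite /= ger0_norm//.
    have -> : (\int[mu]_y (f y)%:E = \int[mu]_(y in `[a, b]) (q y)%:E)%E.
      rewrite [RHS]integral_mkcond; apply: eq_integral => y _.
      by rewrite /f !patchE; case: ifP.
    have <- : (\int[mu0]_(y in `[a, b]) (q y)%:E = \int[mu]_(y in `[a, b]) (q y)%:E)%E.
      by apply: eq_measure_integral => A mA As; have := mu0E A mA; rewrite (setIidl As).
    apply: le_lt_trans q_fin; apply: ge0_subset_integral => //.
      exact/measurable_EFinP.
    by move=> y _; rewrite lee_fin.
  have lf : locally_integrable setT f.
    by apply: open_integrable_locally => //; exact: openT.
  have := FTC1 (a := BLeft a) _ lf.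
  have if' y : mu.-integrable [set` Interval (BLeft a) (BRight y)] (EFin \o f).
    exact: integrableS if_.
  move=> /(_ if').
  set F := (F in let F := F in _) => /= dF.
  have qEm : {ae mu, forall y, y \in `[a, b] -> q y = `|g y - x n i|}.
    have [N [mN N0 sN]] := qE; exists (N `&` `[a, b]); split.
    - exact: measurableI.
    - by rewrite -mu0E.
    - by move=> t /not_implyP[tab nt]; split => //; exact: sN.
  apply: (ae_imp2 qEm dF) => t qt dFt tab; exists F; split; last first.
    have [|d1 d2] := dFt.
      by rewrite lte_fin; move: tab; rewrite in_itv/= => /andP[].
    apply: derivable1_cvg => //; rewrite d2 /f patchE mem_set/=; last exact: subset_itv_oo_cc.
    by rewrite qt// subset_itv_oo_cc.
  move=> s' t' as_ st tb; rewrite -lee_fin.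
  have := main (fun v => `|v|) 1 _ _ _ ler01 _ s' t' (x n i) as_ st tb.
  move=> /(_ _ _ _ _)/le_trans; apply.
  - split=> [v w|r v r0]; first exact: ler_normD.
    by rewrite normrZ ger0_norm.
  - by [].
  - exact: norm_continuous.
  - by move=> v; rewrite mul1r.
  have sub : `]s', t']%classic `<=` `[a, b] by apply: subset_itv; rewrite bnd_simp.
  apply: (@le_trans _ _ (\int[mu]_(y in `]s', t']) (f y)%:E)%E).
    apply: lower_integral_le => [y _|]; first by rewrite lee_fin.
    apply: (ae_imp qEm) => y qy yst; rewrite /f patchE mem_set/=; last exact: sub.
    by rewrite qy//; exact: sub.
  have ist : mu.-integrable `]s', t'] (EFin \o f) by exact: integrableS if_.
  rewrite /F Rintegral_itvB ?bnd_simp//; last exact: ltW.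
  by rewrite /Rintegral fineK// integrable_fin_num.
have scm : {ae mu, forall t, t \in `[a, b] -> s n t @[n --> \oo] --> g t}.
  have [N [mN N0 sN]] := sc; exists (N `&` `[a, b]); split.
  - exact: measurableI.
  - by rewrite -mu0E.
  - by move=> t /not_implyP[tab nt]; split => //; exact: sN.
have Fx' : {ae mu, forall t n i, t \in `]a, b[ ->
    exists F : R -> R, (forall s t, a <= s -> s < t -> t <= b ->
       `|u t - u s - (t - s) *: x n i| <= F t - F s) /\
     h^-1 *: (F (h + t) - F t) @[h --> 0^'] --> `|g t - x n i|}.
  by apply: ae_foralln => n; apply: ae_foralln => i; exact: Fx.
apply: (ae_imp2 scm Fx') => t st Ft tab.
have {}st := st (subset_itv_oo_cc tab).
apply/cvgrPdist_lt => e e0.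
have e40 : 0 < e / 4 by rewrite divr_gt0.
have [n nP] : exists n, `|g t - s n t| < e / 4.
  by move/cvgrPdist_lt : st => /(_ _ e40) [n _ /(_ _ (leqnn n)) ?]; exists n.
have [i xi] : exists i, x n i = s n t.
  exists (index (s n t) (enum_fset (fset_set (range (s n))))); rewrite /x nth_index//.
  by have := (ss n).1 => fs; rewrite -[_ \in _]/(s n t \in fset_set (range (s n))) in_fset_set// inE; exists t.
have [F [Fu Ft']] := Ft n i tab.
rewrite xi in Fu Ft'.
have near1 : \forall h \near 0^', `| `|g t - s n t| - h^-1 *: (F (h + t) - F t)| < e / 4.
  by move/cvgrPdist_lt : Ft'; apply.
have [at_ tb] : a < t /\ t < b by move: tab; rewrite in_itv/= => /andP[].
have near2 : \forall h \near (0 : R)^', a <= h + t /\ h + t <= b.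
  apply: cvg_within; apply/nbhs_ballP; exists (Num.min (t - a) (b - t)) => /=.
    by rewrite lt_min !subr_gt0 at_.
  move=> h; rewrite -ball_normE /= sub0r normrN lt_min !ltr_norml.
  by move=> /andP[/andP[? ?] /andP[? ?]]; split; lra.
near=> h.
have hn0 : h != 0 by near: h; exact: nbhs_dnbhs_neq.
have n1 : `| `|g t - s n t| - h^-1 *: (F (h + t) - F t)| < e / 4 by near: h.
have [ah hb] : a <= h + t /\ h + t <= b by near: h.
suff H : `|h^-1 *: (u (h + t) - u t) - s n t| <= h^-1 *: (F (h + t) - F t).
  have -> : g t - h^-1 *: (u (h + t) - u t) = (g t - s n t) + (s n t - h^-1 *: (u (h + t) - u t)).
    by rewrite subrKA.
  apply: le_lt_trans (ler_normD _ _) _; rewrite [X in _ + X]distrC.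
  move: n1; rewrite ltr_norml; lra.
have [h0|h0] := ltP 0 h.
  have := Fu t (h + t) (ltW at_) _ hb; rewrite ltrDr => /(_ h0).
  rewrite addrK => le1; rewrite -[s n t](scalerK hn0) -scalerBr normrZ.
  by rewrite ger0_norm ?invr_ge0 ?(ltW h0)// ler_wpM2l ?invr_ge0 ?(ltW h0).
have {}h0 : h < 0 by rewrite lt_neqAle hn0.
have := Fu (h + t) t ah _ (ltW tb); rewrite gtrDr => /(_ h0).
rewrite opprD addrCA subrr addr0 scaleNr opprK => le1.
rewrite -[s n t](scalerK hn0) -scalerBr normrZ ltr0_norm ?invr_lt0//.
have -> : h^-1 *: (F (h + t) - F t) = - h^-1 * (F t - F (h + t)).
  by rewrite /GRing.scale/= mulNr -mulrN opprB.
apply: ler_wpM2l; first by rewrite oppr_ge0 invr_le0 ltW.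
by rewrite -normrN opprB [_ - (_ - _)]addrC opprB.
Unshelve. all: by end_near. Qed.

End radon_nikodym_derivative.

(** * Curves controlled by a function of time *)

Section ultrafilter_squeeze.
Context {R : realType} {V : normedModType R} (Psi : V -> R).
Hypothesis Psi_potential : dissipation_potential Psi.
Hypothesis Psi_homogeneous : positively_homogeneous Psi.

Let Psi0 : Psi 0 = 0.
Proof. exact: sublinear0 (potential_sublinear Psi_potential Psi_homogeneous). Qed.

Definition controls (a b : R) (u : R -> V) (H : R -> R) : Prop :=
  forall r s : R, a <= r -> r < s -> s <= b -> Psi (u s - u r) <= H s - H r.

(** The wedge makes the order of the two times irrelevant. *)
Lemma controls_wedge (a b : R) (u : R -> V) (H : R -> R) (r s : R) : controls a b u H ->
  r \in `[a, b] -> s \in `[a, b] -> Psi_wedge Psi (u s - u r) <= `|H s - H r|.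
Proof.
rewrite !in_itv/= => uH /andP[ar rb] /andP[as_ sb]; rewrite /Psi_wedge ge_min opprB.
have [rs|sr|->] := ltgtP r s; last by rewrite !subrr normr0 Psi0 lexx.
  by rewrite (le_trans (uH r s ar rs sb)) ?ler_norm.
by rewrite distrC (le_trans (uH s r as_ sr rb)) ?ler_norm ?orbT.
Qed.

Lemma Psi_wedge_sub_eq0 (v0 v1 : V) : Psi_wedge Psi (v0 - v1) <= 0 -> v0 = v1.
Proof. by rewrite /Psi_wedge ge_min opprB => /orP[|] /(potential_sub_eq0 Psi_potential). Qed.

(** Because [Psi] is not coercive, a small value of [Psi] gives closeness only
within a compact set; here [f i] is close to the point [k i] of [K]. *)
Lemma Psi_squeeze I (U : set_system I) (UU : UltraFilter U) (K : set V)
    (f k x : I -> V) (e : I -> R) (x0 : V) : compact K ->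
  (\forall i \near U, K (k i)) -> f i - k i @[i --> U] --> (0 : V) ->
  x i @[i --> U] --> x0 -> e i @[i --> U] --> (0 : R) ->
  (\forall i \near U, Psi_wedge Psi (f i - x i) <= e i) ->
  f i @[i --> U] --> x0.
Proof.
move=> cK Kk fk xx0 e0 fe.
have [p Kp kp] := ultra_compact_cvg UU cK Kk.
have fp : f i @[i --> U] --> p.
  have h : (f i - k i) + k i @[i --> U] --> 0 + p by exact: cvgD.
  rewrite add0r in h; apply: cvg_trans h; apply: near_eq_cvg.
  by apply: nearW => i; rewrite subrK.
suff <- : p = x0 by [].
apply: Psi_wedge_sub_eq0.
have c : Psi_wedge Psi (f i - x i) @[i --> U] --> Psi_wedge Psi (p - x0).
  by apply: continuous_cvg; [exact: (Psi_wedge_continuous Psi_potential)|exact: cvgB].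
exact: (ler_limit c e0 fe).
Qed.

End ultrafilter_squeeze.

Section arclength.
Context {R : realType}.

(** [tau] is the inverse of [x + A x], normalised.  Adding [x] makes the function
strictly increasing, so that [tau] is defined where [A] is constant. *)
Lemma arclength_reparametrization (a b : R) (A : R -> R) : a < b ->
  {within `[a, b], continuous A} ->
  (forall x y, a <= x -> x <= y -> y <= b -> A x <= A y) ->
  exists tau : R -> R, [/\ forall s, 0 <= s -> s <= 1 -> a <= tau s /\ tau s <= b,
    tau 0 = a, tau 1 = b,
    forall s1 s2, 0 <= s1 -> s1 < s2 -> s2 <= 1 -> tau s1 < tau s2 /\
      A (tau s2) - A (tau s1) <= ((b - a) + (A b - A a)) * (s2 - s1) &
    forall x, a <= x -> x <= b -> exists2 s, 0 <= s <= 1 & tau s = x].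
Proof.
move=> ab cA mA; pose L := (b - a) + (A b - A a).
have L0 : 0 < L by have := mA a b (lexx _) (ltW ab) (lexx _); rewrite /L; lra.
pose S x := ((x - a) + (A x - A a)) / L.
have SS x y : L * (S y - S x) = (y - x) + (A y - A x).
  by rewrite /S -mulrBl mulrCA divff ?gt_eqF// mulr1; lra.
have Sa : S a = 0 by rewrite /S !subrr addr0 mul0r.
have Sb : S b = 1 by rewrite /S divff// gt_eqF.
have Slt x y : a <= x -> x < y -> y <= b -> S x < S y.
  move=> ax xy yb; rewrite /S ltr_pM2r ?invr_gt0//.
  by have := mA x y ax (ltW xy) yb; lra.
have cS : {within `[a, b], continuous S}.
  apply/subspace_continuousP => x xab; apply: cvgMl; apply: cvgD.
    by apply: cvgB; [exact: cvg_within|exact: cvg_cst].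
  by apply: cvgB; [move/subspace_continuousP : cA; exact|exact: cvg_cst].
have /choice[tau tauP] : forall s, exists x, 0 <= s -> s <= 1 -> [/\ a <= x, x <= b & S x = s].
  move=> s; have [s01|ns] := pselect (0 <= s /\ s <= 1); last first.
    by exists 0 => s0 s1; exfalso; apply: ns.
  have [|x] := @IVT _ S a b s (ltW ab) cS.
    by rewrite Sa Sb minElt maxElt ltr01; case: s01 => -> ->.
  by rewrite in_itv/= => /andP[ax xb] Sx; exists x.
have inj x y : a <= x -> x <= b -> a <= y -> y <= b -> S x = S y -> x = y.
  move=> ax xb ay yb Sxy; apply/eqP; case: ltgtP => // h.
    by have := Slt x y ax h yb; rewrite Sxy ltxx.
  by have := Slt y x ay h xb; rewrite Sxy ltxx.
exists tau; split.
- by move=> s s0 s1; have [] := tauP s s0 s1.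
- by have [t1 t2 t3] := tauP 0 (lexx _) ler01; apply: inj => //; [exact: ltW|rewrite t3].
- by have [t1 t2 t3] := tauP 1 ler01 (lexx _); apply: inj => //; [exact: ltW|rewrite t3].
- move=> s1 s2 s10 s12 s21.
  have [p1 p2 p3] := tauP s1 s10 (le_trans (ltW s12) s21).
  have [q1 q2 q3] := tauP s2 (le_trans s10 (ltW s12)) s21.
  have tt : tau s1 < tau s2.
    rewrite ltNge le_eqVlt; apply/negP => /predU1P[h|h].
      by move: s12; rewrite -p3 -q3 h ltxx.
    by have := Slt _ _ q1 h p2; rewrite p3 q3 ltNge (ltW s12).
  split => //.
  have : L * (s2 - s1) = (tau s2 - tau s1) + (A (tau s2) - A (tau s1)).
    by have := SS (tau s1) (tau s2); rewrite p3 q3.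
  by rewrite -/L => ->; rewrite lerDr subr_ge0 ltW.
- move=> x ax xb; exists (S x).
    apply/andP; split.
      by rewrite /S divr_ge0 ?(ltW L0)// addr_ge0 ?subr_ge0//; exact: mA.
    rewrite -Sb; move: xb; rewrite le_eqVlt => /predU1P[->//|xb].
    by rewrite ltW// Slt.
  have S0 : 0 <= S x by rewrite /S divr_ge0 ?(ltW L0)// addr_ge0 ?subr_ge0//; exact: mA.
  have S1 : S x <= 1.
    rewrite -Sb; move: xb; rewrite le_eqVlt => /predU1P[->//|xb].
    by rewrite ltW// Slt.
  by have [t1 t2 t3] := tauP (S x) S0 S1; exact: inj.
Qed.

End arclength.

Section controlled_curves.
Context {R : realType} {V : completeNormedModType R} (Psi Phi : V -> R) (T : R).
Context (D : set V) (En : R -> V -> R) (F : R -> R).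
Local Notation mu := (@lebesgue_measure R).
Hypothesis V_RNP : radon_nikodym_property V.
Hypothesis T_gt0 : 0 < T.
Hypothesis Psi_potential : dissipation_potential Psi.
Hypothesis Psi_homogeneous : positively_homogeneous Psi.
Hypothesis F_profile : viscous_profile F.
Hypothesis Phi_F : forall v, Phi v = F `|v|.

(** [ctl_gap] is what remains of the contact inequality after integration; it
involves no derivative and passes to pointwise limits. *)
Record controlled (E : R) (y w : R -> V) (A : R -> R) : Prop := {
  ctl_cont : {within `[0, T], continuous A};
  ctl_sublevel : forall t, t \in `[0, T] -> sublevel Psi T D En E (w t);
  ctl_Psi : controls Psi 0 T y A;
  ctl_gap : forall c r s, 0 <= c -> 0 <= r -> r < s -> s <= T ->
    (forall t, t \in `[r, s] -> (c%:E < stability_gap Psi D En t (w t))%E) ->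
    Psi (y s - y r) + c * `|y s - y r| <= A s - A r
}.

Lemma lower_integral_subset (A B : set (measurableTypeR R)) (f : R -> \bar R) : A `<=` B ->
  (forall x, B x -> (0 <= f x)%E) ->
  (\int[mu]_(x in A) f x <= \int[mu]_(x in B) f x)%E.
Proof.
move=> AB f0; rewrite integral_mkcond [leRHS]integral_mkcond.
apply: ae_le_lower_integral.
- by move=> x _; rewrite patchE; case: ifPn => // /set_mem/AB/f0.
- by move=> x _; rewrite patchE; case: ifPn => // /set_mem/f0.
apply: aeW => x _; rewrite !patchE; case: ifPn => [/set_mem xA|_].
  by rewrite mem_set//; exact: AB.
by case: ifPn => // /set_mem/f0.
Qed.

Lemma ae_open_itv (P : R -> Prop) : {ae mu, forall t, t \in `]0, T[ -> P t} ->
  {ae mu, forall t, t \in `[0, T] -> P t}.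
Proof.
move=> [N [mN N0 PN]]; exists (N `|` [set 0; T]); split.
- by apply: measurableU => //; apply: measurableU; exact: measurable_set1.
- apply/negligibleP.
    by apply: measurableU => //; apply: measurableU; exact: measurable_set1.
  apply: negligibleU; first exact/negligibleP.
  apply: negligibleU; (apply/negligibleP; [exact: measurable_set1|exact: lebesgue_measure_set1]).
- move=> t /not_implyP[tT nP].
  have [->|t0] := eqVneq t 0; first by right; left.
  have [->|tT'] := eqVneq t T; first by right; right.
  left; apply: PN => /=; apply/not_implyP; split => //.
  by move: tT; rewrite !in_itv/= => /andP[? ?]; rewrite !lt_neqAle eq_sym t0 tT'; apply/andP.
Qed.

Lemma sublinear_norm_perturbation c : 0 <= c -> exists2 M : R, 0 <= M &
  [/\ sublinear (fun v => Psi v + c * `|v|), forall v, 0 <= Psi v + c * `|v|,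
    continuous (fun v => Psi v + c * `|v|) & forall v, Psi v + c * `|v| <= M * `|v|].
Proof.
move=> c0; have [M M0 PM] := potential_bounded Psi_potential Psi_homogeneous.
have [pD pZ] := potential_sublinear Psi_potential Psi_homogeneous.
exists (M + c); first by rewrite addr_ge0// ltW.
split.
- split=> [v w|r v r0].
    have := pD v w; have := ler_wpM2l c0 (ler_normD v w); lra.
  by rewrite pZ// normrZ ger0_norm// mulrDr mulrCA.
- by move=> v; rewrite addr_ge0 ?(dp_ge0 Psi_potential)// mulr_ge0.
- move=> v; apply: cvgD; first exact: (dp_cont Psi_potential).
  by apply: cvgMr; exact: norm_continuous.
- by move=> v; rewrite mulrDl lerD2r.
Qed.

(** [A] is the primitive of the dissipation.  The two lower bounds on the integrand
are integrated, the first one through the density of [u] given by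
[ac_norm_derivative]. *)
Lemma dissipation_controlled (E C : R) (u w : R -> V) (xi : R -> V -> R^o) (eps : R) :
  0 < eps -> ac_norm 0 T u ->
  (forall t, t \in `[0, T] -> sublevel Psi T D En E (w t)) ->
  (forall t, t \in `[0, T] -> dual (xi t)) ->
  (total_dissipation Psi Phi eps u xi 0 T <= C%:E)%E ->
  {ae mu, forall t, t \in `]0, T[ -> subdiff D En t (w t) (- xi t)} ->
  exists A : R -> R, [/\ controlled E u w A, A 0 = 0,
    forall r s, 0 <= r -> r <= s -> s <= T ->
      total_dissipation Psi Phi eps u xi r s = (A s - A r)%:E &
    forall (c k r s : R), 0 < c -> 0 <= r -> r < s -> s <= T ->
      (forall t xi v, dual xi ->
        (c%:E < stability_gap Psi D En t (w t))%E -> subdiff D En t (w t) (- xi) ->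
        ((k / eps)%:E <= (Psi_eps Psi Phi eps v)%:E + Psi_eps_conj Psi Phi eps xi)%E) ->
      (forall t, t \in `[r, s] -> (c%:E < stability_gap Psi D En t (w t))%E) ->
      0 <= k -> k / eps * (s - r) <= A s - A r].
Proof.
move=> e0 uac wE xid dC xisub.
pose f t : \bar R := ((Psi_eps Psi Phi eps (derive1 u t))%:E + Psi_eps_conj Psi Phi eps (xi t))%E.
have f0 t : t \in `[0, T] -> (0 <= f t)%E.
  move=> tT; have [lx _] := xid t tT.
  by apply: le_trans (contact_ge0 Psi_potential Psi_homogeneous F_profile Phi_F (derive1 u t) e0 lx); rewrite lee_fin (dp_ge0 Psi_potential).
have [|A [cA A0 AE]] := @integral_primitive R T f (ltW T_gt0) f0.
  by apply: le_lt_trans dC _; rewrite ltry.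
have [g [dg pg]] := ac_norm_derivative V_RNP T_gt0 uac.
have dE : {ae mu, forall t, t \in `[0, T] -> derive1 u t = g t}.
  apply: ae_open_itv; apply: (ae_imp dg) => t /[apply] h.
  by rewrite /derive1; apply/cvg_lim => //.
have sE := ae_open_itv xisub.
have key c r s : 0 <= c -> 0 <= r -> r < s -> s <= T ->
    (forall t, t \in `[r, s] -> subdiff D En t (w t) (- xi t) ->
      ((Psi (derive1 u t) + c * `|derive1 u t|)%:E <= f t)%E) ->
    Psi (u s - u r) + c * `|u s - u r| <= A s - A r.
  move=> c0 r0 rs sT h.
  have [M M0 [sp p0 cp pM]] := sublinear_norm_perturbation c0.
  have sub : `]r, s] `<=` `[r, s] by exact: subset_itv_oc_cc.
  have sub2 : `[r, s] `<=` `[0, T] by apply: subset_itv; rewrite bnd_simp.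
  rewrite -lee_fin; apply: le_trans (pg _ M sp p0 cp M0 pM r s r0 rs sT) _.
  rewrite -AE//; last exact: ltW.
  apply: (@le_trans _ _ (\int[mu]_(t in `]r, s]) f t)%E).
    apply: lower_integral_le => [t /sub/sub2/f0//|].
    apply: (ae_imp2 dE sE) => t dEt sEt /sub trs.
    have tT := sub2 _ trs.
    by rewrite -dEt//; apply: h => //; exact: sEt.
  by apply: lower_integral_subset => // t /sub2/f0.
exists A; split => //.
- split => //.
    move=> r s r0 rs sT; have := key 0 r s (lexx _) r0 rs sT.
    rewrite mul0r addr0; apply => t trs _; rewrite mul0r addr0.
    have [|lx _] := xid t; last exact: (contact_ge0 Psi_potential Psi_homogeneous F_profile Phi_F _ e0 lx).
    by move: trs; apply: subset_itv; rewrite bnd_simp.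
  move=> c r s c0 r0 rs sT hg; apply: key => // t trs sd.
  apply: (contact_ge Psi_potential Psi_homogeneous Phi_F _ e0 c0 _ (hg t trs) sd).
  by apply: xid; move: trs; apply: subset_itv; rewrite bnd_simp.
- move=> c k r s c0 r0 rs sT kP hg k0.
  have sub2 : `[r, s] `<=` `[0, T] by apply: subset_itv; rewrite bnd_simp.
  rewrite -lee_fin -AE//; last exact: ltW.
  have <- : (\int[mu]_(t in `[r, s]) cst (k / eps)%:E t = (k / eps * (s - r))%:E)%E.
    rewrite integral_cst; last exact: measurable_itv.
    by rewrite /= lebesgue_measure_itv/= lte_fin rs -EFinB -EFinM.
  apply: ae_le_lower_integral => [t _|t /sub2/f0//|].
    by rewrite lee_fin divr_ge0// ltW.
  apply: (ae_imp sE) => t sEt trs.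
  exact: (kP t (xi t) _ (xid t (sub2 _ trs)) (hg t trs) (sEt (sub2 _ trs))).
Qed.

End controlled_curves.

(** * Transitions obtained as limits of rescaled curves *)

Section transition.
Context {R : realType} {V : completeNormedModType R} (Psi : V -> R) (T : R).
Context (D : set V) (En : R -> V -> R).
Local Notation mu := (@lebesgue_measure R).
Local Notation gap := (stability_gap Psi D En).
Hypothesis V_RNP : radon_nikodym_property V.
Hypothesis Psi_potential : dissipation_potential Psi.
Hypothesis Psi_homogeneous : positively_homogeneous Psi.
Hypothesis En_admissible : admissible_energy Psi T D En.

Lemma lipschitz_ac_curve (a b k : R) (Z : set V) (p : V -> R) (u : R -> V) : 0 <= k ->
  (forall t : R, t \in `[a, b] -> Z (u t)) ->
  (forall r s : R, a <= r -> r < s -> s <= b -> p (u s - u r) <= k * (s - r)) ->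
  ac_curve a b Z p u.
Proof.
move=> k0 uZ pu; split => //; exists (cst k); split => //.
- apply: continuous_compact_integrable; first exact: segment_compact.
  by apply: continuous_subspaceT => x; exact: cvg_cst.
- move=> t0 t1 a0 t01 t1b.
  have -> : (\int[mu]_(s in `[t0, t1]) (cst k s)%:E = \int[mu]_(s in `[t0, t1]) cst k%:E s)%E by [].
  rewrite integral_cst; last exact: measurable_itv.
  by rewrite /= lebesgue_measure_itv/= lte_fin t01 -EFinB -EFinM lee_fin; exact: pu.
Qed.

(** A curve as below is an admissible transition of cost at most [J]; such curves
are the limits of the rescaled curves. *)
Section lipschitz_transition.
Variables (E J t : R) (theta : R -> V).
Hypothesis E0 : 0 < E.
Hypothesis J0 : 0 <= J.
Hypothesis tT : t \in `[0, T].
Hypothesis theta_sublevel : forall s : R, s \in `[0, 1] -> sublevel Psi T D En E (theta s).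
Hypothesis theta_lip : forall r s : R, 0 <= r -> r < s -> s <= 1 ->
  Psi (theta s - theta r) <= J * (s - r).
Hypothesis theta_gap : forall c p q : R, 0 <= c -> 0 <= p -> q <= 1 ->
  (forall s : R, s \in `[p, q] -> (c%:E < gap t (theta s))%E) ->
  forall r s : R, p <= r -> r < s -> s <= q ->
  Psi (theta s - theta r) + c * `|theta s - theta r| <= J * (s - r).

Lemma theta_cvg I (U : set_system I) (UU : UltraFilter U) (s : I -> R) (s0 : R) :
  s0 \in `[0, 1] -> s i @[i --> U] --> s0 -> (\forall i \near U, s i \in `[0, 1]) ->
  theta (s i) @[i --> U] --> theta s0.
Proof.
move=> s01 ss0 sn.
have e0 : `|J * s i - J * s0| @[i --> U] --> (0 : R).
  rewrite -(normr0 R) -(subrr (J * s0)); apply: cvg_norm; apply: cvgB; last exact: cvg_cst.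
  exact: cvgMr.
apply: (Psi_squeeze Psi_potential UU (en_compact En_admissible E0) (k := theta \o s)
  (x := fun=> theta s0) _ _ (cvg_cst _) e0).
- by apply: filterS sn => i; exact: theta_sublevel.
- rewrite [X in X @ _ --> _](_ : _ = fun=> (0 : V)); first exact: cvg_cst.
  by apply/funext => i /=; rewrite subrr.
have cJ : controls Psi 0 1 theta (fun r => J * r).
  by move=> p q p0 pq q1; rewrite -mulrBr; exact: theta_lip.
by apply: filterS sn => i si; apply: (controls_wedge Psi_potential Psi_homogeneous cJ).
Qed.

Lemma gap_open (c s : R) : 0 <= c -> s \in `]0, 1[ -> (c%:E < gap t (theta s))%E ->
  \forall r \near s, r \in `[0, 1] /\ (c%:E < gap t (theta r))%E.
Proof.
move=> c0 s01 cs; have s01' : s \in `[0, 1] by exact: subset_itv_oo_cc.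
have near01 : \forall r \near s, r \in `[0, 1].
  move: s01; rewrite in_itv/= => /andP[s0 s1].
  apply/nbhs_ballP; exists (Num.min s (1 - s)) => /=; first by rewrite lt_min s0 subr_gt0.
  move=> r; rewrite -ball_normE /= lt_min !ltr_norml in_itv/= => /andP[/andP[? ?] /andP[? ?]].
  by apply/andP; split; lra.
apply: near_ultraP => W UW sW.
have [//|nW] := in_ultra_setVsetC [set r | r \in `[0, 1] /\ (c%:E < gap t (theta r))%E] UW.
exfalso.
have Wid : r @[r --> W] --> s by exact: sW.
have W01 : \forall r \near W, r \in `[0, 1] by exact: sW.
have : (gap t (theta s) <= c%:E)%E.
  apply: (gap_lsc Psi_potential Psi_homogeneous En_admissible UW (s := fun=> t) (x := theta) E0 c0 tT
    (theta_sublevel s01') (cvg_cst _) (theta_cvg UW s01' Wid W01)).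
    by apply: filterS W01 => r r01; split => //; exact: theta_sublevel.
  near=> r; have r01 : r \in `[0, 1] by near: r.
  have /= : (~` [set r | r \in `[0, 1] /\ (c%:E < gap t (theta r))%E]) r by near: r; exact: nW.
  by move=> h; rewrite leNgt; apply/negP => hr; apply: h.
by rewrite leNgt cs.
Unshelve. all: by end_near. Qed.

(** A lower semicontinuous function has a minimum on a compact interval. *)
Lemma gap_bounded_below (p q : R) : 0 <= p -> q <= 1 ->
  (forall s : R, s \in `[p, q] -> (0 < gap t (theta s))%E) ->
  exists2 c : R, 0 < c & forall s : R, s \in `[p, q] -> (c%:E < gap t (theta s))%E.
Proof.
move=> p0 q1 pos; apply: contrapT => nex.
have /choice[s sP] : forall n : nat, exists s : R, s \in `[p, q] /\ (gap t (theta s) <= (n.+1%:R^-1)%:E)%E.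
  move=> n; apply: contrapT => ns; apply: nex; exists n.+1%:R^-1; first by rewrite invr_gt0.
  by move=> s spq; rewrite ltNge; apply/negP => h; apply: ns; exists s.
have [U [UU oU]] := @ultraFilterLemma _ \oo _.
have [|s0 s0pq ss0] := @ultra_compact_cvg R nat U s `[p, q] UU (@segment_compact _ _ _).
  by apply: nearW => n; exact: (sP n).1.
have sub x : x \in `[p, q] -> x \in `[0, 1] by apply: subset_itv; rewrite bnd_simp.
have s01 : s0 \in `[0, 1] by exact: sub.
have s01n : \forall n \near U, s n \in `[0, 1] by apply: nearW => n; exact: sub (sP n).1.
have : (gap t (theta s0) <= 0)%E.
  apply/lee_addgt0Pr => e e0; rewrite add0e.
  apply: (gap_lsc Psi_potential Psi_homogeneous En_admissible UU (s := fun=> t) (x := theta \o s) E0 (ltW e0) tT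
    (theta_sublevel s01) (cvg_cst _) (theta_cvg UU s01 ss0 s01n)).
    by apply: filterS s01n => n sn; split => //; exact: theta_sublevel.
  apply: oU; have [N _ hN] := near_infty_natSinv_lt (PosNum e0).
  exists N => // n /hN /= /ltW ne; apply: le_trans (sP n).2 _; by rewrite lee_fin.
by rewrite leNgt pos.
Qed.

(** On a compact part of the unstable set the gap exceeds some [c > 0], and
[c |.|] is then Lipschitz along the curve, which [Psi] alone would not give. *)
Lemma transition_loc_ac : loc_ac_norm (unstable_set Psi D En t theta) theta.
Proof.
move=> p q pq sub.
have [p01 _] : unstable_set Psi D En t theta p by apply: sub; rewrite /= in_itv/= lexx.
have [q01 _] : unstable_set Psi D En t theta q by apply: sub; rewrite /= in_itv/= lexx andbT.
have p0 : 0 <= p by move: p01; rewrite in_itv/= => /andP[].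
have q1 : q <= 1 by move: q01; rewrite in_itv/= => /andP[].
have [|c c0 cP] := gap_bounded_below p0 q1; first by move=> s spq; have [] := sub s spq.
apply: (@lipschitz_ac_curve _ _ (J / c)) => //; first by rewrite divr_ge0// ltW.
move=> r s pr rs sq; have := theta_gap (ltW c0) p0 q1 cP pr rs sq.
have := dp_ge0 Psi_potential (theta s - theta r).
rewrite mulrAC ler_pdivlMr// mulrC; lra.
Qed.

Lemma derivative_dissipation_le (c r : R) l : 0 <= c -> r \in `]0, 1[ ->
  (c%:E < gap t (theta r))%E -> h^-1 *: (theta (h + r) - theta r) @[h --> 0^'] --> l ->
  Psi l + c * `|l| <= J.
Proof.
move=> c0 r01 cr hl.
have /nbhs_ballP[d /= d0 dP] := gap_open c0 r01 cr.
have hl' : h^-1 *: (theta (h + r) - theta r) @[h --> 0^'+] --> l.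
  exact: cvg_dnbhs_at_right.
have cl : Psi (h^-1 *: (theta (h + r) - theta r)) + c * `|h^-1 *: (theta (h + r) - theta r)| @[h --> 0^'+]
    --> Psi l + c * `|l|.
  apply: cvgD; first by apply: continuous_cvg => //; exact: (dp_cont Psi_potential).
  by apply: cvgMr; exact: cvg_norm.
apply: (ler_limit cl (cvg_cst J)); near=> h.
have h0 : 0 < h by [].
have hd : h < d by near: h; exact: nbhs_right_lt.
have sg s : s \in `[r, h + r] -> s \in `[0, 1] /\ (c%:E < gap t (theta s))%E.
  rewrite in_itv/= => /andP[rs sh]; apply: dP; rewrite -ball_normE /= ltr_norml.
  by apply/andP; split; lra.
have rh : r < h + r by rewrite ltrDr.
have [h1 _] := sg (h + r) ltac:(by rewrite in_itv/= lexx andbT ltW).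
have := theta_gap c0 _ _ (fun s hs => (sg s hs).2) (lexx r) rh (lexx _).
move: r01 h1; rewrite !in_itv/= => /andP[r0 r1] /andP[_ h1] /(_ (ltW r0) h1).
rewrite addrK Psi_homogeneous ?invr_ge0 ?(ltW h0)// normrZ ger0_norm ?invr_ge0 ?(ltW h0)//.
by move=> hJ; rewrite mulrCA -mulrDr ler_pdivrMl// (mulrC h).
Unshelve. all: by end_near. Qed.

(** Difference quotients are at most [J] from both sides; where they have no limit
the speed is the default value of [lim], which is 0. *)
Lemma Psi_speed_le (r : R) : r \in `]0, 1[ -> Psi_speed Psi theta r <= J.
Proof.
move=> r01; rewrite /Psi_speed.
have [c|nc] := pselect (cvg (Psi (h^-1 *: (theta (r + h) - theta r)) @[h --> 0^'])); last first.
  by rewrite dvgP.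
apply: limr_le => //.
move: r01; rewrite in_itv/= => /andP[r0 r1].
have near2 : \forall h \near (0 : R)^', 0 <= r + h /\ r + h <= 1.
  apply: cvg_within; apply/nbhs_ballP; exists (Num.min r (1 - r)) => /=.
    by rewrite lt_min subr_gt0 r0.
  move=> h; rewrite -ball_normE /= sub0r normrN lt_min !ltr_norml.
  by move=> /andP[/andP[? ?] /andP[? ?]]; split; lra.
near=> h.
have hn0 : h != 0 by near: h; exact: nbhs_dnbhs_neq.
have [h1 h2] : 0 <= r + h /\ r + h <= 1 by near: h.
have [h0|h0] := ltP 0 h.
  rewrite Psi_homogeneous ?invr_ge0 ?(ltW h0)// ler_pdivrMl// mulrC.
  by have := theta_lip (ltW r0) _ h2; rewrite ltrDl addrAC subrr add0r; apply.
have {}h0 : h < 0 by rewrite lt_neqAle hn0.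
have -> : h^-1 *: (theta (r + h) - theta r) = (- h)^-1 *: (theta r - theta (r + h)).
  by rewrite invrN scaleNr -scalerN opprB.
have mh : 0 < - h by rewrite oppr_gt0.
rewrite Psi_homogeneous ?invr_ge0 ?(ltW mh)// ler_pdivrMl// mulrC.
by have := theta_lip h1 _ (ltW r1); rewrite gtrDl opprD addNKr; apply.
Unshelve. all: by end_near. Qed.

(** The unstable set is covered by countably many compact rational intervals on
which the curve is absolutely continuous. *)
Lemma derivative_ae : {ae mu, forall r, r \in `]0, 1[ -> (0 < gap t (theta r))%E ->
  cvg (h^-1 *: (theta (h + r) - theta r) @[h --> 0^'])}.
Proof.
pose P (pq : rat * rat) := forall s : R, s \in `[ratr pq.1, ratr pq.2] ->
  s \in `[0, 1] /\ (0 < gap t (theta s))%E.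
have piece pq : {ae mu, forall r : R, P pq -> ratr pq.1 < r -> r < ratr pq.2 ->
    cvg (h^-1 *: (theta (h + r) - theta r) @[h --> 0^'])}.
  have [Ppq|nP] := pselect (P pq); last by apply: aeW.
  have [lt|ge] := ltP (ratr pq.1 : R) (ratr pq.2); last first.
    by apply: aeW => r _ h1 h2; have := lt_trans h1 h2; rewrite ltNge ge.
  have ac : ac_norm (ratr pq.1) (ratr pq.2) theta.
    by apply: transition_loc_ac; [exact: ltW|move=> s /Ppq].
  have [g [dg _]] := ac_norm_derivative V_RNP lt ac.
  apply: (ae_imp dg) => r gr _ h1 h2; apply/cvg_ex; exists (g r); apply: gr.
  by rewrite in_itv/= h1.
have all : {ae mu, forall r : R, forall (n : nat) (pq : rat * rat), choice.unpickle n = Some pq -> P pq ->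
    ratr pq.1 < r -> r < ratr pq.2 -> cvg (h^-1 *: (theta (h + r) - theta r) @[h --> 0^'])}.
  apply: ae_foralln => n; case E1 : (choice.unpickle n) => [pq|]; last by apply: aeW.
  by apply: (ae_imp (piece pq)) => r h _ [<-].
apply: (ae_imp all) => r h r01 gr.
have /nbhs_ballP[d /= d0 dP] := gap_open (lexx 0) r01 gr.
have [p /andP[p1 p2]] : exists p : rat, (r - d < ratr p) && (ratr p < r).
  have [p] := @rat_in_itvoo _ (r - d) r ltac:(by rewrite ltrBlDr ltrDl).
  by rewrite in_itv/= => pP; exists p.
have [q /andP[q1 q2]] : exists q : rat, (r < ratr q) && (ratr q < r + d).
  have [q] := @rat_in_itvoo _ r (r + d) ltac:(by rewrite ltrDl).
  by rewrite in_itv/= => qP; exists q.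
apply: (h (choice.pickle (p, q)) (p, q)) => //; first exact: choice.pickleK.
move=> s /=; rewrite in_itv/= => /andP[ps sq]; apply: dP.
by rewrite -ball_normE /= ltr_norml; apply/andP; split; lra.
Qed.

(** The bound holds for every [c] below the gap.  If the gap is infinite, the
derivative vanishes and so does its product with the gap. *)
Lemma finsler_density_le : {ae mu, forall r, r \in `[0, 1] ->
  (finsler_density Psi D En t theta r <= J%:E)%E}.
Proof.
have der : {ae mu, forall r, r \in `]0, 1[ -> (finsler_density Psi D En t theta r <= J%:E)%E}.
  apply: (ae_imp derivative_ae) => r dr r01; rewrite /finsler_density.
  case: ifPn => [/asboolP[_ gr]|_]; last by rewrite lee_fin; exact: Psi_speed_le.
  have key c : 0 <= c -> (c%:E < gap t (theta r))%E ->
      Psi (derive1 theta r) + c * `|derive1 theta r| <= J.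
    by move=> c0 cr; apply: (derivative_dissipation_le c0 r01 cr); exact: dr.
  set l := derive1 theta r in key *.
  have Pl : Psi l <= J by have := key 0 (lexx _) gr; rewrite mul0r addr0.
  case G : (gap t (theta r)) gr => [g| |]; rewrite ?ltNye//.
    rewrite lte_fin => g0; rewrite -EFinM -EFinD lee_fin.
    apply: (@ler_eps_mul _ _ _ `|l|) => e e0.
    have := key (Num.max 0 (g - e)).
    rewrite le_max lexx G lte_fin gt_max g0 ltrBlDr ltrDl => /(_ isT e0).
    have : (g - e) * `|l| <= Num.max 0 (g - e) * `|l| by rewrite ler_wpM2r// le_max lexx orbT.
    rewrite mulrBl; lra.
  move=> _; have l0 : `|l| = 0.
    apply/eqP; rewrite eq_le normr_ge0 andbT leNgt; apply/negP => l0.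
    have := key ((J + 1) / `|l|); rewrite G ltry divr_ge0 ?addr_ge0// => /(_ isT isT).
    rewrite divfK ?gt_eqF//; have := dp_ge0 Psi_potential l; lra.
  by rewrite l0 mule0 adde0 lee_fin.
exact: ae_open_itv der.
Qed.

Lemma finsler_cost_lipschitz : (finsler_cost Psi T D En t (theta 0) (theta 1) <= J%:E)%E.
Proof.
apply: (@le_trans _ _ (\int[mu]_(r in `[0%R, 1%R]) finsler_density Psi D En t theta r)%E).
  apply: ereal_inf_lbound; exists theta => //; split => //; last exact: transition_loc_ac.
  by exists E => //; apply: (@lipschitz_ac_curve _ _ J).
apply: (@le_trans _ _ (\int[mu]_(r in `[0%R, 1%R]) cst J%:E r)%E).
  apply: lower_integral_le => [r _|]; first by rewrite lee_fin.
  exact: finsler_density_le.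
rewrite integral_cst; last exact: measurable_itv.
by rewrite /= lebesgue_measure_itv/= lte_fin ltr01 -EFinB subr0 mule1.
Qed.

End lipschitz_transition.

Section limit_of_rescaled_curves.
Context {I : Type} (U : set_system I) (UU : UltraFilter U).
Variables (E J t : R) (y w : I -> R -> V) (A : I -> R -> R) (a b dd : I -> R).
Variables (x0 x1 : V).
Hypothesis E0 : 0 < E.
Hypothesis tT : t \in `[0, T].
Hypothesis ywA : forall i, controlled Psi T D En E (y i) (w i) (A i).
Hypothesis yw : forall i (s : R), s \in `[0, T] -> `|y i s - w i s| <= dd i.
Hypothesis dd0 : dd i @[i --> U] --> (0 : R).
Hypothesis ab : \forall i \near U, [/\ 0 <= a i, a i < b i & b i <= T].
Hypothesis a_t : a i @[i --> U] --> t.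
Hypothesis b_t : b i @[i --> U] --> t.
Hypothesis ya : y i (a i) @[i --> U] --> x0.
Hypothesis yb : y i (b i) @[i --> U] --> x1.
Hypothesis AJ : A i (b i) - A i (a i) @[i --> U] --> J.

Let L i := (b i - a i) + (A i (b i) - A i (a i)).

(** Reparametrisations of [`[a i, b i]] by [`[0, 1]] under which the control [A i]
is Lipschitz; the constant [L i] tends to [J]. *)
Record rescaling (i : I) (tau : R -> R) : Prop := {
  resc_itv : forall s : R, s \in `[0, 1] -> a i <= tau s /\ tau s <= b i;
  resc0 : tau 0 = a i;
  resc1 : tau 1 = b i;
  resc_lt : forall s1 s2 : R, 0 <= s1 -> s1 < s2 -> s2 <= 1 -> tau s1 < tau s2;
  resc_lip : forall s1 s2 : R, 0 <= s1 -> s1 < s2 -> s2 <= 1 ->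
    A i (tau s2) - A i (tau s1) <= L i * (s2 - s1);
  resc_onto : forall x : R, a i <= x -> x <= b i -> exists2 s : R, s \in `[0, 1] & tau s = x
}.

Lemma exists_rescaling : exists tau : I -> R -> R, \forall i \near U, rescaling i (tau i).
Proof.
have /choice[tau tauP] : forall i, exists tau : R -> R,
    [/\ 0 <= a i, a i < b i & b i <= T] -> rescaling i tau.
  move=> i; have [[a0 aib bT]|nab] := pselect [/\ 0 <= a i, a i < b i & b i <= T]; last by exists id.
  have cA : {within `[a i, b i], continuous (A i)}.
    apply: continuous_subspaceW (ctl_cont (ywA i)).
    by apply: subset_itv; rewrite bnd_simp.
  have mA x z : a i <= x -> x <= z -> z <= b i -> A i x <= A i z.
    move=> ax; rewrite le_eqVlt => /predU1P[->//|xz] zb.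
    have := ctl_Psi (ywA i) (le_trans a0 ax) xz (le_trans zb bT).
    have := dp_ge0 Psi_potential (y i z - y i x); lra.
  have [tau [t1 t2 t3 t4 t5]] := arclength_reparametrization aib cA mA.
  exists tau => _; split => //.
  - by move=> s; rewrite in_itv/= => /andP[s0 s1]; exact: t1.
  - by move=> s1 s2 s10 s12 s21; have [] := t4 s1 s2 s10 s12 s21.
  - by move=> s1 s2 s10 s12 s21; have [] := t4 s1 s2 s10 s12 s21.
by exists tau; apply: filterS ab => i; exact: tauP.
Qed.

(** The rescaled curves [z i] have a pointwise limit [theta] along the ultrafilter,
and the convergence is continuous in the parameter.  If the gap exceeds [c] on
[theta] over a compact parameter interval, then, by lower semicontinuity, it
exceeds [c] on the curves [w i] over the whole corresponding time interval for
most [i]; this allows [ctl_gap] to be used before the limit. *)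
Theorem rescaled_transition_cost : (finsler_cost Psi T D En t x0 x1 <= J%:E)%E.
Proof.
have [tau tauP] := exists_rescaling.
pose z i s := y i (tau i s); pose v i s := w i (tau i s).
have LJ : L i @[i --> U] --> J.
  rewrite -[J]add0r -(subrr t); apply: cvgD => //; exact: cvgB.
have inT i (s : R) : [/\ 0 <= a i, a i < b i & b i <= T] -> a i <= s /\ s <= b i -> s \in `[0, T].
  by move=> [a0 _ bT] [as_ sb]; rewrite in_itv/= (le_trans a0 as_) (le_trans sb bT).
have J0 : 0 <= J.
  apply: (ler_limit (cvg_cst 0) AJ); apply: filterS ab => i [a0 aib bT].
  have := ctl_Psi (ywA i) a0 aib bT; have := dp_ge0 Psi_potential (y i (b i) - y i (a i)); lra.
have zlip : \forall i \near U, forall r s : R, 0 <= r -> r < s -> s <= 1 ->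
    Psi (z i s - z i r) <= L i * (s - r).
  apply: filterS2 ab tauP => i abi Ri r s r0 rs s1.
  have t1 := resc_itv Ri; have lt := resc_lt Ri r0 rs s1.
  apply: le_trans (resc_lip Ri r0 rs s1).
  have [[r1 _] [_ s2]] : (a i <= tau i r /\ tau i r <= b i) /\ (a i <= tau i s /\ tau i s <= b i).
    by split; apply: t1; rewrite in_itv/=; apply/andP; split => //; lra.
  by have [a0 _ bT] := abi; apply: (ctl_Psi (ywA i)) => //; [exact: le_trans r1|exact: le_trans bT].
have vK : \forall i \near U, forall s : R, s \in `[0, 1] -> sublevel Psi T D En E (v i s).
  apply: filterS2 ab tauP => i abi Ri s s01.
  by apply: (ctl_sublevel (ywA i)); apply: inT abi (resc_itv Ri s01).
have zv : \forall i \near U, forall s : R, s \in `[0, 1] -> `|z i s - v i s| <= dd i.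
  by apply: filterS2 ab tauP => i abi Ri s s01; apply: yw; apply: inT abi (resc_itv Ri s01).
have zv0 (s : I -> R) : (\forall i \near U, s i \in `[0, 1]) ->
    z i (s i) - v i (s i) @[i --> U] --> (0 : V).
  move=> s01; apply/cvgr0Pnorm_lt => e e0; near=> i.
  have zvi : forall s : R, s \in `[0, 1] -> `|z i s - v i s| <= dd i by near: i.
  apply: le_lt_trans (zvi _ _) _; first by near: i.
  by near: i; move/cvgr_lt : dd0; exact.
have cK := en_compact En_admissible E0.
have /choice[theta thetaP] : forall s : R, exists p : V, s \in `[0, 1] ->
    sublevel Psi T D En E p /\ z i s @[i --> U] --> p.
  move=> s; have [s01|ns] := pselect (s \in `[0, 1]); last by exists 0.
  have [|p Kp vp] := @ultra_compact_cvg V I U (v ^~ s) _ UU cK.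
    by apply: filterS vK => i; exact.
  exists p => _; split => //.
  have h : (z i s - v i s) + v i s @[i --> U] --> 0 + p.
    by apply: cvgD => //; apply: (zv0 (fun=> s)); exact: nearW.
  rewrite add0r in h; apply: cvg_trans h; apply: near_eq_cvg.
  by apply: nearW => i; rewrite subrK.
have scvg (s : I -> R) (s0 : R) : s0 \in `[0, 1] -> s i @[i --> U] --> s0 ->
    (\forall i \near U, s i \in `[0, 1]) -> z i (s i) @[i --> U] --> theta s0.
  move=> s01 ss0 sn.
  have e0 : `|L i * s i - L i * s0| @[i --> U] --> (0 : R).
    rewrite -(normr0 R) -(subrr (J * s0)); apply: cvg_norm; apply: cvgB; first exact: cvgM.
    exact: cvgMl.
  apply: (Psi_squeeze Psi_potential UU cK (k := fun i => v i (s i)) (x := z ^~ s0) _ (zv0 s sn) (thetaP s0 s01).2 e0).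
    by apply: filterS2 vK sn => i; exact.
  apply: filterS2 zlip sn => i zl si.
  have cL : controls Psi 0 1 (z i) (fun r => L i * r).
    by move=> p q p0 pq q1; rewrite -mulrBr; exact: zl.
  exact: (controls_wedge Psi_potential Psi_homogeneous cL).
have i01 (s : R) : 0 <= s -> s <= 1 -> s \in `[0, 1] by move=> s0 s1; rewrite in_itv/= s0.
have e0 : theta 0 = x0.
  have h := (thetaP 0 (i01 _ (lexx _) ler01)).2.
  apply: (@cvg_unique _ (@norm_hausdorff _ V) _ _ _ _ h); apply: cvg_trans ya; apply: near_eq_cvg.
  by apply: filterS tauP => i Ri; rewrite /z (resc0 Ri).
have e1 : theta 1 = x1.
  have h := (thetaP 1 (i01 _ ler01 (lexx _))).2.
  apply: (@cvg_unique _ (@norm_hausdorff _ V) _ _ _ _ h); apply: cvg_trans yb; apply: near_eq_cvg.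
  by apply: filterS tauP => i Ri; rewrite /z (resc1 Ri).
rewrite -e0 -e1; apply: (@finsler_cost_lipschitz E J t theta E0 J0 tT).
- by move=> s /thetaP[].
- move=> r s r0 rs s1.
  have [_ cr] := thetaP r (i01 _ r0 (le_trans (ltW rs) s1)).
  have [_ cs] := thetaP s (i01 _ (le_trans r0 (ltW rs)) s1).
  have c1 : Psi (z i s - z i r) @[i --> U] --> Psi (theta s - theta r).
    by apply: continuous_cvg; [exact: (dp_cont Psi_potential)|exact: cvgB].
  have c2 : L i * (s - r) @[i --> U] --> J * (s - r) by apply: cvgMl.
  by apply: (ler_limit c1 c2); apply: filterS zlip => i; exact.
move=> c p q c0 p0 q1 hg r s pr rs sq.
have pq : p <= q by lra.
(* The indices for which the gap stays above c on the time interval of [p, q]. *)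
pose B : set I := [set i | forall x : R, tau i p <= x -> x <= tau i q -> (c%:E < gap x (w i x))%E].
have UB : U B.
  have [//|nB] := in_ultra_setVsetC B UU; exfalso.
  have /choice[sg sgP] : forall i, exists s : R, (~` B) i -> rescaling i (tau i) ->
      s \in `[p, q] /\ (gap (tau i s) (v i s) <= c%:E)%E.
    move=> i; have [Bi|nBi] := pselect (B i); first by exists 0.
    have [x xP] : exists x, [/\ tau i p <= x, x <= tau i q & ~ (c%:E < gap x (w i x))%E].
      apply: contrapT => nx; apply: nBi => x px xq; apply: contrapT => nx'.
      by apply: nx; exists x.
    have [Ri|nR] := pselect (rescaling i (tau i)); last by exists 0.
    have [px xq x3] := xP.
    have [p1 _] := resc_itv Ri (i01 p p0 (le_trans pq q1)).
    have [_ q2] := resc_itv Ri (i01 q (le_trans p0 pq) q1).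
    have [s' s'01 s'x] := resc_onto Ri (le_trans p1 px) (le_trans xq q2).
    exists s' => _ _; rewrite /v s'x; split; last by rewrite leNgt; apply/negP.
    move: s'01; rewrite !in_itv/= => /andP[s'0 s'1]; apply/andP; split.
      rewrite leNgt; apply/negP => lt.
      by move: px; rewrite -s'x leNgt (resc_lt Ri s'0 lt (le_trans pq q1)).
    rewrite leNgt; apply/negP => lt.
    by move: xq; rewrite -s'x leNgt (resc_lt Ri (le_trans p0 pq) lt s'1).
  have sgn : \forall i \near U, sg i \in `[p, q] /\ (gap (tau i (sg i)) (v i (sg i)) <= c%:E)%E.
    by apply: filterS2 nB tauP => i; exact: sgP.
  have [|s0 s0pq cs0] := @ultra_compact_cvg R I U sg `[p, q] UU (@segment_compact _ _ _).
    by apply: filterS sgn => i [].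
  have sub (x : R) : x \in `[p, q] -> x \in `[0, 1] by apply: subset_itv; rewrite bnd_simp.
  have sg01 : \forall i \near U, sg i \in `[0, 1] by apply: filterS sgn => i [/sub].
  have s01 : s0 \in `[0, 1] by exact: sub.
  have cz := scvg sg s0 s01 cs0 sg01.
  have cv : v i (sg i) @[i --> U] --> theta s0.
    have h : z i (sg i) - (z i (sg i) - v i (sg i)) @[i --> U] --> theta s0 - 0.
      by apply: cvgB => //; exact: zv0.
    rewrite subr0 in h; apply: cvg_trans h; apply: near_eq_cvg.
    by apply: nearW => i; rewrite opprB addrC subrK.
  have ct : tau i (sg i) @[i --> U] --> t.
    apply: (squeeze_cvgr _ a_t b_t); apply: filterS2 tauP sg01 => i Ri s01'.
    by have [? ?] := resc_itv Ri s01'; apply/andP.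
  have : (gap t (theta s0) <= c%:E)%E.
    apply: (gap_lsc Psi_potential Psi_homogeneous En_admissible UU E0 c0 tT (thetaP s0 s01).1 ct cv).
      near=> i.
      have abi : [/\ 0 <= a i, a i < b i & b i <= T] by near: i.
      have sgi : sg i \in `[0, 1] by near: i.
      have vKi : forall s : R, s \in `[0, 1] -> sublevel Psi T D En E (v i s) by near: i.
      have Ri : rescaling i (tau i) by near: i.
      by split; [exact: inT abi (resc_itv Ri sgi)|exact: vKi].
    by apply: filterS sgn => i [].
  by rewrite leNgt hg.
have r0 : 0 <= r by lra.
have r1 : r <= 1 by lra.
have s0 : 0 <= s by lra.
have s1 : s <= 1 by lra.
have [_ cr] := thetaP r (i01 _ r0 r1).
have [_ cs] := thetaP s (i01 _ s0 s1).
have c1 : Psi (z i s - z i r) + c * `|z i s - z i r| @[i --> U]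
    --> Psi (theta s - theta r) + c * `|theta s - theta r|.
  have cd : z i s - z i r @[i --> U] --> theta s - theta r by exact: cvgB.
  apply: cvgD; first by apply: continuous_cvg => //; exact: (dp_cont Psi_potential).
  by apply: cvgMr; exact: cvg_norm.
have c2 : L i * (s - r) @[i --> U] --> J * (s - r) by apply: cvgMl.
apply: (ler_limit c1 c2); near=> i.
have abi : [/\ 0 <= a i, a i < b i & b i <= T] by near: i.
have Bi : B i by near: i.
have Ri : rescaling i (tau i) by near: i.
apply: le_trans (resc_lip Ri r0 rs s1); have lt := resc_lt Ri r0 rs s1.
have [ar _] := resc_itv Ri (i01 _ r0 r1).
have [_ sb] := resc_itv Ri (i01 _ s0 s1).
have tle (x x' : R) : 0 <= x -> x <= x' -> x' <= 1 -> tau i x <= tau i x'.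
  by move=> x00; rewrite le_eqVlt => /predU1P[->//|xx x'1]; exact: ltW (resc_lt Ri x00 xx x'1).
have [a0 _ bT] := abi; apply: (ctl_gap (ywA i)) => //; [exact: le_trans ar|exact: le_trans bT|].
move=> x; rewrite in_itv/= => /andP[rx xs]; apply: Bi.
  by apply: le_trans rx; apply: tle => //; lra.
by apply: (le_trans xs); apply: tle => //; lra.
Unshelve. all: by end_near. Qed.

End limit_of_rescaled_curves.

End transition.

(** * Monotone functions, iterated limits and diagonal selection *)

Section nondecreasing_functions.
Context {R : realType} (T : R) (G : R -> R).
Hypothesis G_nd : forall r s : R, 0 <= r -> r <= s -> s <= T -> G r <= G s.

Lemma nondecreasing_left_limit (t : R) : 0 < t -> t <= T -> exists l : R,
  [/\ G s @[s --> t^'-] --> l, forall s : R, 0 <= s -> s < t -> G s <= l & l <= G t].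
Proof.
move=> t0 tT.
have cl : cvg (G s @[s --> t^'-]).
  apply: nondecreasing_at_left_is_cvgr.
    near=> x => r s; rewrite !in_itv/= => /andP[xr rt] /andP[xs st] rs.
    apply: G_nd => //; last by rewrite (le_trans (ltW st)).
    by rewrite (le_trans _ (ltW xr))//; near: x; exact: nbhs_left_ge.
  near=> x; exists (G t) => _ /= [s + <-]; rewrite in_itv/= => /andP[xs st].
  apply: G_nd => //; last exact: ltW.
  by rewrite (le_trans _ (ltW xs))//; near: x; exact: nbhs_left_ge.
exists (lim (G s @[s --> t^'-])); split => //.
  move=> s s0 st; apply: (ler_limit (cvg_cst (G s)) cl); near=> x.
  apply: G_nd => //; last by rewrite (le_trans _ tT)// ltW//; near: x; exact: nbhs_left_lt.
  by near: x; exact: nbhs_left_ge.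
apply: (ler_limit cl (cvg_cst (G t))); near=> x; apply: G_nd => //.
by near: x; exact: nbhs_left_ge.
Unshelve. all: by end_near. Qed.

Lemma nondecreasing_right_limit (t : R) : 0 <= t -> t < T -> exists l : R,
  [/\ G s @[s --> t^'+] --> l, forall s : R, t < s -> s <= T -> l <= G s & G t <= l].
Proof.
move=> t0 tT.
have cl : cvg (G s @[s --> t^'+]).
  apply: nondecreasing_at_right_is_cvgr.
    near=> x => r s; rewrite !in_itv/= => /andP[tr rx] /andP[ts sx] rs.
    apply: G_nd => //; first by rewrite (le_trans t0)// ltW.
    by rewrite (le_trans (ltW sx))//; near: x; exact: nbhs_right_le.
  near=> x; exists (G t) => _ /= [s + <-]; rewrite in_itv/= => /andP[ts sx].
  apply: G_nd => //; first exact: ltW.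
  by rewrite (le_trans (ltW sx))//; near: x; exact: nbhs_right_le.
exists (lim (G s @[s --> t^'+])); split => //.
  move=> s ts sT; apply: (ler_limit cl (cvg_cst (G s))); near=> x.
  apply: G_nd => //; first by rewrite (le_trans t0)// ltW//; near: x; exact: nbhs_right_gt.
  by near: x; exact: nbhs_right_le.
apply: (ler_limit (cvg_cst (G t)) cl); near=> x; apply: G_nd => //.
by near: x; exact: nbhs_right_le.
Unshelve. all: by end_near. Qed.

(** [S] contains the discontinuities.  It also contains the rationals and the end
points, so that values on [S] squeeze the values at the other points. *)
Lemma nondecreasing_continuity_points : exists S : set R,
  [/\ countable S, S 0, S T, forall q : rat, S (ratr q) &
    forall t : R, t \in `[0, T] -> ~ S t -> forall e : R, 0 < e ->
      \forall d \near 0^'+, [/\ 0 <= t - d, t + d <= T & G (t + d) - G (t - d) < e]].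
Proof.
exists ([set 0; T] `|` range (ratr : rat -> R) `|` [set x | x \in (`]0, T[) /\ discontinuity G x]); split.
- have cU (A B : set R) : countable A -> countable B -> countable (A `|` B).
    by move=> cA cB; rewrite -bigcup2E; apply: bigcup_countable => // -[|[|i]] _.
  apply: (cU).
    apply: cU; first by apply: finite_set_countable; exact: finite_set2.
    exact: (sub_countable (card_image_le _ _)) (countableP _).
  apply: discontinuity_countable => r s; rewrite !in_itv/= => /andP[r0 rT] /andP[s0 sT] rs.
  exact: G_nd.
- by left; left; left.
- by left; left; right.
- by move=> q; left; right; exists q.
move=> t tT nS e e0.
have t0 : 0 < t.
  move: tT; rewrite in_itv/= => /andP[]; rewrite le_eqVlt => /predU1P[t0|//].
  by exfalso; apply: nS; left; left; left.
have tT' : t < T.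
  move: tT; rewrite in_itv/= => /andP[_]; rewrite le_eqVlt => /predU1P[t0'|//].
  by exfalso; apply: nS; left; left; right.
have [l [cl _ _]] := nondecreasing_left_limit t0 (ltW tT').
have [r [cr _ _]] := nondecreasing_right_limit (ltW t0) tT'.
have lr : l = r.
  apply: contrapT => lr; apply: nS; right; split; first by rewrite in_itv/= t0.
  split; [by apply/cvg_ex; exists l|by apply/cvg_ex; exists r|].
  by rewrite (cvg_lim _ cl)// (cvg_lim _ cr)//; apply/eqP.
have nl : \forall s \near t^'-, l - e / 2 < G s.
  by move/cvgr_gt : cl; apply; rewrite ltrBlDr ltrDl divr_gt0.
have nr : \forall s \near t^'+, G s < r + e / 2.
  by move/cvgr_lt : cr; apply; rewrite ltrDl divr_gt0.
move: nl nr => /nbhs_ballP[d1 /= d10 d1P] /nbhs_ballP[d2 /= d20 d2P].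
near=> d.
have d0 : 0 < d by near: d; exact: nbhs_right_gt.
have dd1 : d < d1 by near: d; exact: nbhs_right_lt.
have dd2 : d < d2 by near: d; exact: nbhs_right_lt.
have dt : d < t by near: d; exact: nbhs_right_lt.
have dT : d < T - t by near: d; apply: nbhs_right_lt; rewrite subr_gt0.
split; [lra|lra|].
have h1 : l - e / 2 < G (t - d).
  by apply: d1P; [rewrite -ball_normE /= opprB addrC subrK gtr0_norm|rewrite ltrBlDr ltrDl].
have h2 : G (t + d) < r + e / 2.
  by apply: d2P; [rewrite -ball_normE /= opprD addrA subrr sub0r normrN gtr0_norm|rewrite ltrDl].
rewrite lr in h1; lra.
Unshelve. all: by end_near. Qed.

End nondecreasing_functions.

Section countable_complement.
Context {R : realType}.

Lemma countable_compl_dense (S : set R) (a b : R) : countable S -> a < b ->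
  exists2 x : R, x \in `]a, b[ & ~ S x.
Proof.
move=> cS ab; apply: contrapT => nex.
have sub : `]a, b[ `<=` S by move=> x xab; apply: contrapT => nx; apply: nex; exists x.
have := countable_lebesgue_measure0 (sub_countable (subset_card_le sub) cS).
by rewrite lebesgue_measure_itv/= lte_fin ab -EFinB => /eqP; rewrite eqe subr_eq0 gt_eqF.
Qed.

End countable_complement.

Section iterated_limits.
Context {J I : Type} (F : set_system J) (U : set_system I).

(** The limit along this filter is taken first in [i], then in [j]. *)
Definition iterated : set_system (J * I) :=
  [set A | \forall j \near F, \forall i \near U, A (j, i)].

Lemma iterated_proper : ProperFilter F -> ProperFilter U -> ProperFilter iterated.
Proof.
move=> FF UU; split.
  by move=> h; have [j hj] := @filter_ex _ F _ _ h; have [] := @filter_ex _ U _ _ hj.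
split.
- by apply: nearW => j; apply: nearW.
- move=> A B FA FB; apply: (@filterS2 _ F _ _ _ _ _ FA FB) => j; exact: filterS2.
- move=> A B AB FA; apply: (@filterS _ F _ _ _ _ FA) => j; apply: filterS => i; exact: AB.
Qed.

Lemma iterated_cvg {R : realType} {X : normedModType R} (f : J * I -> X) (g : J -> X) (l : X) :
  ProperFilter F -> ProperFilter U ->
  (\forall j \near F, f (j, i) @[i --> U] --> g j) -> g j @[j --> F] --> l ->
  f p @[p --> iterated] --> l.
Proof.
move=> FF UU fg gl; apply/(@cvgrPdist_lt _ _ _ _ (iterated_proper FF UU)) => e e0.
rewrite /prop_near1 /nbhs /= /iterated /=.
near=> j.
have fgj : f (j, i) @[i --> U] --> g j by near: j.
have glj : `|l - g j| < e / 2 by near: j; move/cvgrPdist_lt : gl; apply; rewrite divr_gt0.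
near=> i; rewrite [ltRHS](splitr e) -(subrKA (g j)).
apply: (le_lt_trans (ler_normD _ _)); apply: ltrD => //.
by near: i; move/cvgrPdist_lt : fgj; apply; rewrite divr_gt0.
Unshelve. all: by end_near. Qed.

Lemma iterated_fst (W : set_system (J * I)) : Filter F -> ProperFilter U -> iterated `<=` W ->
  p.1 @[p --> W] `=>` F.
Proof.
move=> FF UU FW A FA; apply: FW.
have : \forall j \near F, A j by [].
by apply: (@filterS _ F) => // j Aj; exact: nearW.
Qed.

Lemma iterated_snd (W : set_system (J * I)) : Filter F -> iterated `<=` W ->
  p.2 @[p --> W] `=>` U.
Proof. by move=> FF FW A UA; apply: FW; apply: nearW => j. Qed.

End iterated_limits.

Section selection.

Lemma subsequence_of_near (U : set_system nat) (P : nat -> set nat) : ProperFilter U ->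
  \oo `<=` U -> (forall k, \forall n \near U, P k n) ->
  exists phi : nat -> nat, increasing_seq phi /\ forall k, P k (phi k).
Proof.
move=> UU oU PU.
have /choice[f fP] : forall km : nat * nat, exists n, (km.2 < n)%N /\ P km.1 n.
  move=> [k m]; have /oU mU : \forall n \near \oo, (m < n)%N by exact: nbhs_infty_gt.
  by have [n [? ?]] := filter_ex (filterI mU (PU k)); exists n.
pose phi := fix phi k := if k is k'.+1 then f (k, phi k') else f (0%N, 0%N).
exists phi; split.
  by apply/increasing_seqP => k; have [] := fP (k.+1, phi k).
by case=> [|k]; [have [] := fP (0%N, 0%N)|have [] := fP (k.+1, phi k)].
Qed.

(** At step [k] only the points of [S] with code at most [k] are considered. *)
Lemma diagonal_selection {R : realType} (U : set_system nat) (S : set R) (P : R -> nat -> set nat) :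
  ProperFilter U -> \oo `<=` U -> countable S ->
  (forall t k, S t -> \forall n \near U, P t k n) ->
  exists phi : nat -> nat, increasing_seq phi /\
    forall t, S t -> \forall k \near \oo, P t k (phi k).
Proof.
move=> UU oU /countable_injP[e einj] PU.
have /choice[tt ttP] : forall i : nat, exists t, (exists2 t', S t' & e t' = i) -> S t /\ e t = i.
  move=> i; have [[t' St' ti]|nt] := pselect (exists2 t', S t' & e t' = i); last by exists 0.
  by exists t'.
have [|phi [phi1 phi2]] := @subsequence_of_near U
   (fun k => [set n | forall i : 'I_k.+1, (exists2 t', S t' & e t' = i) -> P (tt i) k n]) UU oU.
  move=> k; apply: filter_forall => i.
  have [h|nh] := pselect (exists2 t', S t' & e t' = i); last by apply: nearW.
  by have [St _] := ttP _ h; apply: filterS (PU _ k St).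
exists phi; split => // t St; exists (e t) => // k /= ek.
have [|St' ett] := ttP (e t); first by exists t.
have <- : tt (e t) = t by apply: einj => //; exact: mem_set.
by apply: (phi2 k (Ordinal (n := k.+1) ek)); exists t.
Qed.

End selection.

(** * Helly selection *)

Section limit_curve.
Context {R : realType} {V : completeNormedModType R} (Psi : V -> R) (T : R).
Context (D : set V) (En : R -> V -> R).
Hypothesis Psi_potential : dissipation_potential Psi.
Hypothesis En_admissible : admissible_energy Psi T D En.
Variables (E C : R) (y w : nat -> R -> V) (A : nat -> R -> R) (dd : nat -> R).
Hypothesis E0 : 0 < E.
Hypothesis ywA : forall n, controlled Psi T D En E (y n) (w n) (A n).
Hypothesis yw : forall n (s : R), s \in `[0, T] -> `|y n s - w n s| <= dd n.
Hypothesis dd0 : dd n @[n --> \oo] --> (0 : R).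
Hypothesis A0 : forall n, A n 0 = 0.
Hypothesis AC : forall n, A n T <= C.

Lemma control_nondecreasing n (r s : R) : 0 <= r -> r <= s -> s <= T -> A n r <= A n s.
Proof.
move=> r0; rewrite le_eqVlt => /predU1P[->//|rs] sT.
have := ctl_Psi (ywA n) r0 rs sT; have := dp_ge0 Psi_potential (y n s - y n r); lra.
Qed.

(** The curves [w n] live in a compact set, and the [y n] are uniformly close to
them. *)
Lemma controlled_compact I (U : set_system I) (UU : UltraFilter U) (n : I -> nat) (s : I -> R) :
  dd (n i) @[i --> U] --> (0 : R) -> (\forall i \near U, s i \in `[0, T]) ->
  exists2 p, sublevel Psi T D En E p &
    y (n i) (s i) @[i --> U] --> p /\ w (n i) (s i) @[i --> U] --> p.
Proof.
move=> ddn sT.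
have [|p Kp wp] := @ultra_compact_cvg V I U (fun i => w (n i) (s i)) _ UU (en_compact En_admissible E0).
  by apply: filterS sT => i; exact: (ctl_sublevel (ywA (n i))).
have d0 : y (n i) (s i) - w (n i) (s i) @[i --> U] --> (0 : V).
  apply/cvgr0Pnorm_lt => e e0; near=> i.
  have si : s i \in `[0, T] by near: i.
  apply: (le_lt_trans (yw (n i) si)).
  by near: i; move/cvgr_lt : ddn; exact.
exists p => //; split => //.
have h : (y (n i) (s i) - w (n i) (s i)) + w (n i) (s i) @[i --> U] --> 0 + p by exact: cvgD.
rewrite add0r in h; apply: cvg_trans h; apply: near_eq_cvg.
by apply: nearW => i; rewrite subrK.
Unshelve. all: by end_near. Qed.

Lemma increasing_cvg_oo (phi : nat -> nat) : increasing_seq phi -> phi k @[k --> \oo] --> \oo.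
Proof.
move=> /increasing_seqP ph; have ge k : (k <= phi k)%N.
  by elim: k => // k ih; exact: leq_ltn_trans ih (ph k).
by move=> B [N _ NB]; exists N => // k /= Nk; apply: NB; exact: leq_trans (ge k).
Qed.

(** The limits are first taken along an ultrafilter, at all times.  A subsequence
is then selected so as to realise them on the countable set [S].  At another
time [t] the control squeezes [A], and a limit point of the curves at [t] is
identified by comparison with nearby times of [S]: its [Psi]-distance to the
limit of the values there is zero. *)
Theorem helly_selection : exists (phi : nat -> nat) (G : R -> R) (x : R -> V),
  [/\ increasing_seq phi,
      forall t : R, t \in `[0, T] -> A (phi k) t @[k --> \oo] --> G t &
      forall t : R, t \in `[0, T] -> y (phi k) t @[k --> \oo] --> x t].
Proof.
have [U [UU oU]] := @ultraFilterLemma _ \oo _.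
have /choice[G GP] : forall t : R, exists l : R, t \in `[0, T] -> A n t @[n --> U] --> l.
  move=> t; have [tT|nt] := pselect (t \in `[0, T]); last by exists 0.
  have [|l Al] := @bounded_ultra_cvg R nat U _ (A ^~ t) C UU; last by exists l.
  apply: nearW => n; move: tT; rewrite in_itv/= => /andP[t0 tT].
  rewrite ger0_norm; first exact: le_trans (control_nondecreasing n t0 tT (lexx _)) (AC n).
  by rewrite -(A0 n); exact: control_nondecreasing.
have /choice[x xP] : forall t : R, exists p : V, t \in `[0, T] ->
    sublevel Psi T D En E p /\ y n t @[n --> U] --> p.
  move=> t; have [tT|nt] := pselect (t \in `[0, T]); last by exists 0.
  have [||p Kp [yp _]] := @controlled_compact _ U UU id (fun=> t); last by exists p.
    exact: ultra_le oU _ _ _ dd0.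
  exact: nearW.
have inT (t : R) : 0 <= t -> t <= T -> t \in `[0, T] by move=> *; rewrite in_itv/=; apply/andP.
have Gnd (r s : R) : 0 <= r -> r <= s -> s <= T -> G r <= G s.
  move=> r0 rs sT; apply: (ler_limit (GP r _) (GP s _)).
  - by apply: inT => //; exact: le_trans sT.
  - by apply: inT => //; exact: le_trans rs.
  - by apply: nearW => n; exact: control_nondecreasing.
have [S [cS S0 ST SQ Scont]] := nondecreasing_continuity_points Gnd.
pose P (t : R) (k : nat) : set nat := [set n | t \in `[0, T] ->
  `|A n t - G t| < k.+1%:R^-1 /\ `|y n t - x t| < k.+1%:R^-1].
have [|phi [iphi phiP]] := @diagonal_selection R U S P _ oU cS.
  move=> t k _; have [tT|nt] := pselect (t \in `[0, T]); last by apply: nearW.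
  have k0 : (0 : R) < k.+1%:R^-1 by rewrite invr_gt0.
  near=> n => _; split; rewrite distrC.
    by near: n; move/cvgrPdist_lt : (GP t tT); exact.
  by near: n; move/cvgrPdist_lt : (xP t tT).2; exact.
have phioo := increasing_cvg_oo iphi.
have ASG (t : R) : S t -> t \in `[0, T] -> A (phi k) t @[k --> \oo] --> G t.
  move=> St tT; apply/cvgrPdist_lt => e e0; near=> k.
  have [|h _] : P t k (phi k) by near: k; exact: phiP.
    exact: tT.
  rewrite distrC; apply: (lt_trans h).
  by near: k; exact: (near_infty_natSinv_lt (PosNum e0)).
have YSx (t : R) : S t -> t \in `[0, T] -> y (phi k) t @[k --> \oo] --> x t.
  move=> St tT; apply/cvgrPdist_lt => e e0; near=> k.
  have [|_ h] : P t k (phi k) by near: k; exact: phiP.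
    exact: tT.
  rewrite distrC; apply: (lt_trans h).
  by near: k; exact: (near_infty_natSinv_lt (PosNum e0)).
have between (t e : R) : t \in `[0, T] -> ~ S t -> 0 < e -> exists p q : R,
    [/\ S p, S q, 0 <= p < t, t < q <= T & G q - G p < e].
  move=> tT nS e0; have := Scont t tT nS e e0 => /filter_ex h.
  near (0:R)^'+ => d.
  have [d1 d2 d3] : [/\ 0 <= t - d, t + d <= T & G (t + d) - G (t - d) < e].
    by near: d; exact: Scont.
  have d0 : 0 < d by near: d; exact: nbhs_right_gt.
  have [p] := @rat_in_itvoo _ (t - d) t ltac:(by rewrite ltrBlDr ltrDl).
  rewrite in_itv/= => /andP[p1 p2].
  have [q] := @rat_in_itvoo _ t (t + d) ltac:(by rewrite ltrDl).
  rewrite in_itv/= => /andP[q1 q2].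
  exists (ratr p), (ratr q); split => //.
  - by rewrite p2 andbT; apply: le_trans d1 (ltW p1).
  - by rewrite q1; apply: le_trans (ltW q2) d2.
  have := Gnd (t - d) (ratr p) d1 (ltW p1) ltac:(lra).
  have := Gnd (ratr q) (t + d) ltac:(lra) (ltW q2) d2; lra.
have AG (t : R) : t \in `[0, T] -> A (phi k) t @[k --> \oo] --> G t.
  move=> tT;have [/ASG|nS] := pselect (S t); first exact.
  apply/cvgrPdist_lt => e e0.
  have [p [q [Sp Sq /andP[p0 pt] /andP[tq qT] Gpq]]] := between t _ tT nS (divr_gt0 e0 (ltr0n R 2)).
  have pT : p \in `[0, T] by apply: inT => //; lra.
  have qT' : q \in `[0, T] by apply: inT => //; lra.
  near=> k.
  have hp : `|G p - A (phi k) p| < e / 2.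
    by near: k; move/cvgrPdist_lt : (ASG p Sp pT); apply; rewrite divr_gt0.
  have hq : `|G q - A (phi k) q| < e / 2.
    by near: k; move/cvgrPdist_lt : (ASG q Sq qT'); apply; rewrite divr_gt0.
  have a1 := @control_nondecreasing (phi k) p t p0 (ltW pt) ltac:(lra).
  have t0 : 0 <= t by lra.
  have a2 := @control_nondecreasing (phi k) t q t0 (ltW tq) qT.
  have g1 := Gnd p t p0 (ltW pt) ltac:(lra).
  have g2 := Gnd t q t0 (ltW tq) qT.
  move: hp hq; rewrite !ltr_norml => /andP[? ?] /andP[? ?]; apply/andP; split; lra.
exists phi, G, x; split => // t tT.
have [/YSx|nS] := pselect (S t); first exact.
apply: cvg_ultraP => W UW oW.
have ddphi : dd (phi k) @[k --> W] --> (0 : R).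
  by apply: (ultra_le oW); apply: cvg_comp phioo dd0.
have [|z Kz [yz _]] := @controlled_compact _ W UW phi (fun=> t) ddphi; first exact: nearW.
suff <- : z = x t by [].
have /choice[p pP] : forall j : nat, exists p : R, [/\ S p, 0 <= p < t & G t - G p < j.+1%:R^-1].
  move=> j; have [|p [q [Sp Sq pt /andP[tq qT] Gpq]]] := between t j.+1%:R^-1 tT nS.
    by rewrite invr_gt0.
  exists p; split => //; move: pt => /andP[p0 pt].
  have t0 : 0 <= t by lra.
  by apply: le_lt_trans Gpq; rewrite lerD2r; exact: Gnd t0 (ltW tq) qT.
have pT j : p j \in `[0, T].
  have [_ /andP[p0 pt] _] := pP j; move: tT; rewrite !in_itv/= => /andP[_ tT].
  by apply/andP; split => //; lra.
have [|l Kl xl] := @ultra_compact_cvg V nat U (x \o p) _ UU (en_compact En_admissible E0).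
  by apply: nearW => j; exact: (xP _ (pT j)).1.
have Gp0 : G t - G (p j) @[j --> U] --> (0 : R).
  apply: (ultra_le oU); apply/cvgr0Pnorm_lt => e e0; near=> j.
  have [_ /andP[p0 pt] Gj] := pP j.
  have := Gnd (p j) t p0 (ltW pt) ltac:(by move: tT; rewrite in_itv/= => /andP[]).
  rewrite -subr_ge0 => h; rewrite ger0_norm//; apply: (lt_trans Gj).
  by near: j; exact: (near_infty_natSinv_lt (PosNum e0)).
have le_of (v : V) : (forall j, Psi (v - x (p j)) <= G t - G (p j)) -> v = l.
  move=> h; apply: (potential_sub_eq0 Psi_potential).
  have c1 : Psi (v - x (p j)) @[j --> U] --> Psi (v - l).
    apply: continuous_cvg; first exact: (dp_cont Psi_potential).
    by apply: cvgB => //; exact: cvg_cst.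
  by apply: (ler_limit c1 Gp0); exact: nearW.
have tT' : t <= T by move: tT; rewrite in_itv/= => /andP[].
have xtl : x t = l.
  apply: le_of => j; have [Sp /andP[p0 pt] _] := pP j.
  have c1 : Psi (y n t - y n (p j)) @[n --> U] --> Psi (x t - x (p j)).
    apply: continuous_cvg; first exact: (dp_cont Psi_potential).
    by apply: cvgB; [exact: (xP t tT).2|exact: (xP _ (pT j)).2].
  have c2 : A n t - A n (p j) @[n --> U] --> G t - G (p j).
    by apply: cvgB; exact: GP.
  by apply: (ler_limit c1 c2); apply: nearW => n; exact: (ctl_Psi (ywA n)).
rewrite xtl; apply: le_of => j; have [Sp /andP[p0 pt] _] := pP j.
have c1 : Psi (y (phi n) t - y (phi n) (p j)) @[n --> W] --> Psi (z - x (p j)).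
  apply: continuous_cvg; first exact: (dp_cont Psi_potential).
  by apply: cvgB => //; apply: (ultra_le oW); exact: YSx.
have c2 : A (phi n) t - A (phi n) (p j) @[n --> W] --> G t - G (p j).
  by apply: cvgB; apply: (ultra_le oW); [exact: AG|exact: AG].
by apply: (ler_limit c1 c2); apply: nearW => n; exact: (ctl_Psi (ywA (phi n))).
Unshelve. all: by end_near. Qed.

End limit_curve.

(** * Jumps and local stability of the limit curve *)

Section jumps_and_stability.
Context {R : realType} {V : completeNormedModType R} (Psi : V -> R) (T : R).
Context (D : set V) (En : R -> V -> R).
Local Notation gap := (stability_gap Psi D En).
Hypothesis V_RNP : radon_nikodym_property V.
Hypothesis T_gt0 : 0 < T.
Hypothesis Psi_potential : dissipation_potential Psi.
Hypothesis Psi_homogeneous : positively_homogeneous Psi.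
Hypothesis En_admissible : admissible_energy Psi T D En.
Variables (E : R) (y w : nat -> R -> V) (A : nat -> R -> R) (dd : nat -> R).
Hypothesis E0 : 0 < E.
Hypothesis ywA : forall n, controlled Psi T D En E (y n) (w n) (A n).
Hypothesis yw : forall n (s : R), s \in `[0, T] -> `|y n s - w n s| <= dd n.
Hypothesis dd0 : dd n @[n --> \oo] --> (0 : R).
Variables (G : R -> R) (x : R -> V).
Hypothesis AG : forall t : R, t \in `[0, T] -> A n t @[n --> \oo] --> G t.
Hypothesis yx : forall t : R, t \in `[0, T] -> y n t @[n --> \oo] --> x t.

Let inT (t : R) : 0 <= t -> t <= T -> t \in `[0, T].
Proof. by move=> *; rewrite in_itv/=; apply/andP. Qed.

Lemma limit_control (r s : R) : 0 <= r -> r < s -> s <= T -> Psi (x s - x r) <= G s - G r.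
Proof.
move=> r0 rs sT.
have rT : r \in `[0, T] by apply: inT => //; lra.
have sT' : s \in `[0, T] by apply: inT => //; lra.
have c1 : Psi (y n s - y n r) @[n --> \oo] --> Psi (x s - x r).
  apply: continuous_cvg; first exact: (dp_cont Psi_potential).
  by apply: cvgB; exact: yx.
have c2 : A n s - A n r @[n --> \oo] --> G s - G r by apply: cvgB; exact: AG.
by apply: (ler_limit c1 c2); apply: nearW => n; exact: (ctl_Psi (ywA n)).
Qed.

Lemma limit_nondecreasing (r s : R) : 0 <= r -> r <= s -> s <= T -> G r <= G s.
Proof.
move=> r0; rewrite le_eqVlt => /predU1P[->//|rs] sT.
have := limit_control r0 rs sT; have := dp_ge0 Psi_potential (x s - x r); lra.
Qed.

Lemma limit_sublevel (t : R) : t \in `[0, T] -> sublevel Psi T D En E (x t).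
Proof.
move=> tT; have [U [UU oU]] := @ultraFilterLemma _ \oo _.
have [||p Kp [yp _]] := controlled_compact En_admissible E0 ywA yw UU (n := id) (s := fun=> t).
- exact: (ultra_le oU) dd0.
- exact: nearW.
suff -> : x t = p by [].
apply/esym; apply: (@cvg_unique _ (@norm_hausdorff _ V) _ _ _ _ yp).
by apply: (ultra_le oU); exact: yx.
Qed.

(** Two limit points of [x] along [F] are at zero wedge distance, because [G] is
Cauchy along [F]. *)
Lemma limit_cvg (F : set_system R) (L : R) : ProperFilter F ->
  (\forall s \near F, s \in `[0, T]) -> G s @[s --> F] --> L -> cvg (x s @[s --> F]).
Proof.
move=> FF nT GL.
have nK : \forall s \near F, sublevel Psi T D En E (x s) by apply: filterS nT; exact: limit_sublevel.
have cK := en_compact En_admissible E0.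
have [W0 [UW0 FW0]] := ultraFilterLemma FF.
have [l Kl xl] := ultra_compact_cvg UW0 cK (FW0 _ nK).
apply/cvg_ex; exists l; apply: cvg_ultraP => W UW FW.
have [m Km xm] := ultra_compact_cvg UW cK (FW _ nK).
suff <- : m = l by [].
have cw := Psi_wedge_continuous Psi_potential.
apply: (Psi_wedge_sub_eq0 Psi_potential).
have h1 r : r \in `[0, T] -> Psi_wedge Psi (m - x r) <= `|L - G r|.
  move=> rT.
  have c1 : Psi_wedge Psi (x s - x r) @[s --> W] --> Psi_wedge Psi (m - x r).
    by apply: continuous_cvg; [exact: cw|apply: cvgB => //; exact: cvg_cst].
  have c2 : `|G s - G r| @[s --> W] --> `|L - G r|.
    by apply: cvg_norm; apply: cvgB; [exact: (ultra_le FW)|exact: cvg_cst].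
  apply: (ler_limit c1 c2); apply: (FW); apply: filterS nT => s sT.
  exact: (controls_wedge Psi_potential Psi_homogeneous limit_control).
have c2 : Psi_wedge Psi (m - x r) @[r --> W0] --> Psi_wedge Psi (m - l).
  by apply: continuous_cvg; [exact: cw|apply: cvgB => //; exact: cvg_cst].
have c3 : `|L - G r| @[r --> W0] --> `|L - L|.
  by apply: cvg_norm; apply: cvgB; [exact: cvg_cst|exact: (ultra_le FW0)].
rewrite subrr normr0 in c3; apply: (ler_limit c2 c3).
by apply: FW0; apply: filterS nT; exact: h1.
Qed.

Let near_left (t : R) : 0 < t -> t <= T -> \forall s \near t^'-, [/\ 0 <= s, s < t & s \in `[0, T]].
Proof.
move=> t0 tT; near=> s; have s0 : 0 <= s by near: s; exact: nbhs_left_ge.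
have st : s < t by near: s; exact: nbhs_left_lt.
by split => //; apply: inT => //; lra.
Unshelve. all: by end_near. Qed.

Let near_right (t : R) : 0 <= t -> t < T -> \forall s \near t^'+, [/\ t < s, s <= T & s \in `[0, T]].
Proof.
move=> t0 tT; near=> s; have st : t < s by near: s; exact: nbhs_right_gt.
have sT : s <= T by near: s; exact: nbhs_right_le.
by split => //; apply: inT => //; lra.
Unshelve. all: by end_near. Qed.

Lemma limit_cvg_left (t : R) : 0 < t -> t <= T -> x s @[s --> t^'-] --> left_lim x t.
Proof.
move=> t0 tT; have [L [GL _ _]] := nondecreasing_left_limit limit_nondecreasing t0 tT.
rewrite /left_lim t0; apply: limit_cvg GL.
by apply: filterS (near_left t0 tT) => s [].
Qed.

Lemma limit_cvg_right (t : R) : 0 <= t -> t < T -> x s @[s --> t^'+] --> right_lim T x t.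
Proof.
move=> t0 tT; have [L [GL _ _]] := nondecreasing_right_limit limit_nondecreasing t0 tT.
rewrite /right_lim tT; apply: limit_cvg GL.
by apply: filterS (near_right t0 tT) => s [].
Qed.

(** [rescaled_transition_cost] along an ultrafilter finer than the iterated filter:
first [n] grows with [s] fixed, then the intervals shrink to [t]. *)
Lemma shrinking_interval_cost (F : set_system R) (a b : R -> R) (t L : R) (x0 x1 : V) :
  ProperFilter F -> t \in `[0, T] ->
  (\forall s \near F, [/\ 0 <= a s, a s < b s & b s <= T]) ->
  a s @[s --> F] --> t -> b s @[s --> F] --> t ->
  x (a s) @[s --> F] --> x0 -> x (b s) @[s --> F] --> x1 ->
  G (b s) - G (a s) @[s --> F] --> L ->
  (finsler_cost Psi T D En t x0 x1 <= L%:E)%E.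
Proof.
move=> FF tT nab at_ bt xa xb GL.
have PF : ProperFilter (iterated F \oo) by exact: iterated_proper.
have [W [UW FW]] := ultraFilterLemma PF.
have sW : p.1 @[p --> W] `=>` F by exact: iterated_fst FW.
have nW : p.2 @[p --> W] --> \oo by exact: iterated_snd FW.
have nabT : \forall s \near F, a s \in `[0, T] /\ b s \in `[0, T].
  by apply: filterS nab => s [a0 ab bT]; split; apply: inT => //; lra.
apply: (@rescaled_transition_cost _ _ _ _ _ _ V_RNP Psi_potential Psi_homogeneous En_admissible
  (R * nat)%type W UW E L t (fun p => y p.2) (fun p => w p.2) (fun p => A p.2)
  (a \o fst) (b \o fst) (fun p => dd p.2) x0 x1 E0 tT).
- by move=> p; exact: ywA.
- by move=> p s; exact: yw.
- exact: cvg_comp nW dd0.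
- exact: (sW _ nab).
- exact: (cvg_comp _ _ sW at_).
- exact: (cvg_comp _ _ sW bt).
- apply: (ultra_le FW); apply: (@iterated_cvg _ _ _ _ R V _ (x \o a)) => //.
  by apply: filterS nabT => s [aT _]; exact: yx.
- apply: (ultra_le FW); apply: (@iterated_cvg _ _ _ _ R V _ (x \o b)) => //.
  by apply: filterS nabT => s [_ bT]; exact: yx.
apply: (ultra_le FW); apply: (@iterated_cvg _ _ _ _ R R^o _ (fun s => G (b s) - G (a s))) => //.
by apply: filterS nabT => s [aT bT]; apply: cvgB; exact: AG.
Qed.

Lemma left_jump_cost (t L : R) : 0 < t -> t <= T -> G s @[s --> t^'-] --> L ->
  (finsler_cost Psi T D En t (left_lim x t) (x t) <= (G t - L)%:E)%E.
Proof.
move=> t0 tT GL.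
apply: (shrinking_interval_cost (F := t^'-) (a := id) (b := fun=> t)).
- exact: inT (ltW t0) tT.
- by apply: filterS (near_left t0 tT) => s [].
- exact: cvg_within.
- exact: cvg_cst.
- exact: limit_cvg_left.
- exact: cvg_cst.
- by apply: cvgB => //; exact: cvg_cst.
Qed.

Lemma right_jump_cost (t L : R) : 0 <= t -> t < T -> G s @[s --> t^'+] --> L ->
  (finsler_cost Psi T D En t (x t) (right_lim T x t) <= (L - G t)%:E)%E.
Proof.
move=> t0 tT GL.
apply: (shrinking_interval_cost (F := t^'+) (a := fun=> t) (b := id)).
- exact: inT t0 (ltW tT).
- by apply: filterS (near_right t0 tT) => s [].
- exact: cvg_cst.
- exact: cvg_within.
- exact: cvg_cst.
- exact: limit_cvg_right.
- by apply: cvgB => //; exact: cvg_cst.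
Qed.

Section stability.
Variables (C : R) (eps : nat -> R).
Hypothesis eps_gt0 : forall n, 0 < eps n.
Hypothesis eps0 : eps n @[n --> \oo] --> (0 : R).
Hypothesis AC : forall n, A n T - A n 0 <= C.
Hypothesis blowup : forall c : R, 0 < c -> exists2 k : R, 0 < k &
  forall n (r s : R), 0 <= r -> r < s -> s <= T ->
    (forall t : R, t \in `[r, s] -> (c%:E < gap t (w n t))%E) ->
    k / eps n * (s - r) <= A n s - A n r.

(** Suppose the gap is larger than [c > 0] at [t].  At a continuity point of [G] the
curves hardly move near [t], so by semicontinuity the gap exceeds [c] on a fixed
interval around [t] along [w n] for large [n].  Then the dissipation on this
interval is at least [k / eps n] times its length, which is unbounded. *)
Lemma stable_at_continuity_point (t : R) : t \in `[0, T] ->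
  (forall e : R, 0 < e ->
    \forall d \near 0^'+, [/\ 0 <= t - d, t + d <= T & G (t + d) - G (t - d) < e]) ->
  (gap t (x t) <= 0)%E.
Proof.
move=> tT Gcont; rewrite leNgt; apply/negP => gt.
have [c c0 ct] : exists2 c : R, 0 < c & (c%:E < gap t (x t))%E.
  case Eg : (gap t (x t)) gt => [g| |]//; last by exists 1; rewrite ?ltry.
  by rewrite lte_fin => g0; exists (g / 2); rewrite ?lte_fin ?divr_gt0// ltr_pdivrMr// mulr2n mulrDr mulr1 ltrDl.
have nd : \forall d \near (0 : R)^'+, [/\ 0 < d, 0 <= t - d & t + d <= T].
  near=> d; have [] : [/\ 0 <= t - d, t + d <= T & G (t + d) - G (t - d) < 1].
    by near: d; apply: Gcont.
  by split => //; near: d; exact: nbhs_right_gt.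
pose F := iterated (0 : R)^'+ \oo.
have FF : ProperFilter F by exact: iterated_proper.
pose B : set (R * nat) := [set p | forall s : R, s \in `[t - p.1, t + p.1] -> (c%:E < gap s (w p.2 s))%E].
have FB : F B.
  apply: near_ultraP => W UW FW.
  have [//|nB] := in_ultra_setVsetC B UW; exfalso.
  have /choice[sg sgP] : forall p : R * nat, exists s : R, (~` B) p ->
      s \in `[t - p.1, t + p.1] /\ (gap s (w p.2 s) <= c%:E)%E.
    move=> p; have [Bp|nBp] := pselect (B p); first by exists 0.
    apply: contrapT => nex; apply: nBp => s sP; rewrite ltNge; apply/negP => h.
    by apply: nex; exists s.
  have dW : p.1 @[p --> W] --> (0 : R)^'+ by exact: iterated_fst FW.
  have nW : p.2 @[p --> W] --> \oo by exact: iterated_snd FW.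
  have ndW : \forall p \near W, [/\ 0 < p.1, 0 <= t - p.1 & t + p.1 <= T] by exact: (dW _ nd).
  have sgT : \forall p \near W, [/\ t - p.1 <= sg p, sg p <= t + p.1, sg p \in `[0, T] &
      (gap (sg p) (w p.2 (sg p)) <= c%:E)%E].
    apply: filterS2 ndW nB => p [p0 p1 p2] /sgP[+ gp]; rewrite in_itv/= => /andP[h1 h2].
    by split => //; apply: inT; [exact: le_trans h1|exact: le_trans p2].
  have d0 : p.1 @[p --> W] --> (0 : R) by apply: cvg_trans dW _; exact: cvg_within.
  have ct1 : t - p.1 @[p --> W] --> t.
    by rewrite -[X in _ --> X]subr0; apply: cvgB => //; exact: cvg_cst.
  have ct2 : t + p.1 @[p --> W] --> t.
    by rewrite -[X in _ --> X]addr0; apply: cvgD => //; exact: cvg_cst.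
  have sgt : sg p @[p --> W] --> t.
    by apply: (squeeze_cvgr _ ct1 ct2); apply: filterS sgT => p [-> -> _ _].
  have ddW : dd p.2 @[p --> W] --> (0 : R) by exact: cvg_comp nW dd0.
  have [|q Kq [yq wq]] := controlled_compact En_admissible E0 ywA yw UW (s := sg) ddW.
    by apply: filterS sgT => p [].
  have e0 : A p.2 (t + p.1) - A p.2 (t - p.1) @[p --> W] --> (0 : R).
    apply: (ultra_le FW); apply: (@iterated_cvg _ _ _ _ R R^o _ (fun d => G (t + d) - G (t - d))) => //.
      apply: filterS nd => d [p0 p1 p2]; apply: cvgB; apply: AG; apply: inT; lra.
    apply/cvgr0Pnorm_lt => e e0; near=> d.
    have [h1 h2 h3] : [/\ 0 <= t - d, t + d <= T & G (t + d) - G (t - d) < e].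
      by near: d; apply: Gcont.
    have h4 : 0 < d by near: d; exact: nbhs_right_gt.
    have := @limit_nondecreasing (t - d) (t + d) h1 ltac:(lra) h2; rewrite -subr_ge0 => h5.
    by rewrite ger0_norm.
  have xt : y p.2 t @[p --> W] --> x t by exact: (cvg_comp _ _ nW (yx tT)).
  have ysg : y p.2 (sg p) @[p --> W] --> x t.
    apply: (@Psi_squeeze _ _ _ Psi_potential _ W UW _ (fun p => y p.2 (sg p)) (fun p => w p.2 (sg p))
      (fun p => y p.2 t) _ _ (en_compact En_admissible E0) _ _ xt e0).
    - by apply: filterS sgT => p [_ _ sT _]; exact: (ctl_sublevel (ywA p.2)).
    - by rewrite -(subrr q); exact: cvgB.
    apply: filterS2 ndW sgT => p [p0 p1 p2] [h1 h2 sT _].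
    apply: le_trans (controls_wedge Psi_potential Psi_homogeneous (ctl_Psi (ywA p.2)) tT sT) _.
    have mono := @control_nondecreasing _ _ _ _ _ _ Psi_potential _ _ _ _ ywA p.2.
    have h3 := mono (t - p.1) (sg p) p1 h1 ltac:(lra).
    have h4 := mono (sg p) (t + p.1) ltac:(lra) h2 p2.
    have h5 := mono (t - p.1) t p1 ltac:(lra) ltac:(lra).
    have h6 := mono t (t + p.1) ltac:(lra) ltac:(lra) p2.
    by rewrite ler_norml; apply/andP; split; lra.
  have wsg : w p.2 (sg p) @[p --> W] --> x t.
    by rewrite (@cvg_unique _ (@norm_hausdorff _ V) _ _ _ _ ysg yq).
  have : (gap t (x t) <= c%:E)%E.
    apply: (gap_lsc Psi_potential Psi_homogeneous En_admissible UW E0 (ltW c0) tT (limit_sublevel tT) sgt wsg).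
      by apply: filterS sgT => p [_ _ sT _]; split => //; exact: (ctl_sublevel (ywA p.2)).
    by apply: filterS sgT => p [].
  by rewrite leNgt ct.
have [k k0 kP] := blowup c0.
near (0 : R)^'+ => d.
have [d0 d1 d2] : [/\ 0 < d, 0 <= t - d & t + d <= T] by near: d.
have Bd : \forall n \near \oo, B (d, n) by near: d; exact: FB.
have C1 : 0 < `|C| + 1 by rewrite ltr_wpDl.
near \oo => n.
have Bn : B (d, n) by near: n.
have en : eps n < k * (2 * d) / (`|C| + 1).
  by near: n; move/cvgr_lt : eps0; apply; rewrite divr_gt0// mulr_gt0// mulr_gt0.
have := kP n (t - d) (t + d) d1 ltac:(lra) d2 Bn.
have mono := control_nondecreasing Psi_potential ywA.
have := mono n 0 (t - d) (lexx _) d1 ltac:(lra).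
have := mono n (t + d) T ltac:(lra) d2 (lexx _).
have := AC n; have := ler_norm C => a1 a2 a3 a4 a5.
have : k * (2 * d) / eps n <= C.
  have -> : k * (2 * d) / eps n = k / eps n * (t + d - (t - d)).
    by rewrite mulrAC; congr (_ * _); lra.
  lra.
rewrite ler_pdivrMr// => h.
move: en; rewrite ltr_pdivlMr// mulrC => en.
have : C * eps n <= `|C| * eps n by rewrite ler_wpM2r// ltW.
have := eps_gt0 n; rewrite mulrDl mul1r in en; lra.
Unshelve. all: by end_near. Qed.

(** Off the jump set [t] is approached by continuity points of [G] at which [x]
tends to [x t]; from the left if [t > 0], and from the right if [t = 0]. *)
Lemma stable_off_jumps (t : R) : t \in `[0, T] -> ~ jump_set T x t ->
  locally_stable Psi D En t (x t).
Proof.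
move=> tT nJ; apply: (gap_eq0_locally_stable Psi_potential Psi_homogeneous En_admissible E0 tT (limit_sublevel tT)).
have [S [cS S0 ST SQ Scont]] := nondecreasing_continuity_points limit_nondecreasing.
have lt : left_lim x t = x t by apply: contrapT => h; apply: nJ; split => //; left.
have rt : x t = right_lim T x t by apply: contrapT => h; apply: nJ; split => //; right.
have [t0 tT'] : 0 <= t /\ t <= T by move: tT; rewrite in_itv/= => /andP[].
have [F [FF Ft xF FT FS]] : exists F : set_system R, [/\ ProperFilter F, F --> t,
    x s @[s --> F] --> x t, \forall s \near F, s \in `[0, T] &
    forall B, F B -> exists2 s, B s & ~ S s].
  have [t00|t0'] := ltP 0 t.
    exists t^'-; split; [exact: at_left_proper_filter|exact: cvg_within|
      by rewrite -[X in _ --> X]lt; exact: limit_cvg_left|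
      by apply: filterS (near_left t00 tT') => s []|].
    move=> B /nbhs_ballP[d /= d0 dB].
    have [|s] := @countable_compl_dense _ S (t - d) t cS; first by rewrite ltrBlDr ltrDl.
    rewrite in_itv/= => /andP[s1 s2] nS; exists s => //; apply: dB => //.
    by rewrite -ball_normE /= gtr0_norm ?subr_gt0// ltrBlDr addrC -ltrBlDr.
  have tT0 : t < T by rewrite (le_lt_trans t0').
  exists t^'+; split; [exact: at_right_proper_filter|exact: cvg_within|
    by rewrite [X in _ --> X]rt; exact: limit_cvg_right|
    by apply: filterS (near_right t0 tT0) => s []|].
  move=> B /nbhs_ballP[d /= d0 dB].
  have [|s] := @countable_compl_dense _ S t (t + d) cS; first by rewrite ltrDl.
  rewrite in_itv/= => /andP[s1 s2] nS; exists s => //; apply: dB => //.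
  by rewrite -ball_normE /= distrC gtr0_norm ?subr_gt0// ltrBlDl.
have PF : ProperFilter (within (~` S) F).
  by apply: Build_ProperFilter_ex => B /FS[s sB nS]; exists s; exact: sB.
have [W [UW FW]] := ultraFilterLemma PF.
have FW' : F `<=` W by move=> B FB; apply: FW; apply: filterS FB => s.
apply: (gap_lsc Psi_potential Psi_homogeneous En_admissible UW E0 (lexx 0) tT (limit_sublevel tT)
  (s := id) (cvg_trans FW' Ft) (ultra_le FW' xF)).
  by apply: (FW'); apply: filterS FT => s sT; split => //; exact: limit_sublevel.
apply: FW; apply: filterS FT => s sT nS.
by apply: stable_at_continuity_point => //; exact: Scont.
Qed.

End stability.
End jumps_and_stability.

(** * Variation with corrected jumps *)

Section controlled_variation.
Context {R : realType} {V : completeNormedModType R} (Psi : V -> R).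
Hypothesis Psi_potential : dissipation_potential Psi.
Hypothesis Psi_homogeneous : positively_homogeneous Psi.
Variables (a b : R) (u : R -> V).

Lemma Psi_triangle (v0 v1 v2 : V) : Psi (v2 - v0) <= Psi (v2 - v1) + Psi (v1 - v0).
Proof.
have [pD _] := potential_sublinear Psi_potential Psi_homogeneous.
by have := pD (v2 - v1) (v1 - v0); rewrite addrA subrK.
Qed.

(** The increments of [H] telescope. *)
Lemma controls_variation (H : R -> R) (s : seq R) : controls Psi a b u H -> itv_partition a b s ->
  Psi_variation a b Psi u s <= H b - H a.
Proof.
move=> cH abs; have [ps _] := abs; rewrite /Psi_variation.
pose P n := nth b (a :: s) n.
have -> : H b - H a = \sum_(0 <= n < size s) (H (P n.+1) - H (P n)).
  by rewrite telescope_sumr// /P (itv_partition_nth_size _ abs).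
rewrite !big_nat; apply: ler_sum => n /= ns; apply: cH.
- by apply: itv_partition_nth_ge => //; exact: ltnW.
- by move/(pathP b) : ps; exact.
- exact: (@itv_partition_nth_le _ _ a b s n.+1).
Qed.

Lemma controls_left (H : R -> R) (i l : R) (ul : V) (r : R) : controls Psi a b u H ->
  a <= r -> r < i -> i <= b -> u s @[s --> i^'-] --> ul -> H s @[s --> i^'-] --> l ->
  Psi (ul - u r) <= l - H r.
Proof.
move=> cH ar ri ib cu cl.
have c1 : Psi (u s - u r) @[s --> i^'-] --> Psi (ul - u r).
  apply: continuous_cvg; first exact: (dp_cont Psi_potential).
  by apply: cvgB => //; exact: cvg_cst.
have c2 : H s - H r @[s --> i^'-] --> l - H r by apply: cvgB => //; exact: cvg_cst.
apply: (ler_limit c1 c2); near=> s.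
have rs : r < s by near: s; exact: nbhs_left_gt.
have si : s < i by near: s; exact: nbhs_left_lt.
exact: cH ar rs (le_trans (ltW si) ib).
Unshelve. all: by end_near. Qed.

Lemma controls_right (H : R -> R) (i l : R) (ur : V) (s : R) : controls Psi a b u H ->
  a <= i -> i < s -> s <= b -> u r @[r --> i^'+] --> ur -> H r @[r --> i^'+] --> l ->
  Psi (u s - ur) <= H s - l.
Proof.
move=> cH ai is_ sb cu cl.
have c1 : Psi (u s - u r) @[r --> i^'+] --> Psi (u s - ur).
  apply: continuous_cvg; first exact: (dp_cont Psi_potential).
  by apply: cvgB => //; exact: cvg_cst.
have c2 : H s - H r @[r --> i^'+] --> H s - l by apply: cvgB => //; exact: cvg_cst.
apply: (ler_limit c1 c2); near=> r.
have ir : i < r by near: r; exact: nbhs_right_gt.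
have rs : r < s by near: r; exact: nbhs_right_lt.
exact: cH (le_trans ai (ltW ir)) rs sb.
Unshelve. all: by end_near. Qed.

Lemma controls_both (H : R -> R) (l r : R) (ul ur : V) : controls Psi a b u H -> a < b ->
  u s @[s --> a^'+] --> ur -> H s @[s --> a^'+] --> r ->
  u s @[s --> b^'-] --> ul -> H s @[s --> b^'-] --> l -> Psi (ul - ur) <= l - r.
Proof.
move=> cH ab cur cr cul cl.
have c1 : Psi (u s - ur) @[s --> b^'-] --> Psi (ul - ur).
  apply: continuous_cvg; first exact: (dp_cont Psi_potential).
  by apply: cvgB => //; exact: cvg_cst.
have c2 : H s - r @[s --> b^'-] --> l - r by apply: cvgB => //; exact: cvg_cst.
apply: (ler_limit c1 c2); near=> s.
have as_ : a < s by near: s; exact: nbhs_left_gt.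
have sb : s < b by near: s; exact: nbhs_left_lt.
exact: (controls_right cH (lexx a) as_ (ltW sb) cur cr).
Unshelve. all: by end_near. Qed.

Variables (ul ur : R -> V).
Let jump i := Psi (u i - ul i) + Psi (ur i - u i).

(** The jump of [H] at [i] is replaced by that of [Psi], which is what the triangle
inequality requires of a control; the part after [i] is shifted accordingly. *)
Lemma controls_remove_jump (H : R -> R) (i l r : R) : controls Psi a b u H -> a < i -> i < b ->
  u s @[s --> i^'-] --> ul i -> u s @[s --> i^'+] --> ur i ->
  H s @[s --> i^'-] --> l -> H s @[s --> i^'+] --> r ->
  controls Psi a b u (fun t => if t < i then H t
    else if t == i then l + Psi (u i - ul i) else H t - (r - l - jump i)).
Proof.
move=> cH ai ib cul cur cl cr p q ap pq qb; rewrite /jump.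
have L p' : a <= p' -> p' < i -> Psi (ul i - u p') <= l - H p'.
  by move=> ap' pi; apply: (controls_left cH ap' pi (ltW ib)).
have Rr q' : i < q' -> q' <= b -> Psi (u q' - ur i) <= H q' - r.
  by move=> iq qb'; apply: (controls_right cH (ltW ai) iq qb').
have [qi|iq|qi] := ltgtP q i.
- by rewrite (lt_trans pq qi); exact: cH.
- have [pi|ip|pi] := ltgtP p i.
  + have := L p ap pi; have := Rr q iq qb.
    have := Psi_triangle (u p) (ul i) (u q); have := Psi_triangle (ul i) (u i) (u q).
    have := Psi_triangle (u i) (ur i) (u q); lra.
  + have := cH p q ap pq qb; lra.
  + have := Rr q iq qb; have := Psi_triangle (u i) (ur i) (u q); rewrite pi; lra.
- rewrite -qi pq; have := L p ap; rewrite -qi => /(_ pq).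
  have := Psi_triangle (u p) (ul q) (u q); lra.
Qed.

(** One jump is replaced at a time.  The shift leaves the jumps of [H] at the other
points unchanged, so the induction proceeds in any order. *)
Lemma variation_off_jumps (I : seq R) (H Hl Hr : R -> R) (s : seq R) : uniq I -> controls Psi a b u H ->
  (forall i, i \in I -> a < i < b) ->
  (forall i, i \in I -> u s @[s --> i^'-] --> ul i /\ u s @[s --> i^'+] --> ur i) ->
  (forall i, i \in I -> H s @[s --> i^'-] --> Hl i /\ H s @[s --> i^'+] --> Hr i) ->
  itv_partition a b s ->
  Psi_variation a b Psi u s <= H b - H a - \sum_(i <- I) (Hr i - Hl i - jump i).
Proof.
elim: I H Hl Hr => [|i I ih] H Hl Hr uI cH Iab cu cHl abs.
  by rewrite big_nil subr0; exact: controls_variation.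
have iI : i \in i :: I by rewrite inE eqxx.
have [cul cur] := cu i iI; have [cl cr] := cHl i iI; have /andP[ai ib] := Iab i iI.
move: uI => /= /andP[niI uI].
pose d := Hr i - Hl i - jump i.
pose H' t := if t < i then H t else if t == i then Hl i + Psi (u i - ul i) else H t - d.
pose Hl' j := if j < i then Hl j else Hl j - d.
pose Hr' j := if j < i then Hr j else Hr j - d.
have cH' : controls Psi a b u H' by exact: controls_remove_jump.
have sub j : j \in I -> j \in i :: I by rewrite inE => ->; rewrite orbT.
have := ih H' Hl' Hr' uI cH' (fun j jI => Iab j (sub j jI)) (fun j jI => cu j (sub j jI)).
have -> : H' b = H b - d by rewrite /H' ltNge (ltW ib)/= gt_eqF.
have -> : H' a = H a by rewrite /H' ai.
have -> : \sum_(j <- I) (Hr' j - Hl' j - jump j) = \sum_(j <- I) (Hr j - Hl j - jump j).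
  by apply: eq_bigr => j _; rewrite /Hr' /Hl'; case: ifP => // _; lra.
rewrite big_cons -/d => h; apply: (le_trans (h _ abs)); last by lra.
move=> j jI; have [cj1 cj2] := cHl j (sub j jI); rewrite /Hl' /Hr'.
have [ji|ij|ji] := ltgtP j i; last by move: niI; rewrite -ji jI.
- split.
    apply: cvg_trans cj1; apply: near_eq_cvg; near=> t; rewrite /H'.
    by rewrite (@lt_trans _ _ j)//; near: t; exact: nbhs_left_lt.
  apply: cvg_trans cj2; apply: near_eq_cvg; near=> t; rewrite /H'.
  suff -> : t < i by [].
  by near: t; exact: nbhs_right_lt.
- have c1 : H t - d @[t --> j^'-] --> Hl j - d by apply: cvgB => //; exact: cvg_cst.
  have c2 : H t - d @[t --> j^'+] --> Hr j - d by apply: cvgB => //; exact: cvg_cst.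
  split.
    apply: cvg_trans c1; apply: near_eq_cvg; near=> t; rewrite /H'.
    have it : i < t by near: t; exact: nbhs_left_gt.
    by rewrite ltNge (ltW it)/= gt_eqF.
  apply: cvg_trans c2; apply: near_eq_cvg; near=> t; rewrite /H'.
  have jt : j < t by near: t; exact: nbhs_right_gt.
  have it : i < t by exact: lt_trans jt.
  by rewrite ltNge (ltW it)/= gt_eqF.
Unshelve. all: by end_near. Qed.

(** The same replacement for the one-sided jumps at the end points. *)
Lemma controls_open (H : R -> R) (l r : R) : controls Psi a b u H -> a < b ->
  u s @[s --> a^'+] --> ur a -> H s @[s --> a^'+] --> r ->
  u s @[s --> b^'-] --> ul b -> H s @[s --> b^'-] --> l ->
  controls Psi a b u (fun t => if t == a then r - Psi (ur a - u a)
    else if t == b then l + Psi (u b - ul b) else H t).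
Proof.
move=> cH ab cur cr cul cl p q ap pq qb.
have both := controls_both cH ab cur cr cul cl.
have Rr s : a < s -> s <= b -> Psi (u s - ur a) <= H s - r.
  by move=> as_ sb; apply: (controls_right cH (lexx a) as_ sb).
have L s : a <= s -> s < b -> Psi (ul b - u s) <= l - H s.
  by move=> as_ sb; apply: (controls_left cH as_ sb (lexx b)).
rewrite (gt_eqF (le_lt_trans ap pq)) (lt_eqF (lt_le_trans pq qb)).
have [pa|pa] := eqVneq p a; have [qb'|qb'] := eqVneq q b.
- rewrite pa qb'; have := Psi_triangle (u a) (ur a) (u b).
  have := Psi_triangle (ur a) (ul b) (u b); lra.
- have := Rr q; rewrite -pa => /(_ pq qb); have := Psi_triangle (u p) (ur p) (u q); lra.
- have := L p ap; rewrite -qb' => /(_ pq); have := Psi_triangle (u p) (ul q) (u q); lra.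
- exact: cH.
Qed.

End controlled_variation.

Section jump_variation.
Context {R : realType} {V : completeNormedModType R} (Psi : V -> R) (T : R).
Hypothesis Psi_potential : dissipation_potential Psi.
Hypothesis Psi_homogeneous : positively_homogeneous Psi.
Variables (x : R -> V) (G : R -> R) (cost : R -> V -> V -> \bar R).
Hypothesis x_control : forall r s : R, 0 <= r -> r < s -> s <= T -> Psi (x s - x r) <= G s - G r.
Hypothesis x_left : forall t : R, 0 < t -> t <= T -> x s @[s --> t^'-] --> left_lim x t.
Hypothesis x_right : forall t : R, 0 <= t -> t < T -> x s @[s --> t^'+] --> right_lim T x t.
Hypothesis cost_left : forall t L : R, 0 < t -> t <= T -> G s @[s --> t^'-] --> L ->
  (cost t (left_lim x t) (x t) <= (G t - L)%:E)%E.
Hypothesis cost_right : forall t L : R, 0 <= t -> t < T -> G s @[s --> t^'+] --> L ->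
  (cost t (x t) (right_lim T x t) <= (L - G t)%:E)%E.

Lemma Var_Psi_le (a b : R) : 0 <= a -> b <= T -> (Var_Psi Psi x a b <= (G b - G a)%:E)%E.
Proof.
move=> a0 bT; apply: ge_ereal_sup => _ [s abs <-]; rewrite lee_fin.
apply: controls_variation abs => p q ap pq qb.
by apply: x_control => //; [exact: le_trans ap|exact: le_trans bT].
Qed.

(** By [variation_off_jumps] the inequality holds with sums over finitely many
jumps, in the form: variation plus jumps of [G] at most [G b - G a] plus
[Psi]-jumps.  The costs are bounded by the jumps of [G], and the supremum over
finite sets gives the general case. *)
Theorem jump_corrected_variation_le (a b : R) : 0 <= a -> a < b -> b <= T ->
  (Var_Psi Psi x a b - Jmp_Psi T Psi x a b + Jmp T cost x a b <= (G b - G a)%:E)%E.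
Proof.
move=> a0 ab bT.
have Gnd (r s : R) : 0 <= r -> r <= s -> s <= T -> G r <= G s.
  move=> r0; rewrite le_eqVlt => /predU1P[->//|rs] sT.
  have := x_control r0 rs sT; have := dp_ge0 Psi_potential (x s - x r); lra.
have /choice[Gl GlP] : forall t : R, exists l : R, 0 < t -> t <= T -> G s @[s --> t^'-] --> l.
  move=> t; have [[t0 tT]|nt] := pselect (0 < t /\ t <= T); last first.
    by exists 0 => t0 tT; exfalso; apply: nt.
  by have [l [cl _ _]] := nondecreasing_left_limit Gnd t0 tT; exists l.
have /choice[Gr GrP] : forall t : R, exists l : R, 0 <= t -> t < T -> G s @[s --> t^'+] --> l.
  move=> t; have [[t0 tT]|nt] := pselect (0 <= t /\ t < T); last first.
    by exists 0 => t0 tT; exfalso; apply: nt.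
  by have [l [cl _ _]] := nondecreasing_right_limit Gnd t0 tT; exists l.
have aT : a < T by exact: lt_le_trans bT.
have b0 : 0 < b by exact: le_lt_trans ab.
have cG : controls Psi a b x G.
  move=> p q ap pq qb.
  by apply: x_control => //; [exact: le_trans ap|exact: le_trans bT].
pose H t := if t == a then Gr a - Psi (right_lim T x a - x a)
    else if t == b then Gl b + Psi (x b - left_lim x b) else G t.
have cH : controls Psi a b x H.
  by apply: (controls_open Psi_potential Psi_homogeneous) => //;
    [exact: x_right|exact: GrP|exact: x_left|exact: GlP].
have Ha : H a = Gr a - Psi (right_lim T x a - x a) by rewrite /H eqxx.
have Hb : H b = Gl b + Psi (x b - left_lim x b) by rewrite /H gt_eqF// eqxx.
set X := jump_set T x `&` `]a, b[.
pose J t := Psi (x t - left_lim x t) + Psi (right_lim T x t - x t).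
have XT t : X t -> [/\ a < t, t < b, 0 < t & t < T].
  move=> [_]; rewrite /= in_itv/= => /andP[at_ tb]; split => //.
    exact: le_lt_trans at_.
  exact: lt_le_trans bT.
have key (F : set R) (s : seq R) : finite_set F -> F `<=` X -> itv_partition a b s ->
    Psi_variation a b Psi x s <= (H b - H a) - \sum_(i <- fset_set F) (Gr i - Gl i - J i).
  move=> finF FX abs.
  have FI i : i \in fset_set F -> [/\ a < i, i < b, 0 < i & i < T].
    by rewrite in_fset_set// => /set_mem/FX/XT.
  apply: (variation_off_jumps Psi_potential Psi_homogeneous (ul := left_lim x) (ur := right_lim T x)) => //.
  - exact: fset_uniq.
  - by move=> i /FI[-> ->].
  - by move=> i /FI[ai ib i0 iT]; split; [apply: x_left => //; exact: ltW|apply: x_right => //; exact: ltW].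
  move=> i /FI[ai ib i0 iT].
  have nH : \forall t \near i, H t = G t.
    near=> t; rewrite /H gt_eqF ?lt_eqF//.
      by near: t; exact: lt_nbhsl ib.
    by near: t; exact: lt_nbhsr ai.
  split.
    apply: cvg_trans (GlP i i0 (ltW iT)); apply: near_eq_cvg.
    by apply: cvg_within; apply: filterS nH.
  apply: cvg_trans (GrP i (ltW i0) iT); apply: near_eq_cvg.
  by apply: cvg_within; apply: filterS nH.
rewrite /Jmp_Psi /Jmp -/X.
set S := (\esum_(t in X) _)%E.
have S0 : (0 <= S)%E.
  by apply: esum_ge0 => t _; rewrite -EFinD lee_fin addr_ge0// (dp_ge0 Psi_potential).
have [v vE] : exists v, Var_Psi Psi x a b = v%:E.
  have h1 : (Var_Psi Psi x a b < +oo)%E by apply: le_lt_trans (Var_Psi_le a0 bT) _; rewrite ltry.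
  have h2 : (-oo < Var_Psi Psi x a b)%E.
    apply: lt_le_trans (ltNyr (Psi_variation a b Psi x [:: b])) _.
    by apply: ereal_sup_ubound; exists [:: b] => //; exact: itv_partition1.
  by move: h1 h2; case: (Var_Psi _ _ _ _) => // v; exists v.
(* If the Psi-jumps had an infinite sum, the left side would be -oo. *)
rewrite vE; case SE : S S0 => [j| |]// j0; last first.
  by rewrite -EFinD addey// addeNy addNye leNye.
have sumJ (F : set R) : finite_set F -> F `<=` X -> \sum_(i <- fset_set F) J i <= j.
  move=> finF FX; rewrite -lee_fin -SE -sumEFin.
  apply: ereal_sup_ubound; exists F => //.
  by rewrite fsbig_finite.
have costX : (\esum_(t in X) (cost t (left_lim x t) (x t) + cost t (x t) (right_lim T x t))
    <= ((H b - H a) - v + j)%:E)%E.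
  apply: ge_ereal_sup => _ [F [finF FX] <-]; rewrite fsbig_finite//=.
  apply: (@le_trans _ _ (\sum_(i <- fset_set F) (Gr i - Gl i))%:E).
    rewrite -sumEFin big_seq [leRHS]big_seq; apply: lee_sum => i.
    rewrite in_fset_set// => /set_mem/FX/XT[ai ib i0 iT].
    apply: le_trans (leeD (cost_left i0 (ltW iT) (GlP i i0 (ltW iT)))
      (cost_right (ltW i0) iT (GrP i (ltW i0) iT))) _.
    by rewrite -EFinD lee_fin; lra.
  rewrite lee_fin.
  have : (v%:E <= ((H b - H a) - \sum_(i <- fset_set F) (Gr i - Gl i - J i))%:E)%E.
    by rewrite -vE; apply: ge_ereal_sup => _ [s abs <-]; rewrite lee_fin; exact: key.
  rewrite lee_fin sumrB; have := sumJ F finF FX; lra.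
have ca := cost_right a0 aT (GrP a a0 aT).
have cb := cost_left b0 bT (GlP b b0 bT).
apply: le_trans (leeD (lexx _) (leeD (leeD ca cb) costX)) _.
by rewrite -!EFinD lee_fin Ha Hb; lra.
Unshelve. all: by end_near. Qed.

End jump_variation.

(** * Passage to the limit in the dissipation *)

Lemma total_dissipation_limit {R : realType} {V : normedModType R} (Psi Phi : V -> R)
    (eps : nat -> R) (u : nat -> R -> V) (xi : nat -> R -> V -> R^o) (A : nat -> R -> R)
    (G : R -> R) (r s : R) :
  (forall n, total_dissipation Psi Phi (eps n) (u n) (xi n) r s = (A n s - A n r)%:E) ->
  A n r @[n --> \oo] --> G r -> A n s @[n --> \oo] --> G s ->
  limn_einf (fun n => total_dissipation Psi Phi (eps n) (u n) (xi n) r s) = (G s - G r)%:E.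
Proof.
move=> dA Ar As; rewrite (_ : (fun n => _) = (fun n => (A n s - A n r)%:E)); last exact/funext.
have c : (A n s - A n r)%:E @[n --> \oo] --> (G s - G r)%:E.
  by apply: cvg_EFin; [exact: nearW|exact: cvgB].
by have [-> _] := cvg_limn_einf_sup c.
Qed.

Theorem proposition7p3 (R : realType) (V : completeNormedModType R)
    (V_separable : separable V) (V_RNP : radon_nikodym_property V)
    (T : R) (T_gt0 : 0 < T)
    (Psi Phi : V -> R)
    (Psi_potential : dissipation_potential Psi)
    (Psi_homogeneous : positively_homogeneous Psi)
    (Phi_potential : dissipation_potential Phi)
    (F : R -> R) (F_profile : viscous_profile F)
    (Phi_F : forall v, Phi v = F `|v|)
    (D : set V) (En : R -> V -> R)
    (En_admissible : admissible_energy Psi T D En)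
    (E C : R) (E_gt0 : 0 < E) (C_gt0 : 0 < C)
    (u w : nat -> R -> V) (xi : nat -> R -> V -> R^o) (eps : nat -> R)
    (u_AC : forall n, ac_norm 0 T (u n))
    (w_sublevel : forall n t, t \in `[0, T] -> sublevel Psi T D En E (w n t))
    (w_measurable : forall n, lebesgue_measurable_on `[0, T] (w n))
    (xi_dual : forall n t, t \in `[0, T] -> dual (xi n t))
    (xi_measurable : forall n, weakstar_measurable_on `[0, T] (xi n))
    (eps_gt0 : forall n, 0 < eps n)
    (dissipation_le : forall n,
       (total_dissipation Psi Phi (eps n) (u n) (xi n) 0 T <= C%:E)%E)
    (xi_subdiff : forall n, {ae @lebesgue_measure R, forall t,
       t \in `]0, T[ -> subdiff D En t (w n t) (- xi n t)})
    (u_w_close :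
       ereal_sup [set (`|u n t - w n t|)%:E | t in `[0, T]] @[n --> \oo]
         --> 0%E)
    (eps_noninc : nonincreasing_seq eps) (eps_cvg0 : eps n @[n --> \oo] --> 0) :
  exists (phi : nat -> nat) (ulim : R -> V),
    [/\ increasing_seq phi,
        BV_Psi T (sublevel Psi T D En E) Psi ulim,
        forall t, t \in `[0, T] -> u (phi k) t @[k --> \oo] --> ulim t,
        forall t, t \in `[0, T] -> ~ jump_set T ulim t ->
          locally_stable Psi D En t (ulim t) &
        forall r s, 0 <= r -> r < s -> s <= T ->
          (Var_f Psi T D En ulim r s <=
             limn_einf (fun k => total_dissipation Psi Phi (eps (phi k))
                                   (u (phi k)) (xi (phi k)) r s))%E].
Proof.
have /choice[A AP] := fun n => dissipation_controlled V_RNP T_gt0 Psi_potential Psi_homogeneous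
  F_profile Phi_F (eps_gt0 n) (u_AC n) (w_sublevel n) (xi_dual n) (dissipation_le n) (xi_subdiff n).
have ctlA n : controlled Psi T D En E (u n) (w n) (A n) by have [] := AP n.
have A0 n : A n 0 = 0 by have [] := AP n.
have Adiss n (r s : R) : 0 <= r -> r <= s -> s <= T ->
    total_dissipation Psi Phi (eps n) (u n) (xi n) r s = (A n s - A n r)%:E.
  by have [_ _ + _] := AP n; apply.
have AC n : A n T <= C.
  have := dissipation_le n; rewrite Adiss ?(ltW T_gt0)// lee_fin A0; lra.
pose sup n := ereal_sup [set (`|u n t - w n t|)%:E | t in `[0, T]].
have sup_ge0 n : (0 <= sup n)%E.
  apply: (@le_trans _ _ (`|u n 0 - w n 0|)%:E); first by rewrite lee_fin.
  by apply: ereal_sup_ubound; exists 0 => //=; rewrite in_itv/= lexx ltW.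
(* The distance of the n-th curves may be infinite for small n; the sequence is
   shifted so that it is finite throughout. *)
have [N _ supN] : \forall n \near \oo, (sup n < 1)%E.
  have /fine_cvgP[fn cn] := u_w_close.
  have c1 : \forall n \near \oo, fine (sup n) < 1 by move/cvgr_lt : cn; apply.
  near=> n; have h : sup n \is a fin_num by near: n; exact: fn.
  by rewrite -(fineK h) lte_fin; near: n; exact: c1.
pose sh n := (n + N)%N.
have shN n : (sup (sh n) < 1)%E by apply: supN; rewrite /= leq_addl.
have close n (t : R) : t \in `[0, T] -> `|u (sh n) t - w (sh n) t| <= fine (sup (sh n)).
  move=> tT; rewrite -lee_fin fineK; first by apply: ereal_sup_ubound; exists t.
  by rewrite ge0_fin_numE// (lt_trans (shN n)) ?ltry.
have sh_oo : sh n @[n --> \oo] --> \oo.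
  by apply: increasing_cvg_oo; apply/increasing_seqP => n; rewrite /sh ltEnat/= ltn_add2r.
have d0 : fine (sup (sh n)) @[n --> \oo] --> (0 : R).
  have /fine_cvgP[_ cn] := u_w_close; exact: (cvg_comp _ _ sh_oo cn).
have [psi [G [x [psi_incr AG ux]]]] := helly_selection Psi_potential En_admissible E_gt0
  (fun n => ctlA (sh n)) close d0 (fun n => A0 (sh n)) (fun n => AC (sh n)).
have psi_oo := increasing_cvg_oo psi_incr.
pose phi k := sh (psi k).
have phi_oo : phi k @[k --> \oo] --> \oo by exact: (cvg_comp _ _ psi_oo sh_oo).
have ctl k := ctlA (phi k).
have cl k (t : R) : t \in `[0, T] -> `|u (phi k) t - w (phi k) t| <= fine (sup (phi k)).
  exact: close.
have d1 : fine (sup (phi k)) @[k --> \oo] --> (0 : R) by exact: (cvg_comp _ _ psi_oo d0).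
have e1 : eps (phi k) @[k --> \oo] --> (0 : R) by exact: (cvg_comp _ _ phi_oo eps_cvg0).
have xG := limit_control Psi_potential ctl AG ux.
have xl := limit_cvg_left Psi_potential Psi_homogeneous En_admissible E_gt0 ctl cl d1 AG ux.
have xr := limit_cvg_right Psi_potential Psi_homogeneous En_admissible E_gt0 ctl cl d1 AG ux.
have AC' k : A (phi k) T - A (phi k) 0 <= C by rewrite A0 subr0; exact: AC.
have blowup (c : R) : 0 < c -> exists2 k : R, 0 < k &
    forall n (r s : R), 0 <= r -> r < s -> s <= T ->
      (forall t : R, t \in `[r, s] -> (c%:E < stability_gap Psi D En t (w (phi n) t))%E) ->
      k / eps (phi n) * (s - r) <= A (phi n) s - A (phi n) r.
  move=> c0; have [k k0 kP] := contact_blowup Psi_potential Psi_homogeneous F_profile Phi_F D En c0.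
  exists k => // n r s r0 rs sT h; have [_ _ _ hA] := AP (phi n).
  by apply: (hA c k r s) => //; [move=> t z v; exact: kP|exact: ltW].
have stab := stable_off_jumps T_gt0 Psi_potential Psi_homogeneous En_admissible E_gt0 ctl cl d1 AG ux
  (fun k => eps_gt0 (phi k)) e1 AC' blowup.
exists phi, x; split.
- by apply/increasing_seqP => k; move/increasing_seqP : psi_incr => /(_ k); rewrite /phi /sh ltEnat /= ltn_add2r.
- split; first exact: (limit_sublevel En_admissible E_gt0 ctl cl d1 ux).
  by apply: le_lt_trans (Var_Psi_le xG (lexx 0) (lexx T)) _; rewrite ltry.
- exact: ux.
- exact: stab.
move=> r s r0 rs sT.
have rT : r \in `[0, T] by rewrite in_itv/= r0 (le_trans (ltW rs)).
have sT' : s \in `[0, T] by rewrite in_itv/= sT (le_trans r0 (ltW rs)).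
have lim_eq : limn_einf (fun k => total_dissipation Psi Phi (eps (phi k)) (u (phi k)) (xi (phi k)) r s)
    = (G s - G r)%:E.
  apply: (total_dissipation_limit (A := fun k => A (phi k)) _ (AG r rT) (AG s sT')) => k.
  exact: (Adiss (phi k) r s r0 (ltW rs) sT).
rewrite lim_eq; apply: jump_corrected_variation_le => //.
- exact: (left_jump_cost V_RNP Psi_potential Psi_homogeneous En_admissible E_gt0 ctl cl d1 AG ux).
- exact: (right_jump_cost V_RNP Psi_potential Psi_homogeneous En_admissible E_gt0 ctl cl d1 AG ux).
Unshelve. all: by end_near. Qed.
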